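(* For $p\in\mathbb{Z}$, $n\in\mathbb{N}$ with $n\ge2$ and $\eta=e^{\pi i/n}$, $$\mathcal{Z}_{2p+1}\sum_{m\in\mathbb{Z}\setminus\{0\}}\frac{(-1)^m}{\left(\prod_{j=1}^{n-1}\sinh\left(m\pi i\eta^j\right)\right)m^{2p+1-n}}=-\frac{2^{n-1}(2\pi i)^{2p+1-n}}{\eta^{n(n-1)/2}}\sum_{\substack{m_1,\ldots,m_n\ge0\\ m_1+\cdots+m_n=p}}\ \prod_{\nu=1}^n\frac{B_{2m_\nu}(1/2)}{(2m_\nu)!}\eta^{2(\nu-1)m_\nu}.$$ Furthermore, if $p\ge n/2$, then both sides are equal to $$\frac{(2\pi i)^{2p+1-n}(-1)^{1-n}2^{n-1}}{(2p-n)!}\,\zeta_n\bigl(n-2p,\ 1/(1-\eta);\ 1,\eta,\ldots,\eta^{n-1}\bigr).$$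
   Context: For an integer $h$, $$\mathcal{Z}_h=\sum_{j=0}^{n-1}\eta^{j(1-h)}=\begin{cases}n&\text{if } h\equiv1\ (\mathrm{mod}\ 2n),\\0&\text{if } h\not\equiv1\ (\mathrm{mod}\ 2n)\text{ and } 2\nmid h,\\\dfrac{2}{1-\eta^{1-h}}&\text{if } h\not\equiv1\ (\mathrm{mod}\ 2n)\text{ and } 2\mid h.\end{cases}$$ $B_j(y)$ is the $j$th Bernoulli polynomial: $\dfrac{te^{ty}}{e^t-1}=\sum_{j=0}^\infty B_j(y)\dfrac{t^j}{j!}$. An empty sum is $0$. For $\theta\in\mathbb{R}$ let $H(\theta)=\{re^{i(\theta+\phi)} : r>0,\ -\pi/2<\phi<\pi/2\}$. For $a,\omega_1,\ldots,\omega_n\in H(\theta)$, the Barnes zeta-function is $$\zeta_n(s,a;\omega_1,\ldots,\omega_n)=\sum_{m_1=0}^\infty\cdots\sum_{m_n=0}^\infty\frac{1}{(a+\omega_1m_1+\cdots+\omega_nm_n)^s}\qquad(\Re s>n),$$ with $x^{-s}$ for $x\in H(\theta)$ taken with $\arg x\in(\theta-\pi/2,\theta+\pi/2)$; it is continued meromorphically to all $s\in\mathbb{C}$, and $\zeta_n$ denotes this continuation. Here $1,\eta,\ldots,\eta^{n-1}$ and $1/(1-\eta)=\frac12\sum_{j=0}^{n-1}\eta^j$ lie in $H(\theta_n)$ with $\theta_n=\pi/2-\pi/(2n)$. *)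

(* Defs.v *)
From HB Require Import structures.
From mathcomp Require Import all_boot all_order all_algebra finmap.
From mathcomp Require Import all_classical all_reals all_analysis.
From mathcomp Require Export complex.
From mathcomp.analysis.showcase Require Export summability.
Set Implicit Arguments.
Unset Strict Implicit.
Unset Printing Implicit Defensive.
Import Order.TTheory GRing.Theory Num.Theory.
Import numFieldNormedType.Exports.
Local Open Scope classical_set_scope.
Local Open Scope ring_scope.

Section ComplexFunctions.
Variable R : realType.
Local Notation C := R[i].

Definition expC (z : C) : C :=
  (expR (complex.Re z))%:C%C * (cos (complex.Im z) +i* sin (complex.Im z))%C.

Definition sinhC (z : C) : C := (expC z - expC (- z)) / 2%:R.

Definition rnorm (z : C) : R := complex.Re `|z|.

(* The filter [totally] ranges over the finite subsets of [I], so that [csum]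
   is the unconditional sum of the family, irrespective of the order of its terms. *)
Definition csummable (I : choiceType) (u : I -> C) : Prop :=
  cvg (partial_sum (u : I -> C^o) @ totally).
Definition csum (I : choiceType) (u : I -> C) : C :=
  summability.sum (u : I -> C^o).

Definition holomorphic_near (F : set_system C^o) (f : C -> C) : Prop :=
  \forall z \near F, derivable (f : C^o -> C^o) z 1.

(* Removable singularities are excluded: wherever a meromorphic [f] has no
   pole, [f z] is the value of the holomorphic function.  The value at a pole
   is unconstrained. *)
Definition meromorphic (f : C -> C) : Prop := forall z : C^o,
  holomorphic_near (nbhs z) f \/
  (holomorphic_near z^' f /\ rnorm (f w) @[w --> z^'] --> +oo).

Definition bernoulli_generating (B : nat -> {poly C}) : Prop :=
  forall y : C, \forall t \near (0 : C^o)^',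
    series (fun j => (B j).[y] * (t ^+ j / (j`!)%:R) : C^o) @ \oo -->
      (t * expC (t * y) / (expC t - 1) : C^o).

Definition bernoulli_poly : nat -> {poly C} :=
  xget (fun=> 0) [set B | bernoulli_generating B].

(* The argument, in (theta - pi/2, theta + pi/2), of a point [x] of the open half-plane
   H(theta) = {r e^(i (theta + phi)) | r > 0, -pi/2 < phi < pi/2}. *)
Definition arg_halfplane (theta : R) (x : C) : R :=
  xget 0 [set alpha | theta - pi / 2 < alpha < theta + pi / 2 /\
                      x = `|x| * expC ('i%C * alpha%:C%C)].

Definition pow_halfplane (theta : R) (x s : C) : C :=
  expC (s * ((ln (rnorm x))%:C%C + 'i%C * (arg_halfplane theta x)%:C%C)).

(* As in the definition of the Barnes zeta-function, [a] and the [omega i] are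
   meant to lie in H(theta); every [a + \sum_i omega i * m_i] then does too. *)
Section Barnes.
Variables (theta : R) (n : nat) (a : C) (omega : 'I_n -> C).

Definition barnes_series (s : C) : C :=
  csum (fun m : {ffun 'I_n -> nat} =>
    pow_halfplane theta (a + \sum_(i < n) omega i * (m i)%:R) (- s)).

Definition barnes_continuation (f : C -> C) : Prop :=
  meromorphic f /\
  (forall s : C, n%:R < complex.Re s -> f s = barnes_series s).

Definition barnes_zeta : C -> C :=
  xget (fun=> 0) [set f | barnes_continuation f].

End Barnes.

Definition eta_root (n : nat) : C := expC ((pi / n%:R)%:C%C * 'i%C).

Definition Zcal (n : nat) (h : int) : C :=
  \sum_(j < n) eta_root n ^ (j%:Z * (1 - h)).

End ComplexFunctions.

Arguments bernoulli_poly {R} j : rename.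
Arguments eta_root {R} n.
Arguments Zcal {R} n h.

(* Main.v *)
(** Put [G t = t ^ (n - 2 p) / \prod_(0 <= j < n) sinh (eta ^ j t)].  If [eta ^ (2 p) <> 1], both
    sides vanish: [Zcal] is a geometric sum, and the sum over the Bernoulli products is, up to a
    factor, the coefficient of [t ^ (2 p)] in [\prod_j eta ^ j t / sinh (eta ^ j t)], a function
    invariant under [t -> eta t].  If [eta ^ (2 p) = 1], [G] is itself invariant, so that its mean
    over the arc of radius [r] in a sector of angle [pi / n] around the imaginary axis depends on
    [r] only through a jump, given by the residue, at each pole [i pi k].  This mean tends to [0]
    along [r = pi (N + 1 / 2)], and for small [r] it is the constant coefficient of [G] at [0];
    hence the sum of the residues.

    For the Barnes zeta-function let [D] be the derivation in [x], and let [c] be the coefficients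
    of [t ^ n / \prod_i (1 - exp (omega_i t))].  The operator [T = \prod_i (1 - exp (omega_i D))]
    sends [P = \sum_(k < K) c_k D ^ (k - n) x ^ (- s)] to [x ^ (- s)] up to a remainder [O(x ^ (n - s - K))],
    and [T P] telescopes over the lattice.  So [P a] minus the lattice sum of the remainder
    continues the series, and at a nonpositive integer [s] the remainder is zero for large [K],
    which leaves a coefficient of [t ^ n exp (a t) / \prod_i (1 - exp (omega_i t))].  For
    [a = 1 / 2 \sum_i omega_i] this is a product of functions [t / sinh t].  A vanishing argument along
    a segment shows that any meromorphic continuation takes this value. *)

Require Import Defs.
From HB Require Import structures.
From mathcomp Require Import all_boot all_order all_algebra finmap.
From mathcomp Require Import all_classical all_reals all_analysis.
From mathcomp Require Import ring lra zify.
Set Implicit Arguments.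
Unset Strict Implicit.
Unset Printing Implicit Defensive.
Import Order.TTheory GRing.Theory Num.Theory.
Import numFieldNormedType.Exports.
Local Open Scope classical_set_scope.
Local Open Scope ring_scope.

(** * Complex differentiation and integration *)

Section Modulus.
Variable R : realType.
Local Notation C := R[i].
Implicit Types (x y z w : C).

(** All the analysis rests on Goursat's lemma, proved for rectangles only. Annuli and sectors are
    pulled back to rectangles by [expC]: a mean over an arc becomes a vertical integral, and
    rotation by [eta] a translation that makes the two horizontal sides cancel. The lemma admits
    finitely many points where the function is merely continuous; applied to difference quotients
    this gives Cauchy's formula, and Taylor expansions and removability follow. In the residue count
    each pole is first removed by subtracting an invariant rational function with the same residue,
    whose mean is known on both sides of the pole; no contour ever encircles a pole. Bernoulli
    polynomials, arguments, infinite sums and the Barnes zeta-function are all obtained by choice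
    with a default value, so existence must be established before any of them can be computed. For
    the Barnes function this includes the case of a cancelled pole, since the value at a removable
    singularity is prescribed. *)

Lemma rnormE z : `|z| = (rnorm z)%:C%C.
Proof. by rewrite /rnorm normc_def. Qed.

Lemma rnorm_ge0 z : 0 <= rnorm z.
Proof. by rewrite -ler0c -rnormE. Qed.

Lemma rnorm_sqrt z : rnorm z = Num.sqrt (complex.Re z ^+ 2 + complex.Im z ^+ 2).
Proof. by rewrite /rnorm normc_def. Qed.

Lemma ler_rnormD x y : rnorm (x + y) <= rnorm x + rnorm y.
Proof. by rewrite -lecR rmorphD /= -!rnormE ler_normD. Qed.

Lemma rnormM x y : rnorm (x * y) = rnorm x * rnorm y.
Proof. by apply: (@complexI R); rewrite rmorphM /= -!rnormE normrM. Qed.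

Lemma rnormN x : rnorm (- x) = rnorm x.
Proof. by rewrite /rnorm normrN. Qed.

Lemma rnormBC x y : rnorm (x - y) = rnorm (y - x).
Proof. by rewrite -rnormN opprB. Qed.

Lemma ler_rnormB x y : rnorm (x - y) <= rnorm x + rnorm y.
Proof. by rewrite -(rnormN y) ler_rnormD. Qed.

Lemma lerB_rnormD x y : rnorm x - rnorm y <= rnorm (x + y).
Proof. by rewrite lerBlDr -(rnormN y) (le_trans _ (ler_rnormD _ _))// addrK. Qed.

Lemma lerB_rnorm x y : rnorm x - rnorm y <= rnorm (x - y).
Proof. by rewrite -(rnormN y) lerB_rnormD. Qed.

Lemma rnormV x : rnorm x^-1 = (rnorm x)^-1.
Proof.
apply: (@complexI R).
by rewrite -!rnormE normfV rnormE [RHS](fmorphV (real_complex R)).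
Qed.

Lemma rnorm0 : rnorm (0 : C) = 0.
Proof. by rewrite /rnorm normr0. Qed.

Lemma rnorm1 : rnorm (1 : C) = 1.
Proof. by rewrite /rnorm normr1. Qed.

Lemma rnormX x k : rnorm (x ^+ k) = rnorm x ^+ k.
Proof. by elim: k => [|k IH]; rewrite ?expr0 ?rnorm1// !exprS rnormM IH. Qed.

Lemma rnorm_real (t : R) : rnorm t%:C%C = `|t|.
Proof. by rewrite rnorm_sqrt /= expr0n /= addr0 sqrtr_sqr. Qed.

Lemma rnorm_nat k : rnorm (k%:R : C) = k%:R.
Proof. by rewrite -(rmorph_nat (real_complex R)) rnorm_real ger0_norm. Qed.

Lemma rnorm_i : rnorm ('i%C : C) = 1.
Proof. by rewrite rnorm_sqrt /= expr0n /= add0r expr1n sqrtr1. Qed.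

Lemma rnorm_eq0 x : (rnorm x == 0) = (x == 0).
Proof.
by rewrite -[in RHS]normr_eq0 rnormE -(inj_eq (@complexI R)).
Qed.

Lemma rnorm_gt0 x : (0 < rnorm x) = (x != 0).
Proof. by rewrite lt_def rnorm_eq0 rnorm_ge0 andbT. Qed.

Lemma ler_Re_rnorm x : `|complex.Re x| <= rnorm x.
Proof. by rewrite -lecR -rnormE normc_ge_Re. Qed.

Lemma ler_Im_rnorm x : `|complex.Im x| <= rnorm x.
Proof. by rewrite rnorm_sqrt -sqrtr_sqr ler_wsqrtr// lerDr sqr_ge0. Qed.

Lemma ler_rnorm_ReIm x : rnorm x <= `|complex.Re x| + `|complex.Im x|.
Proof.
rewrite rnorm_sqrt -(ger0_norm (addr_ge0 (normr_ge0 _) (normr_ge0 _))).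
rewrite -sqrtr_sqr ler_wsqrtr// sqrrD !real_normK ?num_real//.
by rewrite lerD2r lerDl mulrn_wge0// mulr_ge0.
Qed.

Lemma ler_rnorm_sum I (r : seq I) (P : pred I) (F : I -> C) :
  rnorm (\sum_(i <- r | P i) F i) <= \sum_(i <- r | P i) rnorm (F i).
Proof.
elim/big_rec2: _ => [|i y x _ h]; first by rewrite rnorm0.
by apply: le_trans (ler_rnormD _ _) _; rewrite lerD2l.
Qed.

Lemma rnorm_prod I (r : seq I) (P : pred I) (F : I -> C) :
  rnorm (\prod_(i <- r | P i) F i) = \prod_(i <- r | P i) rnorm (F i).
Proof. by apply: (big_morph _ rnormM rnorm1). Qed.

End Modulus.

Section Differentiability.
Variable R : realType.
Local Notation C := R[i].
Implicit Types (D : C -> Prop) (f g : C -> C) (z w d : C).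

(** Free of division and relative to a set [D], so that Goursat's lemma can be stated on a closed
    rectangle, boundary included. All moduli are real numbers; [derivable_cdiff] compares this
    notion with [derivable]. *)
Definition has_cderiv D f z d := forall e : R, 0 < e -> exists2 r : R, 0 < r &
  forall w, D w -> rnorm (w - z) < r ->
    rnorm (f w - f z - d * (w - z)) <= e * rnorm (w - z).

Definition ccont D f z := forall e : R, 0 < e -> exists2 r : R, 0 < r &
  forall w, D w -> rnorm (w - z) < r -> rnorm (f w - f z) < e.

Definition cdiff D f z := exists d, has_cderiv D f z d.

Local Notation all := (fun=> True).

Lemma has_cderivW D D' f z d : (forall w, D' w -> D w) ->
  has_cderiv D f z d -> has_cderiv D' f z d.
Proof.
move=> DD' h e e0; have [r r0 hr] := h e e0.
by exists r => // w /DD'; exact: hr.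
Qed.

Lemma has_cderiv_eq_near D f g z d (r : R) : 0 < r ->
  (forall w, D w -> rnorm (w - z) < r -> f w = g w) -> f z = g z ->
  has_cderiv D f z d -> has_cderiv D g z d.
Proof.
move=> r0 fg fgz h e e0; have [r1 r10 hr] := h e e0.
exists (Num.min r r1); first by rewrite lt_min r0.
move=> w Dw; rewrite lt_min => /andP[wr wr1].
by rewrite -fg// -fgz; exact: hr.
Qed.

Lemma cderiv_ccont D f z d : has_cderiv D f z d -> ccont D f z.
Proof.
move=> h e e0; have [r r0 hr] := h 1 ltr01.
have k0 : 0 < rnorm d + 1 by rewrite ltr_pwDr// rnorm_ge0.
exists (Num.min r (e / (rnorm d + 1) / 2)); first by rewrite lt_min r0 !divr_gt0.
move=> w Dw; rewrite lt_min => /andP[wr we].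
have := hr w Dw wr; rewrite mul1r => h1.
have -> : f w - f z = (f w - f z - d * (w - z)) + d * (w - z) by ring.
apply: le_lt_trans (ler_rnormD _ _) _; rewrite rnormM.
apply: (@le_lt_trans _ _ ((rnorm d + 1) * rnorm (w - z))).
  by rewrite mulrDl mul1r addrC lerD2l.
rewrite -ltr_pdivlMl//; apply: lt_trans we _.
by rewrite [ltRHS]mulrC gtr_pMr ?invf_lt1 ?ltr1n// mulr_gt0// invr_gt0.
Qed.

Lemma cdiff_ccont D f z : cdiff D f z -> ccont D f z.
Proof. by case=> d /cderiv_ccont. Qed.

Lemma has_cderiv_cst D (c : C) z : has_cderiv D (fun=> c) z 0.
Proof.
move=> e e0; exists 1 => // w _ _; rewrite subrr mul0r subr0 rnorm0.
by rewrite mulr_ge0 ?rnorm_ge0 ?ltW.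
Qed.

Lemma has_cderiv_id D z : has_cderiv D id z 1.
Proof.
move=> e e0; exists 1 => // w _ _; rewrite mul1r subrr rnorm0.
by rewrite mulr_ge0 ?rnorm_ge0 ?ltW.
Qed.

Lemma has_cderivD D f g z d d' : has_cderiv D f z d -> has_cderiv D g z d' ->
  has_cderiv D (fun w => f w + g w) z (d + d').
Proof.
move=> hf hg e e0; have e20 : 0 < e / 2 by rewrite divr_gt0.
have [r r0 hr] := hf _ e20; have [r' r'0 hr'] := hg _ e20.
exists (Num.min r r'); first by rewrite lt_min r0.
move=> w Dw; rewrite lt_min => /andP[wr wr'].
have -> : f w + g w - (f z + g z) - (d + d') * (w - z) =
  (f w - f z - d * (w - z)) + (g w - g z - d' * (w - z)) by ring.
apply: le_trans (ler_rnormD _ _) _.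
by rewrite (splitr e) mulrDl lerD ?hr ?hr'.
Qed.

Lemma has_cderivM D f g z d d' : has_cderiv D f z d -> has_cderiv D g z d' ->
  has_cderiv D (fun w => f w * g w) z (d * g z + f z * d').
Proof.
move=> hf hg e e0.
pose A := rnorm (f z) + rnorm (g z) + rnorm d + 1.
have A0 : 0 < A by rewrite ltr_wpDl// !addr_ge0 ?rnorm_ge0.
(* The error of a product splits into three terms, each at most [e1 * A * rnorm (w - z)]. *)
pose e1 := Num.min 1 (e / (3 * A)).
have e10 : 0 < e1 by rewrite lt_min ltr01 divr_gt0// mulr_gt0.
have [r r0 hr] := hf _ e10; have [r' r'0 hr'] := hg _ e10.
have [r2 r20 hr2] := cderiv_ccont hg e10.
exists (Num.min r (Num.min r' r2)); first by rewrite !lt_min r0 r'0.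
move=> w Dw; rewrite !lt_min => /and3P[wr wr' wr2].
have -> : f w * g w - f z * g z - (d * g z + f z * d') * (w - z) =
  (f w - f z - d * (w - z)) * g w + d * (w - z) * (g w - g z)
  + f z * (g w - g z - d' * (w - z)) by ring.
have h1 := hr w Dw wr; have h2 := hr' w Dw wr'; have h3 := hr2 w Dw wr2.
have gw : rnorm (g w) <= A.
  have -> : g w = g w - g z + g z by ring.
  apply: le_trans (ler_rnormD _ _) _.
  have : rnorm (g w - g z) <= 1 by apply: ltW; apply: lt_le_trans h3 _; rewrite ge_min lexx.
  by rewrite /A; have := rnorm_ge0 (f z); have := rnorm_ge0 d; lra.
have k0 := rnorm_ge0 (w - z).
have e1A : e1 * A * 3 <= e.
  have : e1 <= e / (3 * A) by rewrite /e1 ge_min lexx orbT.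
  by rewrite ler_pdivlMr ?mulr_gt0//; nra.
apply: (@le_trans _ _ (e1 * A * 3 * rnorm (w - z))); last by rewrite ler_wpM2r.
apply: le_trans (ler_rnormD _ _) _.
apply: (@le_trans _ _ (e1 * rnorm (w - z) * A + A * rnorm (w - z) * e1 + A * (e1 * rnorm (w - z)))); last lra.
have dA : rnorm d <= A by rewrite /A; have := rnorm_ge0 (f z); have := rnorm_ge0 (g z); lra.
have fA : rnorm (f z) <= A by rewrite /A; have := rnorm_ge0 d; have := rnorm_ge0 (g z); lra.
apply: lerD; [apply: le_trans (ler_rnormD _ _) _; apply: lerD|]; rewrite !rnormM.
- by apply: ler_pM; rewrite ?rnorm_ge0.
- by apply: ler_pM; rewrite ?mulr_ge0 ?rnorm_ge0 ?ler_wpM2r// ltW.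
- by apply: ler_pM; rewrite ?rnorm_ge0.
Qed.

Lemma has_cderivZ D (c : C) f z d : has_cderiv D f z d ->
  has_cderiv D (fun w => c * f w) z (c * d).
Proof.
move=> hf; have := has_cderivM (has_cderiv_cst D c z) hf.
by rewrite mul0r add0r.
Qed.

Lemma has_cderivB D f g z d d' : has_cderiv D f z d -> has_cderiv D g z d' ->
  has_cderiv D (fun w => f w - g w) z (d - d').
Proof.
move=> hf hg; have := has_cderivD hf (has_cderivZ (-1) hg).
rewrite mulN1r; apply: (@has_cderiv_eq_near _ _ _ _ _ 1) => // [w _ _|]; by rewrite mulN1r.
Qed.

Lemma has_cderiv_comp D D' f g z d d' : (forall w, D w -> D' (f w)) ->
  has_cderiv D f z d -> has_cderiv D' g (f z) d' ->
  has_cderiv D (fun w => g (f w)) z (d' * d).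
Proof.
move=> DD' hf hg e e0.
pose A := rnorm d + rnorm d' + 1.
have A0 : 0 < A by rewrite ltr_wpDl// !addr_ge0 ?rnorm_ge0.
pose e1 := Num.min 1 (e / (2 * A)).
have e10 : 0 < e1 by rewrite lt_min ltr01 divr_gt0// mulr_gt0.
have [r r0 hr] := hf _ e10; have [r' r'0 hr'] := hg _ e10.
have [r2 r20 hr2] := cderiv_ccont hf r'0.
exists (Num.min r r2); first by rewrite !lt_min r0.
move=> w Dw; rewrite !lt_min => /andP[wr wr2].
have h1 := hr w Dw wr; have h3 := hr2 w Dw wr2; have h2 := hr' _ (DD' _ Dw) h3.
have -> : g (f w) - g (f z) - d' * d * (w - z) =
  (g (f w) - g (f z) - d' * (f w - f z)) + d' * (f w - f z - d * (w - z)) by ring.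
have k0 := rnorm_ge0 (w - z).
have fA : rnorm (f w - f z) <= A * rnorm (w - z).
  have -> : f w - f z = (f w - f z - d * (w - z)) + d * (w - z) by ring.
  apply: le_trans (ler_rnormD _ _) _; rewrite rnormM.
  have : e1 * rnorm (w - z) <= 1 * rnorm (w - z).
    by rewrite ler_wpM2r// ge_min lexx.
  by have := rnorm_ge0 d'; rewrite /A; nra.
have e1A : e1 * A * 2 <= e.
  have : e1 <= e / (2 * A) by rewrite /e1 ge_min lexx orbT.
  by rewrite ler_pdivlMr ?mulr_gt0//; nra.
apply: (@le_trans _ _ (e1 * A * 2 * rnorm (w - z))); last by rewrite ler_wpM2r.
apply: le_trans (ler_rnormD _ _) _.
apply: (@le_trans _ _ (e1 * (A * rnorm (w - z)) + A * (e1 * rnorm (w - z)))); last lra.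
apply: lerD.
  by apply: le_trans h2 _; rewrite ler_wpM2l// ltW.
rewrite rnormM; apply: ler_pM; rewrite ?rnorm_ge0// /A.
by have := rnorm_ge0 d; lra.
Qed.

Lemma has_cderiv_inv D z : z != 0 -> has_cderiv D (fun w => w^-1) z (- (z ^- 2)).
Proof.
move=> z0 e e0; have nz : 0 < rnorm z by rewrite rnorm_gt0.
exists (Num.min (rnorm z / 2) (e * rnorm z ^+ 3 / 2)).
  by rewrite lt_min !divr_gt0// mulr_gt0// exprn_gt0.
move=> w _; rewrite lt_min => /andP[h1 h2].
have h3 : rnorm z / 2 <= rnorm w.
  have := lerB_rnorm z (z - w); have -> : z - (z - w) = w by ring.
  by rewrite (rnormBC w z) in h1; lra.
have w0 : w != 0 by rewrite -rnorm_gt0; apply: lt_le_trans h3; rewrite divr_gt0.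
have -> : w^-1 - z^-1 - - z ^- 2 * (w - z) = (w - z) * ((w - z) / (w * z ^+ 2)).
  by field; rewrite z0 w0.
rewrite rnormM mulrC ler_wpM2r ?rnorm_ge0// rnormM rnormV rnormM rnormX.
rewrite ler_pdivrMr; last by rewrite mulr_gt0 ?exprn_gt0// rnorm_gt0.
apply: le_trans (ltW h2) _.
have -> : e * rnorm z ^+ 3 / 2 = e * (rnorm z / 2 * rnorm z ^+ 2) by field.
by rewrite ler_pM2l// ler_wpM2r// exprn_ge0 ?rnorm_ge0.
Qed.

End Differentiability.

Section ComplexIntegral.
Variable R : realType.
Local Notation C := R[i].
Local Notation mu := (@lebesgue_measure R).
Implicit Types (a b c t : R) (g h : R -> C) (k : C).

Definition rcont a b g := forall t, a <= t <= b -> forall e : R, 0 < e ->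
  exists2 r : R, 0 < r & forall u, a <= u <= b -> `|u - t| < r -> rnorm (g u - g t) < e.

Definition cint a b g : C :=
  ((\int[mu]_(t in `[a, b]) complex.Re (g t))%R +i*
   (\int[mu]_(t in `[a, b]) complex.Im (g t))%R)%C.

Lemma Re_add (x y : C) : complex.Re (x + y) = complex.Re x + complex.Re y.
Proof. by case: x; case: y. Qed.
Lemma Im_add (x y : C) : complex.Im (x + y) = complex.Im x + complex.Im y.
Proof. by case: x; case: y. Qed.
Lemma Re_opp (x : C) : complex.Re (- x) = - complex.Re x.
Proof. by case: x. Qed.
Lemma Im_opp (x : C) : complex.Im (- x) = - complex.Im x.
Proof. by case: x. Qed.
Lemma Re_mul (x y : C) : complex.Re (x * y) = complex.Re x * complex.Re y - complex.Im x * complex.Im y.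
Proof. by case: x; case: y. Qed.
Lemma Im_mul (x y : C) : complex.Im (x * y) = complex.Re x * complex.Im y + complex.Im x * complex.Re y.
Proof. by case: x; case: y. Qed.

Lemma rcont_within a b g (p : C -> R) : (forall x y, `|p x - p y| <= rnorm (x - y)) ->
  rcont a b g -> {within `[a, b], continuous (fun t => p (g t))}.
Proof.
move=> pl h; apply/subspace_continuousP => t /=; rewrite in_itv/= => tab.
apply/cvgrPdist_lt => e e0; have [r r0 hr] := h t tab e e0.
apply/nbhs_ballP; exists r => //= u /=.
rewrite /ball /= distrC => ut; rewrite in_itv/= => uab.
by rewrite distrC; apply: le_lt_trans (pl _ _) _; exact: hr.
Qed.

Lemma rcont_integrable a b g (p : C -> R) : (forall x y, `|p x - p y| <= rnorm (x - y)) ->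
  rcont a b g -> mu.-integrable `[a, b] (EFin \o (fun t => p (g t))).
Proof.
move=> pl h; apply: continuous_compact_integrable; first exact: segment_compact.
exact: rcont_within.
Qed.

Lemma Re_lip (x y : C) : `|complex.Re x - complex.Re y| <= rnorm (x - y).
Proof. by rewrite -Re_opp -Re_add ler_Re_rnorm. Qed.

Lemma Im_lip (x y : C) : `|complex.Im x - complex.Im y| <= rnorm (x - y).
Proof. by rewrite -Im_opp -Im_add ler_Im_rnorm. Qed.

Lemma Rint_cst a b (k : R) : a <= b -> (\int[mu]_(t in `[a, b]) k)%R = (b - a) * k.
Proof.
move=> ab; rewrite Rintegral_cst//= lebesgue_measure_itv /= lte_fin.
have [_|ba] := ltP a b => /=; first by rewrite mulrC.
by have -> : a = b by [lra]; rewrite subrr mul0r mulr0.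
Qed.

Lemma cint_split a c b g : a <= c -> c <= b -> rcont a b g ->
  cint a b g = cint a c g + cint c b g.
Proof.
move=> ac cb h; have E (p : C -> R) : (forall x y, `|p x - p y| <= rnorm (x - y)) ->
  (\int[mu]_(t in `[a, b]) p (g t) = \int[mu]_(t in `[a, c]) p (g t) +
     \int[mu]_(t in `[c, b]) p (g t))%R.
  move=> pl; have hi := rcont_integrable pl h.
  have := @Rintegral_itvB R (fun t => p (g t)) (BLeft a) (BRight b) c hi.
  rewrite !bnd_simp => /(_ ac cb) e1.
  rewrite -[X in _ = _ + X]Rintegral_itv_obnd_cbnd; last first.
    apply: integrableS hi => //; apply: subset_itv; by rewrite bnd_simp.
  by rewrite -e1 addrC subrK.
by rewrite /cint (E _ Re_lip) (E _ Im_lip).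
Qed.

Lemma cintD a b g h : rcont a b g -> rcont a b h ->
  cint a b (fun t => g t + h t) = cint a b g + cint a b h.
Proof.
move=> hg hh; rewrite /cint; apply/eqP; rewrite eq_complex /=; apply/andP; split; apply/eqP.
  under eq_Rintegral do rewrite Re_add.
  by rewrite RintegralD//; apply: rcont_integrable Re_lip _.
under eq_Rintegral do rewrite Im_add.
by rewrite RintegralD//; apply: rcont_integrable Im_lip _.
Qed.

Lemma cintZ a b g k : rcont a b g -> cint a b (fun t => k * g t) = k * cint a b g.
Proof.
move=> hg; have hR := rcont_integrable Re_lip hg; have hI := rcont_integrable Im_lip hg.
have sc (x : R) (f : R -> R) : mu.-integrable `[a, b] (EFin \o f) ->
    mu.-integrable `[a, b] (EFin \o (fun t => x * f t)).
  move=> hf; have := @integrableZl _ _ _ mu `[a, b] _ x (EFin \o f) hf.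
  by move=> /(_ (measurable_itv _)); apply: eq_integrable => // t _ /=.
rewrite /cint; apply/eqP; rewrite eq_complex; apply/andP; split; apply/eqP => /=.
  under eq_Rintegral do rewrite Re_mul.
  by rewrite RintegralB ?RintegralZl//=; [rewrite Re_mul|exact: sc|exact: sc].
under eq_Rintegral do rewrite Im_mul.
by rewrite RintegralD ?RintegralZl//=; [rewrite Im_mul|exact: sc|exact: sc].
Qed.

(** Real and imaginary parts are bounded separately, hence the factor 2. *)
Lemma cint_le a b g (M : R) : a <= b -> rcont a b g ->
  (forall t, a <= t <= b -> rnorm (g t) <= M) -> rnorm (cint a b g) <= 2 * (M * (b - a)).
Proof.
move=> ab hg hM.
have E (p : C -> R) : (forall x y, `|p x - p y| <= rnorm (x - y)) -> (forall x, `|p x| <= rnorm x) ->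
   `|(\int[mu]_(t in `[a, b]) p (g t))%R| <= M * (b - a).
  move=> pl pb; have hi := rcont_integrable pl hg.
  have hn : mu.-integrable `[a, b] (EFin \o (fun t => `|p (g t)|)).
    apply: (@rcont_integrable _ _ _ (fun x => `|p x|)) hg.
    by move=> x y; apply: le_trans (ler_dist_dist _ _) (pl _ _).
  apply: le_trans (le_normr_Rintegral _ hi) _ => //.
  rewrite mulrC -Rint_cst//; apply: le_Rintegral => //.
    have := @rcont_integrable a b (fun=> M%:C%C) _ Re_lip; apply.
    by move=> t _ e e0; exists 1 => // u _ _; rewrite subrr rnorm0.
  by move=> t /=; rewrite in_itv/= => /hM; apply: le_trans.
apply: le_trans (ler_rnorm_ReIm _) _ => /=.
rewrite mulr_natl mulr2n.
exact: lerD (E _ Re_lip (@ler_Re_rnorm R)) (E _ Im_lip (@ler_Im_rnorm R)).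
Qed.

Lemma cint_cst a b k : a <= b -> cint a b (fun=> k) = (b - a)%:C%C * k.
Proof. by move=> ab; rewrite /cint !Rint_cst//; case: k => x y; simpc. Qed.

Lemma eq_cint a b g h : (forall t, a <= t <= b -> g t = h t) -> cint a b g = cint a b h.
Proof.
move=> gh; rewrite /cint; congr (_ +i* _)%C; apply: eq_Rintegral => t;
  by rewrite inE /= in_itv /= => /gh ->.
Qed.

Lemma rcont_real a b : rcont a b (fun t => t%:C%C).
Proof.
move=> t _ e e0; exists e => // u _ ut.
by rewrite -rmorphB rnorm_real.
Qed.

Lemma Rint_id a b : a <= b -> (\int[mu]_(t in `[a, b]) t)%R = (b ^+ 2 - a ^+ 2) / 2.
Proof.
rewrite le_eqVlt => /predU1P[->|ab].
  by rewrite set_itv1 Rintegral_set1 subrr mul0r.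
pose F := fun t : R => t ^+ 2 / 2 : R^o.
have dF t : is_derive t 1 F t.
  rewrite /F; apply: is_derive_eq.
  rewrite /GRing.scale /=; lra.
rewrite /Rintegral (@continuous_FTC2 R id F a b)//=.
- by rewrite /F; lra.
- by move=> x; apply: continuous_subspaceT => y; exact: cvg_id.
- split.
  + by move=> x _; apply: (@ex_derive _ _ _ _ _ _ _ (dF x)).
  + by apply: cvg_at_right_filter; apply: differentiable_continuous; apply/derivable1_diffP; apply: (@ex_derive _ _ _ _ _ _ _ (dF a)).
  + by apply: cvg_at_left_filter; apply: differentiable_continuous; apply/derivable1_diffP; apply: (@ex_derive _ _ _ _ _ _ _ (dF b)).
- by move=> x _; rewrite derive1E; apply: (@derive_val _ _ _ _ _ _ _ (dF x)).
Qed.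

Lemma cint_real a b : a <= b -> cint a b (fun t => t%:C%C) = ((b ^+ 2 - a ^+ 2) / 2)%:C%C.
Proof. by move=> ab; rewrite /cint /= Rint_id// Rint_cst// mulr0. Qed.

Lemma rcont_cst a b k : rcont a b (fun=> k).
Proof. by move=> t _ e e0; exists 1 => // u _ _; rewrite subrr rnorm0. Qed.

Lemma rcontZ a b g k : rcont a b g -> rcont a b (fun t => k * g t).
Proof.
move=> hg t tab e e0; have k0 : 0 < rnorm k + 1 by rewrite ltr_wpDl ?rnorm_ge0.
have [|r r0 hr] := hg t tab (e / (rnorm k + 1)); first by rewrite divr_gt0.
exists r => // u uab ur; rewrite -mulrBr rnormM.
have := hr u uab ur; rewrite ltr_pdivlMr// => /(le_lt_trans _); apply.
by rewrite mulrC ler_wpM2l ?rnorm_ge0// lerDl.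
Qed.

Lemma cintB a b g h : rcont a b g -> rcont a b h ->
  cint a b (fun t => g t - h t) = cint a b g - cint a b h.
Proof.
move=> hg hh; rewrite -mulN1r -cintZ// -cintD//; last exact: rcontZ.
by apply: eq_cint => t _; rewrite mulN1r.
Qed.

End ComplexIntegral.

(** * Goursat's lemma *)

Section Goursat.
Variable R : realType.
Local Notation C := R[i].
Implicit Types (x y : R) (f g : C -> C) (z w d : C).

Definition rect x0 x1 y0 y1 z : Prop :=
  x0 <= complex.Re z <= x1 /\ y0 <= complex.Im z <= y1.

(** The integral of [f] along the boundary of the rectangle, counterclockwise. *)
Definition rint f x0 x1 y0 y1 : C :=
  cint x0 x1 (fun x => f (x +i* y0)%C) - cint x0 x1 (fun x => f (x +i* y1)%C) +
  'i%C * (cint y0 y1 (fun y => f (x1 +i* y)%C) - cint y0 y1 (fun y => f (x0 +i* y)%C)).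

Lemma rect_sub x0 x1 y0 y1 x0' x1' y0' y1' z : x0 <= x0' -> x1' <= x1 -> y0 <= y0' -> y1' <= y1 ->
  rect x0' x1' y0' y1' z -> rect x0 x1 y0 y1 z.
Proof. by move=> a1 a2 a3 a4 [/andP[b1 b2] /andP[b3 b4]]; split; apply/andP; split; lra. Qed.

Definition ccont_on (D : C -> Prop) f := forall z, D z -> ccont D f z.

Lemma ccont_onW (D D' : C -> Prop) f : (forall z, D' z -> D z) -> ccont_on D f -> ccont_on D' f.
Proof.
move=> DD h z /[dup] D'z /DD Dz e e0; have [r r0 hr] := h z Dz e e0.
by exists r => // w /DD; exact: hr.
Qed.

Lemma rcont_h f x0 x1 y0 y1 y : ccont_on (rect x0 x1 y0 y1) f -> y0 <= y <= y1 ->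
  rcont x0 x1 (fun x => f (x +i* y)%C).
Proof.
move=> h hy t ht e e0; have [|r r0 hr] := h (t +i* y)%C _ e e0; first by split.
exists r => // u hu ut; apply: hr; first by split.
have -> : ((u +i* y) - (t +i* y))%C = (u - t)%:C%C by apply/eqP; rewrite eq_complex /=; apply/andP; split; apply/eqP; ring.
by rewrite rnorm_real.
Qed.

Lemma rcont_v f x0 x1 y0 y1 x : ccont_on (rect x0 x1 y0 y1) f -> x0 <= x <= x1 ->
  rcont y0 y1 (fun y => f (x +i* y)%C).
Proof.
move=> h hx t ht e e0; have [|r r0 hr] := h (x +i* t)%C _ e e0; first by split.
exists r => // u hu ut; apply: hr; first by split.
have -> : ((x +i* u) - (x +i* t))%C = ('i * (u - t)%:C)%C by apply/eqP; rewrite eq_complex /=; apply/andP; split; apply/eqP; ring.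
by rewrite rnormM rnorm_i mul1r rnorm_real.
Qed.

Section Fixed.
Variables (x0 x1 y0 y1 : R).
Hypotheses (x01 : x0 <= x1) (y01 : y0 <= y1).
Local Notation Q := (rect x0 x1 y0 y1).

Let yy0 : y0 <= y0 <= y1. Proof. by rewrite lexx. Qed.
Let yy1 : y0 <= y1 <= y1. Proof. by rewrite lexx y01. Qed.
Let xx0 : x0 <= x0 <= x1. Proof. by rewrite lexx. Qed.
Let xx1 : x0 <= x1 <= x1. Proof. by rewrite lexx x01. Qed.

Lemma rint_split_x f xm : ccont_on Q f -> x0 <= xm <= x1 ->
  rint f x0 x1 y0 y1 = rint f x0 xm y0 y1 + rint f xm x1 y0 y1.
Proof.
move=> h /andP[a b]; rewrite /rint.
rewrite (cint_split a b (rcont_h h yy0)) (cint_split a b (rcont_h h yy1)).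
ring.
Qed.

Lemma rint_split_y f ym : ccont_on Q f -> y0 <= ym <= y1 ->
  rint f x0 x1 y0 y1 = rint f x0 x1 y0 ym + rint f x0 x1 ym y1.
Proof.
move=> h /andP[a b]; rewrite /rint.
rewrite (cint_split a b (rcont_v h xx0)) (cint_split a b (rcont_v h xx1)).
ring.
Qed.

Lemma rintB f g : ccont_on Q f -> ccont_on Q g ->
  rint (fun w => f w - g w) x0 x1 y0 y1 = rint f x0 x1 y0 y1 - rint g x0 x1 y0 y1.
Proof.
move=> h k; rewrite /rint.
rewrite (cintB (rcont_h h yy0) (rcont_h k yy0)) (cintB (rcont_h h yy1) (rcont_h k yy1)).
rewrite (cintB (rcont_v h xx0) (rcont_v k xx0)) (cintB (rcont_v h xx1) (rcont_v k xx1)).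
ring.
Qed.

Lemma rint_le f (M : R) : ccont_on Q f -> (forall z, Q z -> rnorm (f z) <= M) ->
  rnorm (rint f x0 x1 y0 y1) <= 4 * (M * ((x1 - x0) + (y1 - y0))).
Proof.
move=> h hM; rewrite /rint.
apply: le_trans (ler_rnormD _ _) _; rewrite rnormM rnorm_i mul1r.
have -> : 4 * (M * ((x1 - x0) + (y1 - y0))) =
   (2 * (M * (x1 - x0)) + 2 * (M * (x1 - x0))) + (2 * (M * (y1 - y0)) + 2 * (M * (y1 - y0))) by ring.
apply: lerD; apply: le_trans (ler_rnormB _ _) _; apply: lerD; apply: cint_le => //.
- exact: rcont_h h yy0.
- by move=> t ht; apply: hM; split.
- exact: rcont_h h yy1.
- by move=> t ht; apply: hM; split.
- exact: rcont_v h xx1.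
- by move=> t ht; apply: hM; split.
- exact: rcont_v h xx0.
- by move=> t ht; apply: hM; split.
Qed.

Lemma ccont_on_affine (D : C -> Prop) c d : ccont_on D (fun w => c + d * w).
Proof.
move=> z Dz; apply: cderiv_ccont.
exact: (has_cderivD (has_cderiv_cst _ _ _) (has_cderivZ d (has_cderiv_id _ _))).
Qed.

Lemma cint_affine a b (c d : C) : a <= b ->
  cint a b (fun t => c + d * t%:C%C) = (b - a)%:C%C * c + d * ((b ^+ 2 - a ^+ 2) / 2)%:C%C.
Proof.
move=> ab; rewrite cintD; [|exact: rcont_cst|by apply: rcontZ; exact: rcont_real].
by rewrite cint_cst// cintZ ?cint_real//; exact: rcont_real.
Qed.

(** The only boundary integral that is evaluated explicitly; it allows the tangent map of [f] at a
    point to be subtracted before estimating. *)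
Lemma rint_affine c d : rint (fun w => c + d * w) x0 x1 y0 y1 = 0.
Proof.
rewrite /rint.
have hE y : cint x0 x1 (fun x => c + d * (x +i* y)%C) =
    (x1 - x0)%:C%C * (c + d * ('i%C * y%:C%C)) + d * ((x1 ^+ 2 - x0 ^+ 2) / 2)%:C%C.
  by rewrite -cint_affine//; apply: eq_cint => t _; rewrite (complexE (t +i* y)%C) /=; ring.
have vE x : cint y0 y1 (fun y => c + d * (x +i* y)%C) =
    (y1 - y0)%:C%C * (c + d * x%:C%C) + d * 'i%C * ((y1 ^+ 2 - y0 ^+ 2) / 2)%:C%C.
  by rewrite -cint_affine//; apply: eq_cint => t _; rewrite (complexE (x +i* t)%C) /=; ring.
rewrite !hE !vE !rmorphB /=; ring.
Qed.

End Fixed.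

(* A grid measure whose density is unbounded at the exceptional points: a square of side [s]
   containing one of them has measure at least [s], not merely [s ^+ 2]. *)
Definition ssqrt (x : R) : R := Num.sqrt x - Num.sqrt (- x).

Lemma ssqrt_le x y : x <= y -> ssqrt x <= ssqrt y.
Proof. by move=> xy; apply: lerB; apply: ler_wsqrtr => //; lra. Qed.

Lemma ssqrt0 x y : x <= 0 <= y -> Num.sqrt (y - x) <= ssqrt y - ssqrt x.
Proof.
move=> /andP[x0 y0]; rewrite /ssqrt (ler0_sqrtr x0) (@ler0_sqrtr _ (- y)) ?oppr_le0//.
rewrite subr0 sub0r opprK -(ger0_norm (addr_ge0 (sqrtr_ge0 y) (sqrtr_ge0 (- x)))).
rewrite -sqrtr_sqr ler_wsqrtr// sqrrD !sqr_sqrtr ?oppr_ge0//.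
by have := mulr_ge0 (sqrtr_ge0 y) (sqrtr_ge0 (- x)); lra.
Qed.

Definition grid (E : seq R) (x : R) : R := x + \sum_(c <- E) ssqrt (x - c).

Lemma grid_ge E x y : x <= y -> y - x <= grid E y - grid E x.
Proof.
move=> xy; rewrite /grid.
have : \sum_(c <- E) ssqrt (x - c) <= \sum_(c <- E) ssqrt (y - c).
  by apply: ler_sum => c _; apply: ssqrt_le; lra.
lra.
Qed.

Lemma grid_exc E x y c : c \in E -> x <= c <= y -> Num.sqrt (y - x) <= grid E y - grid E x.
Proof.
move=> cE /andP[xc cy]; rewrite /grid (big_rem c)//= [X in _ - (_ + X)](big_rem c)//=.
have : \sum_(c <- rem c E) ssqrt (x - c) <= \sum_(c <- rem c E) ssqrt (y - c).
  by apply: ler_sum => k _; apply: ssqrt_le; lra.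
have := @ssqrt0 (x - c) (y - c); have -> : y - c - (x - c) = y - x by ring.
have -> : x - c <= 0 <= y - c by apply/andP; split; lra.
by move=> /(_ isT); lra.
Qed.

(** The intervals [[F k, F k + l / 2 ^ k]] are nested, and the supremum of their left ends belongs
    to all of them. *)
Lemma nested_limit (F : nat -> R) (l : R) : 0 <= l ->
  (forall k, F k <= F k.+1 <= F k + l * 2^-1 ^+ k.+1) ->
  exists z : R, forall k, F k <= z <= F k + l * 2^-1 ^+ k.
Proof.
move=> l0 H.
have up k j : F k <= F (k + j)%N.
  elim: j => [|j IH]; first by rewrite addn0.
  by rewrite addnS; apply: le_trans IH _; have /andP[] := H (k + j)%N.
have s0 k : 0 <= l * 2^-1 ^+ k by rewrite mulr_ge0// exprn_ge0.
have dn k j : F (k + j)%N + l * 2^-1 ^+ (k + j) <= F k + l * 2^-1 ^+ k.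
  elim: j => [|j IH]; first by rewrite addn0.
  rewrite addnS; apply: le_trans IH; have /andP[_] := H (k + j)%N.
  by rewrite exprS; have := s0 (k + j)%N; lra.
have bnd k j : F j <= F k + l * 2^-1 ^+ k.
  case: (leqP k j) => kj.
    by have := dn k (j - k)%N; rewrite subnKC//; have := s0 j; lra.
  by have := up j (k - j)%N; rewrite subnKC 1?ltnW//; have := s0 k; lra.
have hs : has_sup (range F).
  split; first by exists (F 0%N); exists 0%N.
  by exists (F 0%N + l * 2^-1 ^+ 0) => _ [j _ <-]; exact: bnd.
exists (sup (range F)) => k; apply/andP; split.
  by apply: ub_le_sup; [case: hs|exists k].
by apply: ge_sup; [case: hs|move=> _ [j _ <-]; exact: bnd].
Qed.

Lemma dependent_choice_nat (T : Type) (P : nat -> T -> Prop) (r : nat -> T -> T -> Prop) p0 :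
  P 0%N p0 -> (forall k p, P k p -> exists p', P k.+1 p' /\ r k p p') ->
  exists F : nat -> T, forall k, P k (F k) /\ r k (F k) (F k.+1).
Proof.
move=> P0 step.
have step' k (p : {p | P k p}) : {p' : {p' | P k.+1 p'} | r k (sval p) (sval p')}.
  by apply: cid; have [p' [h1 h2]] := step k _ (svalP p); exists (exist _ p' h1).
pose F := fix F k : {p | P k p} := match k with 0 => exist _ p0 P0 | S k => sval (step' k (F k)) end.
by exists (fun k => sval (F k)) => k; split; [exact: svalP|exact: (svalP (step' k (F k)))].
Qed.

Section Rectangle.
Variables (E : seq C) (f : C -> C) (x0 y0 w h : R).
Hypotheses (w0 : 0 < w) (h0 : 0 < h).
Local Notation Q := (rect x0 (x0 + w) y0 (y0 + h)).
Hypothesis fcont : ccont_on Q f.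
Hypothesis fdiff : forall z, Q z -> (z \in E) \/ cdiff Q f z.

Let gx := grid [seq complex.Re c | c <- E].
Let gy := grid [seq complex.Im c | c <- E].
(** The mass of the sub-rectangle at [(a, b)] of scale [s] for the product of the two grid measures;
    it is additive under bisection, like the boundary integral [I]. *)
Let m a b s := (gx (a + w * s) - gx a) * (gy (b + h * s) - gy b).
Let I a b s := rint f a (a + w * s) b (b + h * s).
Let sub a b s := [/\ x0 <= a, a + w * s <= x0 + w, y0 <= b & b + h * s <= y0 + h].
Let S a b s := rect a (a + w * s) b (b + h * s).

Let subQ a b s z : sub a b s -> S a b s z -> Q z.
Proof. by case=> h1 h2 h3 h4; apply: rect_sub. Qed.

Let fS a b s : sub a b s -> ccont_on (S a b s) f.
Proof. by move=> hs; apply: ccont_onW fcont => z; exact: subQ. Qed.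

Let m_area a b s : 0 <= s -> w * h * s ^+ 2 <= m a b s.
Proof.
move=> s0; rewrite /m.
have -> : w * h * s ^+ 2 = (a + w * s - a) * (b + h * s - b) by ring.
have ws0 : 0 <= w * s by rewrite mulr_ge0// ltW.
have hs0 : 0 <= h * s by rewrite mulr_ge0// ltW.
by apply: ler_pM; rewrite ?grid_ge//; lra.
Qed.

Let m_exc a b s z : 0 <= s -> z \in E -> S a b s z -> Num.sqrt w * Num.sqrt h * s <= m a b s.
Proof.
move=> s0 zE [h1 h2]; rewrite /m.
have -> : Num.sqrt w * Num.sqrt h * s = Num.sqrt (a + w * s - a) * Num.sqrt (b + h * s - b).
  have -> : a + w * s - a = w * s by ring.
  have -> : b + h * s - b = h * s by ring.
  rewrite (sqrtrM _ (ltW w0)) (sqrtrM _ (ltW h0)) mulrACA -expr2 sqr_sqrtr//.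
by apply: ler_pM; rewrite ?sqrtr_ge0//; 
  [apply: grid_exc h1|apply: grid_exc h2]; apply: map_f.
Qed.

Let approx a b s c d (M : R) : 0 < s -> sub a b s ->
  (forall u, S a b s u -> rnorm (f u - (c + d * u)) <= M) ->
  rnorm (I a b s) <= 4 * (M * ((w + h) * s)).
Proof.
move=> s0 hs hM.
have ws0 : a <= a + w * s by rewrite lerDl mulr_ge0// ltW.
have hs0 : b <= b + h * s by rewrite lerDl mulr_ge0// ltW.
have := rintB ws0 hs0 (fS hs) (@ccont_on_affine (S a b s) c d).
rewrite (rint_affine ws0 hs0) subr0 -/(I a b s) => <-.
have -> : (w + h) * s = (a + w * s - a) + (b + h * s - b) by ring.
apply: rint_le => // z Sz e e0.
have e2 : 0 < e / 2 by rewrite divr_gt0.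
have [r r0 hr] := fS hs Sz e2.
have [r' r'0 hr'] := @ccont_on_affine (S a b s) c d z Sz _ e2.
exists (Num.min r r'); first by rewrite lt_min r0.
move=> u Su; rewrite lt_min => /andP[ur ur'].
have -> : f u - (c + d * u) - (f z - (c + d * z)) = (f u - f z) - ((c + d * u) - (c + d * z)) by ring.
apply: le_lt_trans (ler_rnormB _ _) _; have := hr u Su ur; have := hr' u Su ur'; lra.
Qed.

Let diam a b s z u : 0 < s -> S a b s z -> S a b s u -> rnorm (u - z) <= (w + h) * s.
Proof.
move=> s0 [/andP[z1 z2] /andP[z3 z4]] [/andP[u1 u2] /andP[u3 u4]].
apply: le_trans (ler_rnorm_ReIm _) _.
rewrite Re_add Re_opp Im_add Im_opp mulrDl; apply: lerD; rewrite ler_norml; apply/andP; split; lra.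
Qed.

(** Around a point of differentiability the tangent map is subtracted and the integral is
    [o(s ^ 2)], against a mass of at least [w * h * s ^ 2]. Around an exceptional point continuity
    only gives [o(s)], but there the mass is at least of order [s]. *)
Let gauge (e : R) z : 0 < e -> Q z -> exists2 r : R, 0 < r &
  forall a b s, 0 < s -> s < r -> sub a b s -> S a b s z -> rnorm (I a b s) <= e * m a b s.
Proof.
move=> e0 Qz; have wh0 : 0 < w + h by rewrite addr_gt0.
case: (fdiff Qz) => [zE|[d fd]].
  pose e' := e * (Num.sqrt w * Num.sqrt h) / (4 * (w + h)).
  have e'0 : 0 < e' by rewrite divr_gt0 ?mulr_gt0 ?sqrtr_gt0.
  have [r r0 hr] := fcont Qz e'0.
  exists (r / (w + h)); first by rewrite divr_gt0.
  move=> a b s s0 sr hs Sz.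
  apply: (@le_trans _ _ (4 * (e' * ((w + h) * s)))).
    apply: (@approx _ _ _ (f z) 0) => // u Su; rewrite mul0r addr0.
    apply: ltW; apply: hr; first exact: subQ Su.
    by apply: le_lt_trans (diam s0 Sz Su) _; rewrite mulrC -ltr_pdivlMr.
  have -> : 4 * (e' * ((w + h) * s)) = e * (Num.sqrt w * Num.sqrt h * s).
    by rewrite /e'; field; rewrite gt_eqF.
  by rewrite ler_pM2l//; apply: m_exc Sz => //; exact: ltW.
pose e' := e * (w * h) / (4 * (w + h) ^+ 2).
have e'0 : 0 < e' by rewrite divr_gt0 ?mulr_gt0 ?exprn_gt0.
have [r r0 hr] := fd _ e'0.
exists (r / (w + h)); first by rewrite divr_gt0.
move=> a b s s0 sr hs Sz.
apply: (@le_trans _ _ (4 * (e' * ((w + h) * s) * ((w + h) * s)))).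
  apply: (@approx _ _ _ (f z - d * z) d) => // u Su.
  have -> : f u - (f z - d * z + d * u) = f u - f z - d * (u - z) by ring.
  apply: le_trans (hr _ (subQ hs Su) _) _.
    by apply: le_lt_trans (diam s0 Sz Su) _; rewrite mulrC -ltr_pdivlMr.
  by rewrite ler_pM2l//; exact: diam s0 Sz Su.
have -> : 4 * (e' * ((w + h) * s) * ((w + h) * s)) = e * (w * h * s ^+ 2).
  by rewrite /e'; field; rewrite gt_eqF.
by rewrite ler_pM2l// m_area// ltW.
Qed.

(** Integrals and masses both add up over the four quarters, so if every quarter satisfied the
    inequality, so would the whole. *)
Let step (e : R) a b s : 0 < s -> sub a b s -> e * m a b s < rnorm (I a b s) ->
  exists a' b', [/\ a <= a' <= a + w * (s / 2), b <= b' <= b + h * (s / 2),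
    sub a' b' (s / 2) & e * m a' b' (s / 2) < rnorm (I a' b' (s / 2))].
Proof.
move=> s0 hs; have [s1 s2 s3 s4] := hs.
pose a1 := a + w * (s / 2); pose b1 := b + h * (s / 2).
have ws0 : 0 < w * (s / 2) by rewrite mulr_gt0// divr_gt0.
have hs0 : 0 < h * (s / 2) by rewrite mulr_gt0// divr_gt0.
have ea : a1 + w * (s / 2) = a + w * s by rewrite /a1; field.
have eb : b1 + h * (s / 2) = b + h * s by rewrite /b1; field.
have aa1 : a <= a1 by rewrite /a1; lra.
have bb1 : b <= b1 by rewrite /b1; lra.
have aa2 : a1 <= a + w * s by lra.
have bb2 : b1 <= b + h * s by lra.
have Isum : I a b s = I a b (s / 2) + I a b1 (s / 2) + (I a1 b (s / 2) + I a1 b1 (s / 2)).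
  have fSS := fS hs.
  rewrite /I ea eb (rint_split_x (le_trans bb1 bb2) fSS (xm := a1)) ?aa1//.
  congr (_ + _); apply: rint_split_y; rewrite -/a1 -/b1 ?bb1//.
    by apply: ccont_onW fSS => z; apply: rect_sub.
  by apply: ccont_onW fSS => z; apply: rect_sub.
have msum : m a b s = m a b (s / 2) + m a b1 (s / 2) + (m a1 b (s / 2) + m a1 b1 (s / 2)).
  by rewrite /m ea eb -/a1 -/b1; ring.
have L a' b' : (a' = a \/ a' = a1) -> (b' = b \/ b' = b1) ->
  [/\ a <= a' <= a + w * (s / 2), b <= b' <= b + h * (s / 2) & sub a' b' (s / 2)].
  by move=> [->|->] [->|->]; split; rewrite /sub; try (apply/andP; split); try split;
    rewrite ?ea ?eb -/a1 -/b1 ?lexx//; lra.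
move=> bad; apply: contrapT => no.
have good a' b' : (a' = a \/ a' = a1) -> (b' = b \/ b' = b1) ->
    rnorm (I a' b' (s / 2)) <= e * m a' b' (s / 2).
  move=> ha hb; rewrite leNgt; apply/negP => bd; apply: no; exists a', b'.
  by have [] := L _ _ ha hb.
move: bad; rewrite ltNge => /negP; apply.
rewrite Isum msum !mulrDr.
by do 3 ?[apply: le_trans (ler_rnormD _ _) _; apply: lerD]; apply: good; tauto.
Qed.

Theorem goursat : rint f x0 (x0 + w) y0 (y0 + h) = 0.
Proof.
apply/eqP; rewrite -rnorm_eq0 -[_ == _]negbK; apply/negP => nz.
have n0 : 0 < rnorm (rint f x0 (x0 + w) y0 (y0 + h)) by rewrite lt_def nz rnorm_ge0.
set N := rnorm _ in n0.
have m0 : 0 < m x0 y0 1 by apply: lt_le_trans (m_area _ _ ler01); rewrite expr1n mulr1 mulr_gt0.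
(* With half the ratio of integral to mass the whole rectangle is bad; bisection then produces
   nested bad rectangles, which contradict [gauge] at their common point. *)
pose e := N / (2 * m x0 y0 1).
have e0 : 0 < e by rewrite divr_gt0// mulr_gt0.
pose P k (p : R * R) := sub p.1 p.2 (2^-1 ^+ k) /\
  e * m p.1 p.2 (2^-1 ^+ k) < rnorm (I p.1 p.2 (2^-1 ^+ k)).
pose r (k : nat) (p p' : R * R) := p.1 <= p'.1 <= p.1 + w * 2^-1 ^+ k.+1 /\
  p.2 <= p'.2 <= p.2 + h * 2^-1 ^+ k.+1.
have P0 : P 0%N (x0, y0).
  split; first by rewrite /sub /= expr0 !mulr1 !lexx.
  rewrite /= expr0 /I !mulr1 -/N /e.
  have -> : N / (2 * m x0 y0 1) * m x0 y0 1 = N / 2 by field; rewrite gt_eqF.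
  by rewrite ltr_pdivrMr// ltr_pMr// ltr1n.
have sE k : 2^-1 ^+ k.+1 = 2^-1 ^+ k / 2 :> R by rewrite exprSr.
have s0 k : 0 < 2^-1 ^+ k :> R by rewrite exprn_gt0.
have [F HF] : exists F : nat -> R * R, forall k, P k (F k) /\ r k (F k) (F k.+1).
  apply: dependent_choice_nat P0 _ => k [a b] [/= h1 h2].
  have [a' [b' [q1 q2 q3 q4]]] := step (s0 k) h1 h2.
  by exists (a', b'); rewrite /P /r !sE.
have [zx hzx] := @nested_limit (fun k => (F k).1) w (ltW w0) (fun k => (HF k).2.1).
have [zy hzy] := @nested_limit (fun k => (F k).2) h (ltW h0) (fun k => (HF k).2.2).
have Sz k : S (F k).1 (F k).2 (2^-1 ^+ k) (zx +i* zy)%C by split; [exact: hzx|exact: hzy].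
have [d d0 hd] := gauge e0 (subQ (HF 0%N).1.1 (Sz 0%N)).
have [k kd] : exists k, 2^-1 ^+ k < d.
  have : (fun k => 2^-1 ^+ k : R) @ \oo --> (0 : R).
    by apply: cvg_expr; rewrite ger0_norm// invf_lt1// ltr1n.
  move/cvgrPdist_lt => /(_ d d0) [k _ /(_ k (leqnn k))] /=.
  by rewrite sub0r normrN ger0_norm ?ltW//; exists k.
have [hsub hbad] := (HF k).1.
by have := hd _ _ _ (s0 k) kd hsub (Sz k); rewrite leNgt hbad.
Qed.

End Rectangle.

(** The two horizontal sides cancel by periodicity, which leaves the equality of the vertical
    integrals. *)
Lemma strip_shift (E : seq C) f x0 x1 y0 y1 : x0 < x1 -> y0 < y1 ->
  ccont_on (rect x0 x1 y0 y1) f ->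
  (forall z, rect x0 x1 y0 y1 z -> (z \in E) \/ cdiff (rect x0 x1 y0 y1) f z) ->
  (forall x, x0 <= x <= x1 -> f (x +i* y0)%C = f (x +i* y1)%C) ->
  cint y0 y1 (fun y => f (x1 +i* y)%C) = cint y0 y1 (fun y => f (x0 +i* y)%C).
Proof.
move=> x01 y01 h1 h2 per.
have ex : x1 = x0 + (x1 - x0) by ring.
have ey : y1 = y0 + (y1 - y0) by ring.
have : rint f x0 x1 y0 y1 = 0.
  have := @goursat E f x0 y0 (x1 - x0) (y1 - y0).
  by rewrite -ex -ey !subr_gt0; apply.
rewrite /rint (eq_cint per) subrr add0r => /eqP; rewrite mulf_eq0 subr_eq0.
by case/orP=> [|/eqP//]; rewrite -rnorm_eq0 rnorm_i oner_eq0.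
Qed.

End Goursat.

(** * Circle means and Cauchy estimates *)

Section ComplexExp.
Variable R : realType.
Local Notation C := R[i].
Implicit Types (x y : R) (z w : C).

Lemma complex_eq z w : complex.Re z = complex.Re w -> complex.Im z = complex.Im w -> z = w.
Proof. by case: z; case: w => a b c d /= -> ->. Qed.

Lemma expCE x y : expC (x +i* y)%C = ((expR x * cos y) +i* (expR x * sin y))%C :> C.
Proof. by rewrite /expC /=; simpc. Qed.

Lemma Re_expC z : complex.Re (expC z) = expR (complex.Re z) * cos (complex.Im z).
Proof. by case: z => x y; rewrite expCE. Qed.

Lemma Im_expC z : complex.Im (expC z) = expR (complex.Re z) * sin (complex.Im z).
Proof. by case: z => x y; rewrite expCE. Qed.

Lemma expCD z w : expC (z + w) = expC z * expC w.
Proof.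
apply: complex_eq.
  rewrite [RHS]Re_mul !(Re_expC, Im_expC) Re_add Im_add expRD cosD; ring.
rewrite [RHS]Im_mul !(Re_expC, Im_expC) Re_add Im_add expRD sinD; ring.
Qed.

Lemma expC0 : expC (0 : C) = 1.
Proof. by apply: complex_eq; rewrite ?Re_expC ?Im_expC /= expR0 ?cos0 ?sin0 ?mulr1 ?mulr0. Qed.

Lemma rnorm_expC z : rnorm (expC z) = expR (complex.Re z).
Proof.
rewrite rnorm_sqrt Re_expC Im_expC !exprMn -mulrDr cos2Dsin2 mulr1 sqrtr_sqr.
by rewrite ger0_norm ?expR_ge0.
Qed.

Lemma expC_neq0 z : expC z != 0.
Proof. by rewrite -rnorm_gt0 rnorm_expC expR_gt0. Qed.

Lemma expCN z : expC (- z) = (expC z)^-1.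
Proof.
by apply: (mulfI (expC_neq0 z)); rewrite -expCD subrr expC0 mulfV// expC_neq0.
Qed.

Lemma expCMn z k : expC (z * k%:R) = expC z ^+ k.
Proof.
elim: k => [|k IH]; first by rewrite mulr0 expC0 expr0.
by rewrite -natr1 mulrDr mulr1 expCD IH exprSr.
Qed.

Lemma expC_real x : expC (x%:C%C) = (expR x)%:C%C :> C.
Proof. by apply: complex_eq; rewrite ?Re_expC ?Im_expC /= ?cos0 ?sin0 ?mulr1 ?mulr0. Qed.

(** The arc cosine determines the argument up to sign, and the sign of the imaginary part
    decides. *)
Lemma polar z : z != 0 -> exists2 t : R, - pi <= t <= pi & z = expC (ln (rnorm z) +i* t)%C.
Proof.
move=> z0; have n0 : 0 < rnorm z by rewrite rnorm_gt0.
pose c := complex.Re z / rnorm z; pose s := complex.Im z / rnorm z.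
have cs : c ^+ 2 + s ^+ 2 = 1.
  rewrite /c /s !expr_div_n -mulrDl.
  have -> : complex.Re z ^+ 2 + complex.Im z ^+ 2 = rnorm z ^+ 2.
    by rewrite rnorm_sqrt sqr_sqrtr// addr_ge0 ?sqr_ge0.
  by rewrite mulfV// expf_neq0// gt_eqF.
have hc : -1 <= c <= 1 by apply/andP; split; nra.
have [ha hb] := acos_def hc.
have hs : sin (acos c) = `|s|.
  rewrite sin_acos// -sqrtr_sqr; congr Num.sqrt; lra.
have zE : z = (rnorm z)%:C%C * (c +i* s)%C.
  by apply: complex_eq; rewrite ?Re_mul ?Im_mul /= mul0r ?subr0 ?addr0 mulrC divfK ?gt_eqF.
have [s0|s0] := leP 0 s.
  exists (acos c); first by have := pi_ge0 R; lra.
  by rewrite expCE lnK ?posrE// hb hs ger0_norm// [LHS]zE; simpc.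
exists (- acos c); first by have := pi_ge0 R; lra.
rewrite expCE lnK ?posrE// cosN sinN hb hs ltr0_norm// [LHS]zE opprK; simpc => //.
Qed.

Lemma cos_eq1 (a : R) : - (pi *+ 2) <= a <= pi *+ 2 -> cos a = 1 -> [\/ a = 0, a = pi *+ 2 | a = - (pi *+ 2)].
Proof.
move=> ha ca.
have p0 := pi_gt0 R.
wlog a0 : a ha ca / 0 <= a.
  move=> W; case: (leP 0 a) => a0; first exact: W.
  have [||| ?|?|?] := W (- a); rewrite ?cosN//; [lra|lra|..].
  - by apply: Or31; lra.
  - by apply: Or33; lra.
  - by apply: Or32; lra.
have inj (b : R) : 0 <= b <= pi -> cos b = 1 -> b = 0.
  by move=> hb cb; apply: cos_inj; rewrite ?in_itv/= ?lexx ?pi_ge0// cb cos0.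
case: (leP a pi) => api; first by apply: Or31; apply: inj => //; lra.
apply: Or32; suff : pi *+ 2 - a = 0 by lra.
apply: inj; first lra.
by rewrite cosB cos2pi sin2pi ca; lra.
Qed.

Lemma expC_inj_strip z w : expC z = expC w ->
  complex.Re z = complex.Re w /\ cos (complex.Im z - complex.Im w) = 1.
Proof.
move=> h; have hR : complex.Re z = complex.Re w.
  by apply: expR_inj; rewrite -!rnorm_expC h.
split=> //; rewrite cosB.
have e0 := expR_gt0 (complex.Re w).
have h1 : cos (complex.Im z) = cos (complex.Im w).
  by apply: (mulfI (lt0r_neq0 e0)); rewrite -Re_expC -hR -Re_expC h.
have h2 : sin (complex.Im z) = sin (complex.Im w).
  by apply: (mulfI (lt0r_neq0 e0)); rewrite -Im_expC -hR -Im_expC h.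
by rewrite h1 h2 -!expr2 cos2Dsin2.
Qed.

Lemma real_deriv_eps (f : R -> R) (x d : R) : is_derive x 1 f d ->
  forall e : R, 0 < e -> exists2 r : R, 0 < r & forall h, `|h| < r ->
    `|f (x + h) - f x - d * h| <= e * `|h|.
Proof.
move=> [df dd] e e0.
have /cvgrPdist_le /(_ e e0) : (fun h => h^-1 *: ((f \o shift x) (h *: 1) - f x)) @ 0^' --> d.
  by rewrite -dd; exact: df.
case=> r /= r0 hr; exists r => // h hr'.
have [->|h0] := eqVneq h 0; first by rewrite addr0 subrr mulr0 subr0 !normr0 mulr0.
have := hr h; rewrite /ball /= sub0r normrN => /(_ hr' h0).
rewrite /GRing.scale /= mulr1 (addrC h x) => hh.
have -> : f (x + h) - f x - d * h = - ((d - h^-1 * (f (x + h) - f x)) * h) by field.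
by rewrite normrN normrM ler_wpM2r.
Qed.

Lemma has_cderiv_expC0 (D : C -> Prop) : has_cderiv D (@expC R) 0 1.
Proof.
move=> e e0.
(* Besides the three first-order errors of [expR], [cos] and [sin] there are products of order
   [N ^ 2]; the bound [N < e1 / 4] below turns them into multiples of [e1 * N]. *)
pose e1 := Num.min 1 (e / 10).
have e10 : 0 < e1 by rewrite lt_min ltr01 divr_gt0.
have [r1 r10 h1] := real_deriv_eps (is_derive_expR 0) e10.
have [r2 r20 h2] := real_deriv_eps (is_derive_cos 0) e10.
have [r3 r30 h3] := real_deriv_eps (is_derive_sin 0) e10.
exists (Num.min (e1 / 4) (Num.min r1 (Num.min r2 r3))).
  by rewrite !lt_min r10 r20 r30 divr_gt0.
move=> [a b] _; rewrite !subr0 !lt_min => /and4P[n0 n1 n2 n3].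
rewrite expC0 mul1r; set N := rnorm _ in n0 n1 n2 n3 *.
have N0 : 0 <= N by exact: rnorm_ge0.
have aN : `|a| <= N := @ler_Re_rnorm _ (a +i* b)%C.
have bN : `|b| <= N := @ler_Im_rnorm _ (a +i* b)%C.
have := h1 a (le_lt_trans aN n1); have := h2 b (le_lt_trans bN n2).
have := h3 b (le_lt_trans bN n3).
rewrite !add0r expR0 cos0 sin0 oppr0 mul0r !subr0 !mul1r => k3 k2 k1.
have {}k1 : `|expR a - 1 - a| <= e1 * N by apply: le_trans k1 _; rewrite ler_pM2l.
have {}k2 : `|cos b - 1| <= e1 * N by apply: le_trans k2 _; rewrite ler_pM2l.
rewrite ?addr0 in k3.
have {}k3 : `|sin b - b| <= e1 * N by apply: le_trans k3 _; rewrite ler_pM2l.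
have e1l : e1 <= 1 by rewrite ge_min lexx.
have e1e : e1 <= e / 10 by rewrite ge_min lexx orbT.
have e1N : e1 * N <= N by rewrite -[leRHS]mul1r ler_wpM2r.
have a1 : `|expR a - 1| <= 2 * N.
  have -> : expR a - 1 = (expR a - 1 - a) + a by ring.
  by apply: le_trans (ler_normD _ _) _; lra.
have b1 : `|sin b| <= 2 * N.
  have -> : sin b = (sin b - b) + b by ring.
  by apply: le_trans (ler_normD _ _) _; lra.
rewrite expCE; apply: le_trans (ler_rnorm_ReIm _) _ => /=.
have -> : expR a * cos b - 1 - a = (expR a - 1 - a) + (cos b - 1) + (expR a - 1) * (cos b - 1) by ring.
rewrite subr0.
have -> : expR a * sin b - b = (sin b - b) + (expR a - 1) * sin b by ring.
have m1 : `|(expR a - 1) * (cos b - 1)| <= 2 * N * (e1 * N).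
  by rewrite normrM ler_pM.
have m2 : `|(expR a - 1) * sin b| <= 2 * N * (2 * N) by rewrite normrM ler_pM.
have NN : N * N <= e1 / 4 * N by rewrite ler_wpM2r// ltW.
have NN0 := mulr_ge0 N0 N0.
have eN : e1 * N <= e / 10 * N by rewrite ler_wpM2r.
have eNN : e1 * (N * N) <= 1 * (N * N) by rewrite ler_wpM2r// mulr_ge0.
have := ler_normD (expR a - 1 - a + (cos b - 1)) ((expR a - 1) * (cos b - 1)).
have := ler_normD (expR a - 1 - a) (cos b - 1).
have := ler_normD (sin b - b) ((expR a - 1) * sin b).
lra.
Qed.

Lemma has_cderiv_expC (D : C -> Prop) z : has_cderiv D (@expC R) z (expC z).
Proof.
have h : has_cderiv (fun=> True) (fun w => w - z) z 1.
  have := has_cderivB (@has_cderiv_id R (fun=> True) z) (has_cderiv_cst (fun=> True) z z).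
  by rewrite subr0.
have h2 := @has_cderiv_comp R (fun=> True) (fun=> True) (fun w => w - z) (@expC R) z 1 1.
have {}h2 := h2 (fun _ _ => I) h.
rewrite subrr in h2.
have {}h2 := has_cderivZ (expC z) (h2 (@has_cderiv_expC0 _)).
rewrite !mulr1 in h2.
apply: (@has_cderivW _ (fun=> True)) => //.
apply: (@has_cderiv_eq_near _ _ _ _ _ _ 1) h2 => //.
  by move=> w _ _; rewrite -expCD addrC subrK.
by rewrite subrr expC0 mulr1.
Qed.

End ComplexExp.

Section CircleMeans.
Variable R : realType.
Local Notation C := R[i].
Implicit Types (f F : C -> C) (z w c d h : C) (x y r M : R).
Local Notation full := (fun=> True).

Lemma eps_real_deriv (f : R -> R) x (d : R) :
  (forall e : R, 0 < e -> exists2 r : R, 0 < r & forall t : R, `|t| < r ->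
    `|f (x + t) - f x - d * t| <= e * `|t|) -> is_derive x 1 f d.
Proof.
move=> H.
have L : (fun h : R => h^-1 *: ((f \o shift x) (h *: 1) - f x)) @ (0 : R)^' --> d.
  apply/cvgrPdist_le => e e0; have [r r0 hr] := H e e0.
  exists r => //= h; rewrite /ball /= sub0r normrN => hr' h0.
  have := hr h hr'; rewrite /GRing.scale /= mulr1 (addrC h x) => hh.
  have -> : d - h^-1 * (f (x + h) - f x) = - ((f (x + h) - f x - d * h) * h^-1) by field.
  by rewrite normrN normrM normfV ler_pdivrMr ?normr_gt0.
split; first by apply/cvg_ex; exists d.
exact: cvg_lim L.
Qed.

Lemma Re_lin (v a b c d : C) (t : R) :
  complex.Re (v * a) - complex.Re (v * b) - complex.Re (v * c * d) * t =
  complex.Re (v * (a - b - c * (t%:C%C * d))).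
Proof.
by case: v a b c d => [v1 v2] [a1 a2] [b1 b2] [c1 c2] [d1 d2]; rewrite /= ; ring.
Qed.

(** The real mean value theorem is applied to the component of [f] in the direction [f w - f z]; its
    increment over the segment is the squared modulus of [f w - f z]. *)
Lemma segment_le f z w M :
  (forall t : R, 0 <= t <= 1 -> exists2 d, has_cderiv full f (z + t%:C%C * (w - z)) d & rnorm d <= M) ->
  rnorm (f w - f z) <= M * rnorm (w - z).
Proof.
move=> H; set v := f w - f z.
have [v0|v0] := eqVneq v 0.
  rewrite v0 rnorm0 mulr_ge0 ?rnorm_ge0//.
  by have [|d _] := H 0; [rewrite lexx ler01|apply: le_trans; exact: rnorm_ge0].
have nv0 : 0 < rnorm v by rewrite rnorm_gt0.
pose g (t : R) := complex.Re (conjc v * f (z + t%:C%C * (w - z))).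
pose D (t : R) := xget 0 [set d | has_cderiv full f (z + t%:C%C * (w - z)) d /\ rnorm d <= M].
have HD t : 0 <= t <= 1 -> has_cderiv full f (z + t%:C%C * (w - z)) (D t) /\ rnorm (D t) <= M.
  move=> /H [d h1 h2]; rewrite /D; case: xgetP => [y _ //|/(_ d)]; by case.
have dg (t : R) : 0 <= t <= 1 -> is_derive t 1 g (complex.Re (conjc v * D t * (w - z))).
  move=> /HD [h1 _]; apply: eps_real_deriv => e e0.
  pose K := rnorm v * rnorm (w - z) + 1.
  have K0 : 0 < K by rewrite ltr_wpDl// mulr_ge0 ?rnorm_ge0.
  have [r r0 hr] := h1 (e / K) (divr_gt0 e0 K0).
  have k0 : 0 < rnorm (w - z) + 1 by rewrite ltr_wpDl ?rnorm_ge0.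
  exists (r / (rnorm (w - z) + 1)); first by rewrite divr_gt0.
  move=> h0; move: h0 => h hh; rewrite /g.
  have E : (z + (t + h)%:C%C * (w - z)) - (z + t%:C%C * (w - z)) = h%:C%C * (w - z).
    by rewrite rmorphD /=; ring.
  have := hr (z + (t + h)%:C%C * (w - z)) I; rewrite E rnormM rnorm_real.
  have N0 := rnorm_ge0 (w - z).
  have hr' : `|h| * rnorm (w - z) < r.
    by move: hh; rewrite ltr_pdivlMr// => hh; have := normr_ge0 h; nra.
  move=> /(_ hr') h2.
  rewrite -[X in _ - X - _]/(complex.Re _).
  have -> : complex.Re (conjc v * f (z + (t + h)%:C%C * (w - z))) - complex.Re (conjc v * f (z + t%:C%C * (w - z)))
     - complex.Re (conjc v * D t * (w - z)) * h =
     complex.Re (conjc v * (f (z + (t + h)%:C%C * (w - z)) - f (z + t%:C%C * (w - z)) - D t * (h%:C%C * (w - z)))).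
    exact: Re_lin.
  apply: le_trans (ler_Re_rnorm _) _; rewrite rnormM.
  have -> : rnorm (conjc v) = rnorm v by rewrite /rnorm normcJ.
  apply: (@le_trans _ _ (rnorm v * (e / K * (`|h| * rnorm (w - z))))).
    by rewrite ler_wpM2l ?rnorm_ge0.
  have -> : rnorm v * (e / K * (`|h| * rnorm (w - z))) = (rnorm v * rnorm (w - z)) / K * (e * `|h|).
    by field; rewrite gt_eqF.
  rewrite -[leRHS]mul1r ler_wpM2r ?mulr_ge0 ?(ltW e0)// ler_pdivrMr// mul1r /K lerDl//.
have [||t ht] := @MVT_segment R g (fun t => complex.Re (conjc v * D t * (w - z))) 0 1 ler01.
- by move=> t; rewrite in_itv /= => /andP[t0 t1]; apply: dg; rewrite !ltW.
- apply: derivable_within_continuous => t; rewrite in_itv /= => /dg ht.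
  exact: (@ex_derive _ _ _ _ _ _ _ ht).
have -> : g 1 - g 0 = rnorm v ^+ 2.
  have -> : g 1 = complex.Re (conjc v * f w).
    by rewrite /g; congr (complex.Re (_ * f _)); rewrite (_ : (1 : R)%:C%C = 1)//; ring.
  have -> : g 0 = complex.Re (conjc v * f z).
    by rewrite /g; congr (complex.Re (_ * f _)); rewrite (_ : (0 : R)%:C%C = 0)//; ring.
  rewrite -Re_opp -Re_add -mulrBr -/v.
  rewrite rnorm_sqrt sqr_sqrtr ?addr_ge0 ?sqr_ge0//.
  by case: (v) => a b /=; ring.
rewrite subr0 mulr1 => e1.
have : rnorm v ^+ 2 <= rnorm v * (M * rnorm (w - z)).
  rewrite e1; apply: le_trans (ler_norm _) _; apply: le_trans (ler_Re_rnorm _) _.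
  rewrite !rnormM -mulrA; have -> : rnorm (conjc v) = rnorm v by rewrite /rnorm normcJ.
  rewrite ler_wpM2l ?rnorm_ge0// ler_wpM2r ?rnorm_ge0//.
  by move: ht; rewrite in_itv /= => ht; have [] := HD t ht.
by rewrite expr2 ler_pM2l.
Qed.

(** The integral over the angle on the circle of radius [expR x], not divided by [2 * pi]. In the
    coordinate [x +i* y] an annulus is a rectangle, periodic in [y]. *)
Definition cmean F x := cint (- pi) pi (fun y => F (expC (x +i* y)%C)).

Let pp : - pi <= pi :> R. Proof. by have := pi_ge0 R; lra. Qed.

Lemma ccont_comp (D D' : C -> Prop) F f z : (forall w, D w -> D' (f w)) ->
  ccont D f z -> ccont D' F (f z) -> ccont D (fun w => F (f w)) z.
Proof.
move=> DD hf hF e e0; have [r r0 hr] := hF e e0; have [r' r'0 hr'] := hf r r0.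
by exists r' => // w Dw wr; apply: hr; [exact: DD|exact: hr'].
Qed.

Lemma ccont_expC (D : C -> Prop) z : ccont D (@expC R) z.
Proof. exact: cderiv_ccont (has_cderiv_expC D z). Qed.

Lemma cmean_rcont F x : (forall w, rnorm w = expR x -> ccont full F w) ->
  rcont (- pi) pi (fun y => F (expC (x +i* y)%C)).
Proof.
move=> h; apply: (@rcont_v _ (fun u => F (expC u)) x x).
  move=> z [/andP[z1 z2] _]; apply: (@ccont_comp _ full) => //; first exact: ccont_expC.
  by apply: h; rewrite rnorm_expC; congr expR; apply/eqP; rewrite eq_le z1 z2.
by rewrite lexx.
Qed.

Lemma cmean_le F x M : (forall w, rnorm w = expR x -> ccont full F w) ->
  (forall w, rnorm w = expR x -> rnorm (F w) <= M) -> rnorm (cmean F x) <= 4 * pi * M.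
Proof.
move=> h hM; have -> : 4 * pi * M = 2 * (M * (pi - - pi)) by ring.
apply: cint_le => //; first exact: cmean_rcont.
by move=> t _; apply: hM; rewrite rnorm_expC.
Qed.

Lemma cmean_shift F x0 x1 c : x0 < x1 ->
  (forall w, expR x0 <= rnorm w <= expR x1 -> ccont full F w) ->
  (forall w, expR x0 <= rnorm w <= expR x1 -> w != c -> cdiff full F w) ->
  cmean F x1 = cmean F x0.
Proof.
move=> x01 hc hd.
have [E hE] : exists E : seq C, forall u, - pi <= complex.Im u <= pi -> expC u = c -> u \in E.
  have [->|c0] := eqVneq c 0; first by exists [::] => u _ /eqP; rewrite (negPf (expC_neq0 _)).
  have [t ht ct] := polar c0.
  (* The closed strip contains both ends [pi] and [- pi], so that a point [c] on the negative real
     axis has two preimages; the list covers every case. *)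
  exists [:: (ln (rnorm c) +i* t)%C; (ln (rnorm c) +i* pi)%C; (ln (rnorm c) +i* - pi)%C].
  move=> [a b] /= hb; rewrite {1}ct => /expC_inj_strip /= [-> /cos_eq1].
  rewrite !inE !eq_complex /= !eqxx /=.
  case; first by apply/andP; split; lra.
  - by move=> bt; apply/or3P/Or31/eqP; lra.
  - by move=> bt; apply/or3P/Or32/eqP; lra.
  - by move=> bt; apply/or3P/Or33/eqP; lra.
have bd u : rect x0 x1 (- pi) pi u -> expR x0 <= rnorm (expC u) <= expR x1.
  by case=> /andP[u1 u2] _; rewrite rnorm_expC !ler_expR u1.
apply: (@strip_shift _ E (fun u => F (expC u))) => //.
- by have := pi_gt0 R; lra.
- move=> u /bd hu; apply: (@ccont_comp _ full) => //; first exact: ccont_expC.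
  exact: hc.
- move=> u /[dup] Qu /bd hu; have [ec|nc] := eqVneq (expC u) c.
    by left; apply: hE => //; case: Qu.
  right; have [d hFd] := hd _ hu nc; exists (d * expC u).
  by apply: (@has_cderiv_comp _ _ full) => //; exact: has_cderiv_expC.
- by move=> x _; rewrite !expCE sinN cosN sinpi oppr0.
Qed.

(** The radius is moved towards [0], where continuity makes the mean approach [2 * pi * F 0]. At the
    point [c] continuity alone suffices, as in [goursat]. *)
Lemma cmean_center F r c : 0 < r -> (forall w, rnorm w <= r -> ccont full F w) ->
  (forall w, rnorm w <= r -> w != c -> cdiff full F w) ->
  cmean F (ln r) = (pi *+ 2)%:C%C * F 0.
Proof.
move=> r0 hc hd; have p0 := pi_gt0 R.
apply/eqP; rewrite -subr_eq0 -rnorm_eq0; apply/eqP/le_anti; rewrite rnorm_ge0 andbT.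
apply/ler_addgt0Pr => e e0; rewrite add0r.
have e1 : 0 < e / (4 * pi) by rewrite divr_gt0// mulr_gt0.
have [|d d0 hd0] := hc 0 _ _ e1; first by rewrite rnorm0 ltW.
pose x0 := Num.min (ln r - 1) (ln (d / 2)).
have x0r : x0 < ln r by rewrite gt_min; apply/orP; left; lra.
have x0d : expR x0 < d.
  apply: (@le_lt_trans _ _ (d / 2)); last by rewrite ltr_pdivrMr// ltr_pMr// ltr1n.
  by rewrite -[leRHS]lnK ?posrE ?divr_gt0// ler_expR ge_min lexx orbT.
have le_r w : rnorm w <= expR (ln r) -> rnorm w <= r by rewrite lnK ?posrE.
rewrite (@cmean_shift F x0 (ln r) c)//; first last.
- by move=> w /andP[_ /le_r]; exact: hd.
- by move=> w /andP[_ /le_r]; exact: hc.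
have hx w : rnorm w = expR x0 -> rnorm w <= r.
  by move=> wx; apply: le_r; rewrite wx ler_expR ltW.
have -> : (pi *+ 2)%:C%C * F 0 = cint (- pi) pi (fun=> F 0).
  by rewrite cint_cst// opprK mulr2n.
rewrite /cmean -cintB; [|by apply: cmean_rcont => w /hx; exact: hc|exact: rcont_cst].
have -> : e = 4 * pi * (e / (4 * pi)) by rewrite mulrC divfK// lt0r_neq0// mulr_gt0.
have -> : 4 * pi * (e / (4 * pi)) = 2 * ((e / (4 * pi)) * (pi - - pi)) by ring.
apply: cint_le => //.
  apply: (@cmean_rcont (fun w => F w - F 0)) => w /hx /hc hw.
  move=> e' /hw [r' r'0 hr']; exists r' => // u Du /(hr' _ Du).
  by have -> : F u - F 0 - (F w - F 0) = F u - F w by ring.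
move=> t _; apply/ltW/hd0 => //; by rewrite subr0 rnorm_expC.
Qed.

Lemma cmean_ext F G x : (forall w, rnorm w = expR x -> F w = G w) -> cmean F x = cmean G x.
Proof. by move=> FG; apply: eq_cint => t _; apply: FG; rewrite rnorm_expC. Qed.

Lemma cmean_cst d x : cmean (fun=> d) x = (pi *+ 2)%:C%C * d.
Proof. by rewrite /cmean cint_cst// opprK mulr2n. Qed.

Lemma cmeanD F G x : (forall w, rnorm w = expR x -> ccont full F w) ->
  (forall w, rnorm w = expR x -> ccont full G w) ->
  cmean (fun w => F w + G w) x = cmean F x + cmean G x.
Proof. by move=> hF hG; rewrite /cmean cintD//; exact: cmean_rcont. Qed.

Lemma cmeanZ F d x : (forall w, rnorm w = expR x -> ccont full F w) ->
  cmean (fun w => d * F w) x = d * cmean F x.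
Proof. by move=> hF; rewrite /cmean cintZ//; exact: cmean_rcont. Qed.

Lemma cdiff_kernel d h w : w != h -> cdiff full (fun u => d / (u - h)) w.
Proof.
move=> wh; have wh0 : w - h != 0 by rewrite subr_eq0.
eexists; apply: has_cderivZ.
apply: (@has_cderiv_comp _ full full (fun u => u - h) (fun u => u^-1)) => //.
  exact: has_cderivB (has_cderiv_id _ _) (has_cderiv_cst _ _ _).
exact: has_cderiv_inv.
Qed.

(** Beyond the radius [rnorm h] the kernel is holomorphic and decays, so the radius can be moved to
    infinity; [K] is the distance from [h] at which the trivial bound drops below [e]. *)
Lemma cmean_kernel0 h r : rnorm h < r -> cmean (fun w => h / (w - h)) (ln r) = 0.
Proof.
move=> hr; have r0 : 0 < r by apply: le_lt_trans hr; exact: rnorm_ge0.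
have p0 := pi_gt0 R.
apply/eqP; rewrite -rnorm_eq0; apply/eqP/le_anti; rewrite rnorm_ge0 andbT.
apply/ler_addgt0Pr => e e0; rewrite add0r.
pose K := 4 * pi * rnorm h / e + r.
have n0 := rnorm_ge0 h.
have K1 : r <= K by rewrite /K lerDr divr_ge0 ?(ltW e0)// mulr_ge0// mulr_ge0// ltW.
pose R1 := rnorm h + K + 1.
have R1r : r < R1 by rewrite /R1; lra.
have R10 : 0 < R1 by apply: lt_trans R1r.
have ne w x : rnorm h < expR x -> expR x <= rnorm w -> w != h.
  by move=> h1 h2; apply/eqP => wh; move: (lt_le_trans h1 h2); rewrite wh ltxx.
have hr' : rnorm h < expR (ln r) by rewrite lnK ?posrE.
rewrite -(@cmean_shift _ (ln r) (ln R1) h); first last.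
- by move=> w _; exact: cdiff_kernel.
- by move=> w /andP[w1 _]; apply/cdiff_ccont/cdiff_kernel/(ne _ _ hr').
- by rewrite ltr_ln ?posrE.
have K0 : 0 < K by apply: lt_le_trans K1.
apply: (@le_trans _ _ (4 * pi * (rnorm h / K))).
  apply: cmean_le => w; rewrite lnK ?posrE// => wR.
    by apply/cdiff_ccont/cdiff_kernel; apply/eqP => wh; move: wR; rewrite wh /R1; lra.
  have KK : K <= rnorm (w - h).
    by have := lerB_rnorm w h; rewrite wR /R1; lra.
  rewrite rnormM rnormV ler_wpM2l// lef_pV2 ?posrE//.
  exact: lt_le_trans KK.
have -> : 4 * pi * (rnorm h / K) = 4 * pi * rnorm h / K by rewrite !mulrA.
rewrite ler_pdivrMr//.
have -> : e * K = 4 * pi * rnorm h + e * r by rewrite /K; field; exact: lt0r_neq0.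
rewrite lerDl.
by rewrite mulr_ge0 ?ltW.
Qed.

Section Cauchy.
Variables (f : C -> C) (r : R).
Hypothesis r0 : 0 < r.
Hypothesis fd : forall w, rnorm w <= r -> cdiff full f w.

Lemma cdiffM F G w : cdiff full F w -> cdiff full G w -> cdiff full (fun u => F u * G u) w.
Proof. by move=> [d hF] [d' hG]; eexists; apply: has_cderivM hF hG. Qed.

Lemma cdiffB F G w : cdiff full F w -> cdiff full G w -> cdiff full (fun u => F u - G u) w.
Proof. by move=> [d hF] [d' hG]; eexists; apply: has_cderivB hF hG. Qed.

Lemma cdiffD F G w : cdiff full F w -> cdiff full G w -> cdiff full (fun u => F u + G u) w.
Proof. by move=> [d hF] [d' hG]; eexists; apply: has_cderivD hF hG. Qed.

Lemma cdiff_cst d w : cdiff full (fun=> d) w.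
Proof. by eexists; exact: has_cderiv_cst. Qed.

Lemma cdiff_id w : cdiff full id w.
Proof. by eexists; exact: has_cderiv_id. Qed.

Lemma cdiffX F k w : cdiff full F w -> cdiff full (fun u => F u ^+ k) w.
Proof.
move=> hF; elim: k => [|k IH]; first exact: cdiff_cst.
have := cdiffM hF IH; move=> [d hd]; exists d.
by apply: (@has_cderiv_eq_near _ _ _ _ _ _ 1) hd => //; rewrite ?exprS// => u _ _; rewrite exprS.
Qed.

(** The value at [h] is the derivative, which makes the quotient continuous there; [h] is thus the
    exceptional point that Goursat's lemma admits. *)
Definition dquot h w := if w == h then xget 0 [set d | has_cderiv full f h d] else (f w - f h) / (w - h).

Lemma dquot_cdiff h w : rnorm w <= r -> w != h -> cdiff full (dquot h) w.
Proof.
move=> wr wh; have wh0 : w - h != 0 by rewrite subr_eq0.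
have [d hd] : cdiff full (fun u => (f u - f h) * (1 / (u - h))) w.
  by apply: cdiffM; [apply: cdiffB; [exact: fd|exact: cdiff_cst]|exact: cdiff_kernel].
exists d; apply: (@has_cderiv_eq_near _ _ _ _ _ _ (rnorm (w - h))) hd => //.
- by rewrite rnorm_gt0.
- move=> u _ uw; rewrite /dquot ifN ?mul1r//; apply/eqP => uh.
  by move: uw; rewrite uh rnormBC ltxx.
- by rewrite /dquot ifN ?mul1r.
Qed.

Lemma dquot_ccont h w : rnorm h <= r -> rnorm w <= r -> ccont full (dquot h) w.
Proof.
move=> hr wr; have [->|] := eqVneq w h; last by move=> wh; apply/cdiff_ccont/dquot_cdiff.
move=> e e0; have hD : has_cderiv full f h (dquot h h).
  by rewrite /dquot eqxx; case: (fd hr) => d hd; apply: (@xgetPex _ 0 [set d | has_cderiv full f h d]); exists d.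
have e2 : 0 < e / 2 by rewrite divr_gt0.
have [s s0 hs] := hD _ e2; exists s => // u _ us.
have [->|uh] := eqVneq u h; first by rewrite subrr rnorm0.
have uh0 : 0 < rnorm (u - h) by rewrite rnorm_gt0 subr_eq0.
rewrite {1}/dquot (negPf uh).
have -> : (f u - f h) / (u - h) - dquot h h = (f u - f h - dquot h h * (u - h)) / (u - h).
  by field; rewrite subr_eq0.
rewrite rnormM rnormV ltr_pdivrMr//; apply: le_lt_trans (hs u I us) _.
by rewrite ltr_pM2r// ltr_pdivrMr// ltr_pMr// ltr1n.
Qed.

(** The mean of [w * dquot h w] is its value at the centre, which is [0]. Writing it as [f w * (w /
    (w - h)) - f h * (1 + h / (w - h))] gives Cauchy's formula, by [cmean_kernel0]. *)
Lemma cauchy_kernel h : rnorm h < r ->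
  cmean (fun w => f w * (w / (w - h))) (ln r) = (pi *+ 2)%:C%C * f h.
Proof.
move=> hr.
have er : expR (ln r) = r by rewrite lnK ?posrE.
have := @cmean_center (fun w => w * dquot h w) r h r0.
rewrite mul0r mulr0 => H.
have {}H : cmean (fun w => w * dquot h w) (ln r) = 0.
  apply: H => w wr.
    move=> e e0; have [d1] := cdiff_id w.
    move=> /cderiv_ccont h1; have h2 := @dquot_ccont h w (ltW hr) wr.
    have B1 : 0 < rnorm w + rnorm (dquot h w) + 1 by rewrite ltr_wpDl// addr_ge0 ?rnorm_ge0.
    pose e1 := Num.min 1 (e / 2 / (rnorm w + rnorm (dquot h w) + 1)).
    have e10 : 0 < e1 by rewrite lt_min ltr01 !divr_gt0.
    have [s s0 hs] := h1 e1 e10; have [s' s'0 hs'] := h2 e1 e10.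
    exists (Num.min s s'); first by rewrite lt_min s0.
    move=> u _; rewrite lt_min => /andP[us us'].
    have -> : u * dquot h u - w * dquot h w = (u - w) * (dquot h u - dquot h w) + (u - w) * dquot h w + w * (dquot h u - dquot h w) by ring.
    have k1 := hs u I us; have k2 := hs' u I us'; rewrite /= in k1.
    have e11 : e1 <= 1 by rewrite ge_min lexx.
    have e12 : e1 * (rnorm w + rnorm (dquot h w) + 1) <= e / 2.
      by rewrite -ler_pdivlMr// ge_min lexx orbT.
    have a1 : rnorm (u - w) * rnorm (dquot h u - dquot h w) <= e1 * 1.
      by apply: ler_pM; rewrite ?rnorm_ge0//; [exact: ltW|apply: le_trans e11; exact: ltW].
    have a2 : rnorm (u - w) * rnorm (dquot h w) <= e1 * rnorm (dquot h w).
      by rewrite ler_wpM2r ?rnorm_ge0 ?ltW.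
    have a3 : rnorm w * rnorm (dquot h u - dquot h w) <= rnorm w * e1.
      by rewrite ler_wpM2l ?rnorm_ge0 ?ltW.
    apply: le_lt_trans (ler_rnormD _ _) _.
    apply: (@le_lt_trans _ _ (e / 2)); last by rewrite ltr_pdivrMr// ltr_pMr// ltr1n.
    apply: le_trans (lerD (ler_rnormD _ _) (lexx _)) _; rewrite !rnormM; lra.
  by move=> wh; apply: cdiffM; [exact: cdiff_id|exact: dquot_cdiff].
have ne w : rnorm w = r -> w != h by move=> wr; apply/eqP => wh; move: hr; rewrite -wh wr ltxx.
have ck w : rnorm w = r -> cdiff full (fun u => u / (u - h)) w.
  move=> wr; have [d hd] := cdiffM (cdiff_id w) (cdiff_kernel 1 (ne _ wr)).
  exists d; apply: (@has_cderiv_eq_near _ _ _ _ _ _ 1) hd => // [u _ _|]; by rewrite mul1r.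
have c1 w : rnorm w = expR (ln r) -> ccont full (fun w => f w * (w / (w - h))) w.
  by rewrite er => wr; apply/cdiff_ccont/cdiffM; [apply: fd; rewrite wr|exact: ck].
have c2 w : rnorm w = expR (ln r) -> cdiff full (fun w => 1 + h / (w - h)) w.
  rewrite er => wr; apply/cdiffD; first exact: cdiff_cst.
  by apply: cdiff_kernel; exact: ne.
have : cmean (fun w => w * dquot h w) (ln r) =
    cmean (fun w => f w * (w / (w - h)) + (- f h) * (1 + h / (w - h))) (ln r).
  apply: cmean_ext => w; rewrite er => /ne wh; rewrite /dquot (negPf wh); field.
  by rewrite subr_eq0.
rewrite H cmeanD//; last by move=> w /c2 hw; apply/cdiff_ccont/cdiffM => //; exact: cdiff_cst.
rewrite cmeanZ; last by move=> w /c2 /cdiff_ccont.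
rewrite cmeanD; first last.
- by move=> w; rewrite er => /ne wh; apply/cdiff_ccont/cdiff_kernel.
- by move=> w _; apply/cdiff_ccont/cdiff_cst.
rewrite cmean_cst cmean_kernel0// => /eqP; rewrite eq_sym => /eqP e0.
apply/eqP; rewrite -subr_eq0 -e0; apply/eqP; ring.
Qed.

(** Cauchy's integral for the [k]-th Taylor coefficient; the integral is over the angle, whence
    [w ^+ k] and not [w ^+ k.+1]. *)
Definition tcoef k : C := ((pi *+ 2)%:C%C)^-1 * cmean (fun w => f w / w ^+ k) (ln r).

Let er : expR (ln r) = r. Proof. by rewrite lnK ?posrE. Qed.

Let cM M (F : C -> C) : (forall w, rnorm w = r -> cdiff full F w) ->
  (forall w, rnorm w = r -> rnorm (F w) <= M) ->
  rnorm (((pi *+ 2)%:C%C)^-1 * cmean F (ln r)) <= 2 * M.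
Proof.
move=> hF hM; have p0 := pi_gt0 R.
have p20 : 0 < pi *+ 2 :> R by rewrite pmulrn_rgt0.
rewrite rnormM rnormV rnorm_real ger0_norm ?(ltW p20)// ler_pdivrMl//.
have -> : pi *+ 2 * (2 * M) = 4 * pi * M :> R by ring.
by apply: cmean_le; rewrite er => w; [move=> /hF /cdiff_ccont|exact: hM].
Qed.

Let nz w : rnorm w = r -> w != 0.
Proof. by move=> wr; rewrite -rnorm_gt0 wr. Qed.

Let cdk k w : rnorm w = r -> cdiff full (fun w => f w / w ^+ k) w.
Proof.
move=> wr; apply: cdiffM; first by apply: fd; rewrite wr.
have [d hd] := cdiffX k (cdiff_id w).
eexists; apply: (@has_cderiv_comp _ full full _ (fun u => u^-1)) hd _ => //.
by apply: has_cderiv_inv; rewrite expf_neq0// nz.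
Qed.

Lemma tcoef_le k M : (forall w, rnorm w = r -> rnorm (f w) <= M) ->
  rnorm (tcoef k) <= 2 * (M / r ^+ k).
Proof.
move=> hM; apply: cM => [w|w wr]; first exact: cdk.
by rewrite rnormM rnormV rnormX wr ler_wpM2r ?hM// invr_ge0 exprn_ge0// ltW.
Qed.

(** Three terms of the geometric expansion of Cauchy's kernel. The remainder carries
    [h ^+ 3 / (w - h)], and [rnorm (w - h)] is at least [r / 2] on the circle. *)
Lemma taylor3 M : (forall w, rnorm w = r -> rnorm (f w) <= M) ->
  forall h, rnorm h <= r / 2 ->
  rnorm (f h - tcoef 0 - tcoef 1 * h - tcoef 2 * h ^+ 2) <= 4 * M * (rnorm h / r) ^+ 3.
Proof.
move=> hM h hr; have p0 := pi_gt0 R.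
have p20 : (pi *+ 2)%:C%C != 0 :> C by rewrite -rnorm_eq0 rnorm_real normr_eq0 lt0r_neq0// pmulrn_rgt0.
have hr' : rnorm h < r by apply: le_lt_trans hr _; rewrite ltr_pdivrMr// ltr_pMr// ltr1n.
have fh : f h = ((pi *+ 2)%:C%C)^-1 * cmean (fun w => f w * (w / (w - h))) (ln r).
  by rewrite cauchy_kernel// mulKf.
have ne w : rnorm w = r -> w - h != 0.
  by move=> wr; rewrite subr_eq0; apply/eqP => wh; move: hr'; rewrite -wh wr ltxx.
pose G w := f w / w ^+ 2 * (h ^+ 3 / (w - h)).
have hG w : rnorm w = r -> cdiff full G w.
  move=> wr; apply: cdiffM; first exact: cdk.
  by apply: cdiff_kernel; rewrite -subr_eq0 ne.
have Z (c : C) k w : rnorm w = r -> cdiff full (fun w => c * (f w / w ^+ k)) w.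
  by move=> wr; apply: cdiffM; [exact: cdiff_cst|exact: cdk].
have E : cmean (fun w => f w * (w / (w - h))) (ln r) =
  cmean (fun w => (f w / w ^+ 0 + h * (f w / w ^+ 1)) + (h ^+ 2 * (f w / w ^+ 2) + G w)) (ln r).
  apply: cmean_ext => w; rewrite er => wr; rewrite /G; field.
  by rewrite ne// nz.
have e1 : f h - tcoef 0 - tcoef 1 * h - tcoef 2 * h ^+ 2 = ((pi *+ 2)%:C%C)^-1 * cmean G (ln r).
  rewrite fh E cmeanD; rewrite ?er.
  - rewrite cmeanD ?er.
    + rewrite cmeanD ?er.
      * rewrite cmeanZ ?er; last by move=> w /(cdk 1)/cdiff_ccont.
        rewrite cmeanZ ?er; last by move=> w /(cdk 2)/cdiff_ccont.
        by rewrite /tcoef; ring.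
      * by move=> w wr; apply/cdiff_ccont/Z.
      * by move=> w /hG /cdiff_ccont.
    + by move=> w /(cdk 0)/cdiff_ccont.
    + by move=> w wr; apply/cdiff_ccont/Z.
  - by move=> w wr; apply/cdiff_ccont/cdiffD; [exact: cdk|exact: Z].
  - by move=> w wr; apply/cdiff_ccont/cdiffD; [exact: Z|exact: hG].
rewrite e1; have -> : 4 * M * (rnorm h / r) ^+ 3 = 2 * (M / r ^+ 2 * (rnorm h ^+ 3 / (r / 2))).
  by field; rewrite gt_eqF.
apply: cM => // w wr.
rewrite /G rnormM [rnorm (f w / _)]rnormM [rnorm (_ / (w - h))]rnormM !rnormV !rnormX wr.
have M0 : 0 <= M by apply: le_trans (hM _ wr); exact: rnorm_ge0.
apply: ler_pM; rewrite ?mulr_ge0 ?invr_ge0 ?exprn_ge0 ?rnorm_ge0 ?(ltW r0)//.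
  by rewrite ler_wpM2r ?hM// invr_ge0 exprn_ge0// ltW.
apply: ler_wpM2l; first by rewrite exprn_ge0// rnorm_ge0.
rewrite lef_pV2 ?posrE ?divr_gt0 ?rnorm_gt0 ?ne//.
by have := lerB_rnorm w h; rewrite wr; lra.
Qed.

Lemma tcoef0 : tcoef 0 = f 0.
Proof.
rewrite /tcoef; have -> : cmean (fun w => f w / w ^+ 0) (ln r) = cmean f (ln r).
  by apply: cmean_ext => w _; rewrite expr0 divr1.
rewrite (@cmean_center f r 0)//; [|by move=> w /fd /cdiff_ccont|by move=> w /fd].
rewrite mulKf// -rnorm_eq0 rnorm_real normr_eq0 lt0r_neq0// pmulrn_rgt0// pi_gt0//.
Qed.

End Cauchy.

End CircleMeans.

(** * Uniqueness of meromorphic continuations *)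

Section Meromorphic.
Variable R : realType.
Local Notation C := R[i].
Implicit Types (f g h : C -> C) (z w : C) (r e : R).
Local Notation full := (fun=> True).

Lemma rnorm_ltE z (e : C) : 0 < e -> (`|z| < e) = (rnorm z < complex.Re e).
Proof. by move=> e0; rewrite rnormE ltcE /= (ger0_Im (ltW e0)) eqxx. Qed.

Lemma near_rnormP z (P : C -> Prop) : (\forall w \near (z : C^o), P w) <->
  exists2 r : R, 0 < r & forall w, rnorm (w - z) < r -> P w.
Proof.
split.
  move=> /nbhs_ballP[e /= e0 he]; exists (complex.Re e).
    by move: e0; rewrite ltcE /= => /andP[].
  move=> w wr; apply: he; rewrite /ball /= distrC rnorm_ltE//.
move=> [r r0 hr]; apply/nbhs_ballP; exists (r%:C%C); first by rewrite /= ltcR.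
by move=> w; rewrite /ball /= distrC rnorm_ltE ?ltcR//; exact: hr.
Qed.

Lemma dnear_rnormP z (P : C -> Prop) : (\forall w \near ((z : C^o)^'), P w) <->
  exists2 r : R, 0 < r & forall w, 0 < rnorm (w - z) < r -> P w.
Proof.
rewrite /dnbhs; split.
  move=> H; have /near_rnormP[r r0 hr] : \forall w \near (z : C^o), w != z -> P w by exact: H.
  exists r => // w /andP[w0 wr]; apply: hr => //.
  by move: w0; rewrite rnorm_gt0 subr_eq0.
move=> [r r0 hr].
suff : \forall w \near (z : C^o), w != z -> P w by [].
by apply/near_rnormP; exists r => // w wr wz; apply: hr; rewrite rnorm_gt0 subr_eq0 wz.
Qed.

Lemma derivable_cdiff f z : derivable (f : C^o -> C^o) z 1 <-> cdiff full f z.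
Proof.
split.
  move=> /cvg_ex[d /= /cvgrPdist_le hd]; exists d => e e0.
  have := hd (e%:C%C); rewrite ltcR => /(_ e0) /dnear_rnormP[r r0 hr].
  exists r => // w _ wr.
  have [->|wz] := eqVneq w z; first by rewrite !subrr mulr0 subr0 rnorm0 mulr0.
  have wz0 : w - z != 0 by rewrite subr_eq0.
  have := hr (w - z); rewrite subr0 rnorm_gt0 wz0 wr => /(_ isT).
  rewrite /GRing.scale /= mulr1 subrK rnormE lecR => hh.
  have -> : f w - f z - d * (w - z) = - ((d - (w - z)^-1 * (f w - f z)) * (w - z)) by field.
  by rewrite rnormN rnormM ler_wpM2r ?rnorm_ge0.
move=> [d hd]; apply/cvg_ex; exists d; apply/cvgrPdist_le => /= e e0.
have er : (complex.Re e)%:C%C = e by rewrite RRe_real// ger0_real// ltW.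
have er0 : 0 < complex.Re e by rewrite -ltcR er.
have [r r0 hr] := hd _ er0.
apply/dnear_rnormP; exists r => // w; rewrite subr0 rnorm_gt0 => /andP[w0 wr].
rewrite /GRing.scale /= mulr1 rnormE -er lecR.
have -> : d - w^-1 * (f (w + z) - f z) = - ((f (w + z) - f z - d * (w + z - z)) / w) by field.
rewrite rnormN rnormM rnormV ler_pdivrMr ?rnorm_gt0//.
by apply: le_trans (hr _ I _) _; rewrite addrK.
Qed.

Definition mero_at f z := exists2 r : R, 0 < r &
  (forall w, 0 < rnorm (w - z) < r -> cdiff full f w) /\
  (cdiff full f z \/ forall M : R, exists2 r' : R, 0 < r' &
     forall w, 0 < rnorm (w - z) < r' -> M < rnorm (f w)).

Lemma meromorphicP f : meromorphic f <-> forall z, mero_at f z.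
Proof.
split=> H z.
  case: (H z) => [/near_rnormP[r r0 hr]|[/dnear_rnormP[r r0 hr] /cvgryPgt hM]].
    exists r => //; split; last by left; apply/derivable_cdiff/hr; rewrite subrr rnorm0.
    by move=> w /andP[_ wr]; apply/derivable_cdiff/hr.
  exists r => //; split; first by move=> w wr; apply/derivable_cdiff/hr.
  by right => M; have /dnear_rnormP[r' r'0 hr'] := hM M; exists r'.
have [r r0 [h1 [h2|h2]]] := H z; [left|right].
  apply/near_rnormP; exists r => // w wr; apply/derivable_cdiff.
  by have [->//|wz] := eqVneq w z; apply: h1; rewrite rnorm_gt0 subr_eq0 wz.
split; first by apply/dnear_rnormP; exists r => // w wr; apply/derivable_cdiff/h1.
by apply/cvgryPgt => M; apply/dnear_rnormP; have [r' r'0 hr'] := h2 M; exists r'.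
Qed.

Lemma circle_bounded f r : 0 < r -> (forall w, rnorm w = r -> ccont full f w) ->
  exists M : R, forall w, rnorm w = r -> rnorm (f w) <= M.
Proof.
move=> r0 fc; have p0 := pi_gt0 R.
have er : expR (ln r) = r by rewrite lnK ?posrE.
have hr : rcont (- pi) pi (fun y => f (expC (ln r +i* y)%C)).
  by apply: cmean_rcont; rewrite er.
have pl (x y : C) : `|rnorm x - rnorm y| <= rnorm (x - y).
  by rewrite ler_norml lerB_rnorm andbT lerNl opprB rnormBC lerB_rnorm.
have [|c _ hc] := @EVT_max R _ (- pi) pi _ (rcont_within pl hr); first lra.
exists (rnorm (f (expC (ln r +i* c)%C))) => w wr.
have [|t ht wE] := @polar _ w; first by rewrite -rnorm_gt0 wr.
by rewrite wE wr; apply: hc; rewrite in_itv.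
Qed.

(* Dividing by [(w - z1) ^+ N], which is harmless since [f] vanishes near [z1], and letting
   [N] grow contracts the mean value bound to zero. *)
Lemma zero_near_centre f z z1 r e : 0 < r -> 0 < e -> rnorm (z1 - z) <= r / 4 ->
  (forall w, rnorm (w - z) <= r -> cdiff full f w) ->
  (forall w, rnorm (w - z1) < e -> f w = 0) -> f z = 0.
Proof.
move=> r0 e0 hz fd f0.
have [->|zz1] := eqVneq z z1; first by apply: f0; rewrite subrr rnorm0.
have trans (G : C -> C) u : cdiff full G (z + u) -> cdiff full (fun v => G (z + v)) u.
  move=> [d hd]; exists (d * (0 + 1)); apply: (@has_cderiv_comp _ full full) => //.
  exact: has_cderivD (has_cderiv_cst _ _ _) (has_cderiv_id _ _).
have [M hM] : exists M, forall u, rnorm u = r -> rnorm (f (z + u)) <= M.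
  apply: (@circle_bounded (fun u => f (z + u)) r r0) => u ur.
  by apply/cdiff_ccont/trans/fd; rewrite addrC addKr ur.
have M0 : 0 <= M.
  apply: le_trans (hM (r%:C%C) _); first exact: rnorm_ge0.
  by rewrite rnorm_real ger0_norm// ltW.
pose G N w := f w / (w - z1) ^+ N.
have Gd N w : rnorm (w - z) <= r -> cdiff full (G N) w.
  move=> wr; have [->|wz] := eqVneq w z1.
    exists 0; apply: (@has_cderiv_eq_near _ _ (fun=> 0) _ _ _ e) (has_cderiv_cst _ _ _) => //.
      by move=> u _ /f0; rewrite /G => ->; rewrite mul0r.
    by rewrite /G f0 ?mul0r// subrr rnorm0.
  apply: cdiffM; first exact: fd.
  have [d hd] := cdiffX N (cdiffB (cdiff_id w) (cdiff_cst z1 w)).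
  eexists; apply: (@has_cderiv_comp _ full full _ (fun u => u^-1)) hd _ => //.
  by apply: has_cderiv_inv; rewrite expf_neq0// subr_eq0.
(* On the circle the divisor [w - z1] has modulus at least [3 / 4 * r], at the centre at most
   [r / 4]; each power gains the factor [1 / 3]. *)
have key N : rnorm (f z) <= 2 * M * 3^-1 ^+ N.
  have hG u : rnorm u <= r -> cdiff full (fun v => G N (z + v)) u.
    by move=> ur; apply/trans/Gd; rewrite addrC addKr.
  have hGM u : rnorm u = r -> rnorm (G N (z + u)) <= M / (3 / 4 * r) ^+ N.
    move=> ur; rewrite /G rnormM rnormV rnormX.
    have le1 : 3 / 4 * r <= rnorm (z + u - z1).
      have := lerB_rnorm u (z1 - z); rewrite ur; have -> : u - (z1 - z) = z + u - z1 by ring.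
      lra.
    apply: ler_pM; rewrite ?rnorm_ge0 ?invr_ge0 ?exprn_ge0 ?rnorm_ge0 ?hM//.
    have p : 0 < 3 / 4 * r by rewrite mulr_gt0// divr_gt0.
    rewrite lef_pV2 ?posrE ?exprn_gt0//; last exact: lt_le_trans le1.
    by rewrite lerXn2r// nnegrE ?rnorm_ge0// ltW.
  have := tcoef_le r0 hG 0 hGM; rewrite (tcoef0 r0 hG) expr0 divr1 addr0.
  rewrite /G rnormM rnormV rnormX ler_pdivrMr ?exprn_gt0 ?rnorm_gt0 ?subr_eq0//.
  move=> hh; apply: le_trans hh _.
  have -> : 2 * (M / (3 / 4 * r) ^+ N) * rnorm (z - z1) ^+ N =
     2 * M * (rnorm (z - z1) / (3 / 4 * r)) ^+ N.
    by rewrite expr_div_n; ring.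
  apply: ler_wpM2l; first by rewrite mulr_ge0.
  have p : 0 < 3 / 4 * r by rewrite mulr_gt0// divr_gt0.
  have q0 : 0 <= rnorm (z - z1) / (3 / 4 * r) by rewrite divr_ge0 ?rnorm_ge0// ltW.
  have q1 : rnorm (z - z1) / (3 / 4 * r) <= 3^-1.
    by rewrite ler_pdivrMr// rnormBC; lra.
  by rewrite lerXn2r// nnegrE invr_ge0.
apply/eqP; rewrite -rnorm_eq0; apply/eqP/le_anti; rewrite rnorm_ge0 andbT.
apply/ler_addgt0Pr => e' e'0; rewrite add0r.
have : (fun k => 2 * M * 3^-1 ^+ k : R) @ \oo --> (2 * M * 0 : R).
  apply: cvgMr; apply: cvg_expr; rewrite ger0_norm// invf_lt1// ltr1n//.
rewrite mulr0 => /cvgrPdist_lt /(_ e' e'0) [k _ /(_ k (leqnn k))] /=.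
rewrite sub0r normrN => hk; apply: le_trans (key k) _; apply: ltW.
by apply: le_lt_trans hk; exact: ler_norm.
Qed.

(** The zero set is extended leftwards in steps of [r / 16]: a point at distance below [r / 16] from
    [t +i* y] is within [r / 8] of the next centre, a quarter of the radius [r / 2] used in
    [zero_near_centre]. *)
Lemma zero_along_segment f (s T y r : R) : 0 < r -> s <= T ->
  (forall t, s <= t <= T -> forall w, rnorm (w - (t +i* y)%C) <= r -> cdiff full f w) ->
  (forall w, rnorm (w - (T +i* y)%C) < r -> f w = 0) -> f (s +i* y)%C = 0.
Proof.
move=> r0 sT fd f0.
have r16 : 0 < r / 16 by rewrite divr_gt0.
have dist (a b : R) : rnorm ((a +i* y)%C - (b +i* y)%C) = `|a - b|.
  rewrite (_ : (a +i* y)%C - (b +i* y)%C = (a - b)%:C%C) ?rnorm_real//.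
  by apply: complex_eq; rewrite /= ?subrr.
have key k (t : R) : s <= t <= T -> T - t <= r / 16 * k%:R ->
    forall w, rnorm (w - (t +i* y)%C) < r / 16 -> f w = 0.
  elim: k t => [|k IH] t ht.
    rewrite mulr0 => tT; have -> : t = T by lra.
    by move=> w wr; apply: f0; apply: lt_trans wr _; rewrite gtr_pMr// invf_lt1// ltr1n.
  have -> : k.+1%:R = k%:R + 1 :> R by rewrite natr1.
  rewrite mulrDr mulr1 => tT w wr.
  pose t1 := Num.min T (t + r / 16).
  have t1T : t1 <= T by rewrite ge_min lexx.
  have t1r : t1 <= t + r / 16 by rewrite ge_min lexx orbT.
  have tt1 : t <= t1 by rewrite le_min; apply/andP; split; lra.
  have t1k : T - t1 <= r / 16 * k%:R.
    have k0 : 0 <= r / 16 * k%:R by rewrite mulr_ge0// ltW.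
    by rewrite /t1; case: (leP T (t + r / 16)) => ?; lra.
  have ht1 : s <= t1 <= T by rewrite t1T andbT; lra.
  apply: (@zero_near_centre f w (t1 +i* y)%C (r / 2) (r / 16)) => //; last first.
  - by apply: IH.
  - move=> u ur; apply: (fd t ht).
    have -> : u - (t +i* y)%C = (u - w) + (w - (t +i* y)%C) by ring.
    apply: le_trans (ler_rnormD _ _) _; lra.
  - have -> : (t1 +i* y)%C - w = ((t1 +i* y)%C - (t +i* y)%C) - (w - (t +i* y)%C) by ring.
    apply: le_trans (ler_rnormB _ _) _; rewrite dist ger0_norm; lra.
  - by rewrite divr_gt0.
have [k hk] : exists k : nat, T - s <= r / 16 * k%:R.
  exists (Num.truncn ((T - s) / (r / 16))).+1.
  by rewrite mulrC -ler_pdivrMr// ltW// truncnS_gt.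
by apply: (key k s _ hk); rewrite ?lexx// subrr rnorm0.
Qed.

(** The real segment from the half-plane of agreement to [s] may contain poles, so it is lifted to a
    height [y > 0] where there are none. Agreement at [s +i* y] follows, and [y] tends to [0]. *)
Lemma meromorphic_unique f g (a s : R) : meromorphic f -> meromorphic g ->
  (forall w, a < complex.Re w -> f w = g w) ->
  cdiff full f (s%:C%C) -> g (s%:C%C) = f (s%:C%C).
Proof.
move=> /meromorphicP mf /meromorphicP mg fg fs.
pose T := Num.max s (a + 2); pose h w := f w - g w.
have sT : s <= T by rewrite le_max lexx.
have aT : a + 2 <= T by rewrite le_max lexx orbT.
(* Poles are isolated and the segment is compact; hence a thin strip above it is free of poles. *)
have cov : near_covering [set` `[s - 1, T + 1]%R] by apply/compact_near_coveringP; exact: segment_compact.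
have [d d0 hd] : exists2 d : R, 0 < d & forall y, 0 < y < d -> forall t, s - 1 <= t <= T + 1 ->
    cdiff full h (t +i* y)%C.
  have := cov _ (0 : R)^'+ (fun y t => cdiff full h (t +i* y)%C) _.
  case.
    move=> x _.
    have [r1 r10 [h1 _]] := mf (x%:C%C); have [r2 r20 [h2 _]] := mg (x%:C%C).
    pose r := Num.min r1 r2 / 2.
    have r0 : 0 < r by rewrite divr_gt0// lt_min r10.
    have rr1 : 2 * r <= r1 by rewrite /r mulrC divfK// ge_min lexx.
    have rr2 : 2 * r <= r2 by rewrite /r mulrC divfK// ge_min lexx orbT.
    exists ([set t | `|x - t| < r], [set y | 0 < y < r]) => /=.
      split; first by apply/nbhs_ballP; exists r.
      apply/nbhs_ballP; exists r => // y; rewrite /ball /= sub0r normrN => yr y0; rewrite y0 /=.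
      by apply: le_lt_trans yr; exact: ler_norm.
    move=> [t y] /= [xt /andP[y0 yr]].
    have tx : 0 < rnorm ((t +i* y)%C - x%:C%C) < 2 * r.
      apply/andP; split.
        rewrite rnorm_gt0; apply/eqP => /(congr1 (@complex.Im R)) /=.
        by rewrite subr0 => y00; move: y0; rewrite y00 ltxx.
      apply: le_lt_trans (ler_rnorm_ReIm _) _; rewrite Re_add Im_add Re_opp Im_opp /= subr0.
      by rewrite (gtr0_norm y0) distrC; lra.
    by have [t1 t2] := andP tx; apply: cdiffB; [apply: h1|apply: h2]; rewrite t1 (lt_le_trans t2).
  move=> d /= d0 hd; exists d => // y /andP[y0 yd] t ht.
  apply: (hd y) => //=; first by rewrite sub0r normrN gtr0_norm.
have eqfg y : 0 < y < Num.min 1 (d / 2) -> f (s +i* y)%C = g (s +i* y)%C.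
  move=> /andP[y0]; rewrite lt_min => /andP[y1 yd].
  apply/eqP; rewrite -subr_eq0; apply/eqP; apply: (@zero_along_segment h s T y (y / 2)) => //.
  - by rewrite divr_gt0.
  - move=> t /andP[t1 t2] w wr.
    have hre := le_trans (ler_Re_rnorm _) wr; have him := le_trans (ler_Im_rnorm _) wr.
    move: hre him; rewrite Re_add Im_add Re_opp Im_opp /= !ler_norml => /andP[a1 a2] /andP[b1 b2].
    by case: w wr a1 a2 b1 b2 => w1 w2 /= wr *; apply: hd; apply/andP; split; lra.
  - move=> w wr; rewrite /h fg ?subrr//.
    have := le_lt_trans (ler_Re_rnorm _) wr.
    by rewrite Re_add Re_opp /= ltr_norml => /andP[a1 a2]; lra.
pose pt (y : R) : C := (s +i* y)%C.
have dpt y : pt y - s%:C%C = 'i%C * y%:C%C by apply: complex_eq; rewrite /= ; ring.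
have npt y : 0 < y -> rnorm (pt y - s%:C%C) = y.
  by move=> y0; rewrite dpt rnormM rnorm_i mul1r rnorm_real gtr0_norm.
have m0 : 0 < Num.min 1 (d / 2) by rewrite lt_min ltr01 divr_gt0.
have fc := cdiff_ccont fs.
(* A pole of [g] at [s] is excluded: along [s +i* y] it agrees with [f], which stays bounded. *)
have [r r0 [_ [gs|gM]]] := mg (s%:C%C); last first.
  have [r1 r10 hr1] := fc 1 ltr01.
  have [r2 r20 hr2] := gM (rnorm (f (s%:C%C)) + 1).
  pose y := Num.min (Num.min 1 (d / 2)) (Num.min r1 r2) / 2.
  have y0 : 0 < y by rewrite divr_gt0// !lt_min ltr01 divr_gt0// r10.
  have yy : y < Num.min (Num.min 1 (d / 2)) (Num.min r1 r2).
    by rewrite /y ltr_pdivrMr// ltr_pMr ?ltr1n// !lt_min ltr01 divr_gt0// r10.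
  move: yy; rewrite lt_min => /andP[y1]; rewrite lt_min => /andP[y2 y3].
  have := hr1 (pt y) I; rewrite npt// => /(_ y2) k1.
  have := hr2 (pt y); rewrite npt// y0 => /(_ y3).
  rewrite -eqfg ?y0// => k2.
  have := lerB_rnorm (f (pt y)) (f (s%:C%C)); rewrite -/(pt y) in k2.
  by move=> ?; exfalso; lra.
have gc := cdiff_ccont gs.
apply/eqP; rewrite -subr_eq0 -rnorm_eq0; apply/eqP/le_anti; rewrite rnorm_ge0 andbT.
apply/ler_addgt0Pr => e e0; rewrite add0r.
have e2 : 0 < e / 2 by rewrite divr_gt0.
have [r1 r10 hr1] := fc _ e2; have [r2 r20 hr2] := gc _ e2.
pose y := Num.min (Num.min 1 (d / 2)) (Num.min r1 r2) / 2.
have y0 : 0 < y by rewrite divr_gt0// !lt_min ltr01 divr_gt0// r10.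
have yy : y < Num.min (Num.min 1 (d / 2)) (Num.min r1 r2).
  by rewrite /y ltr_pdivrMr// ltr_pMr ?ltr1n// !lt_min ltr01 divr_gt0// r10.
move: yy; rewrite lt_min => /andP[y1]; rewrite lt_min => /andP[y2 y3].
have := hr1 (pt y) I; rewrite npt// => /(_ y2) k1.
have := hr2 (pt y) I; rewrite npt// => /(_ y3) k2.
have -> : g s%:C%C - f s%:C%C = (f (pt y) - f s%:C%C) - (g (pt y) - g s%:C%C).
  by rewrite /pt eqfg ?y0//; ring.
apply: le_trans (ler_rnormB _ _) _; lra.
Qed.

End Meromorphic.

(** * Taylor expansions and Bernoulli numbers *)

Section Jets.
Variable R : realType.
Local Notation C := R[i].
Implicit Types (f g : C -> C) (a b : nat -> C) (P Q : {poly C}) (t c : C) (K N k : nat).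
Local Notation full := (fun=> True).

(** Only points [t != 0] are constrained: a quotient such as [t / sinhC t] takes the default value
    [0] at [t = 0]. *)
Definition jet K f P := exists M r : R, 0 < r /\
  forall t, 0 < rnorm t < r -> rnorm (f t - P.[t]) <= M * rnorm t ^+ K.

Lemma jet_ext K f g P r : 0 < r -> (forall t, 0 < rnorm t < r -> f t = g t) ->
  jet K f P -> jet K g P.
Proof.
move=> r0 fg [M [r1 [r10 h]]]; exists M, (Num.min r r1); split; first by rewrite lt_min r0.
move=> t /andP[t0]; rewrite lt_min => /andP[tr tr1].
by rewrite -fg ?t0//; apply: h; rewrite t0.
Qed.

Lemma jet_poly K P : jet K (fun t => P.[t]) P.
Proof.
exists 0, 1; split=> // t _; by rewrite subrr rnorm0 mul0r.
Qed.

Lemma poly_bounded P : exists2 B : R, 0 <= B & forall t, rnorm t <= 1 -> rnorm P.[t] <= B.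
Proof.
exists (\sum_(i < size P) rnorm P`_i); first by apply: sumr_ge0 => i _; exact: rnorm_ge0.
move=> t t1; rewrite horner_coef; apply: le_trans (ler_rnorm_sum _ _ _) _.
apply: ler_sum => i _; rewrite rnormM rnormX ler_piMr ?rnorm_ge0//.
by rewrite exprn_ile1// rnorm_ge0.
Qed.

Lemma jet_bounded K f P : jet K f P -> exists B r : R,
  [/\ 0 <= B, 0 < r & forall t, 0 < rnorm t < r -> rnorm (f t) <= B].
Proof.
move=> [M [r [r0 h]]]; have [B B0 hB] := poly_bounded P.
have M0 : 0 <= `|M| by [].
exists (`|M| + B), (Num.min r 1); split; rewrite ?addr_ge0// ?lt_min ?r0 ?ltr01//.
move=> t /andP[t0]; rewrite lt_min => /andP[tr t1].
have -> : f t = (f t - P.[t]) + P.[t] by ring.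
apply: le_trans (ler_rnormD _ _) _; apply: lerD; last exact/hB/ltW.
apply: le_trans (h t _) _; first by rewrite t0.
have e1 : rnorm t ^+ K <= 1 by rewrite exprn_ile1 ?rnorm_ge0 ?ltW.
have e0 : 0 <= rnorm t ^+ K by rewrite exprn_ge0 ?rnorm_ge0.
have := ler_norm M; nra.
Qed.

Lemma jetM K f g P Q : jet K f P -> jet K g Q -> jet K (fun t => f t * g t) (P * Q).
Proof.
move=> /[dup] hf [M [r [r0 h]]] [M' [r' [r'0 h']]].
have [B [s [B0 s0 hB]]] := jet_bounded hf; have [B' B'0 hB'] := poly_bounded Q.
exists (B * `|M'| + `|M| * B'), (Num.min (Num.min r r') (Num.min s 1)).
split; first by rewrite !lt_min r0 r'0 s0 ltr01.
move=> t /andP[t0]; rewrite !lt_min => /andP[/andP[tr tr'] /andP[ts t1]].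
have -> : f t * g t - (P * Q).[t] = f t * (g t - Q.[t]) + (f t - P.[t]) * Q.[t].
  by rewrite hornerM; ring.
apply: le_trans (ler_rnormD _ _) _; rewrite !rnormM mulrDl.
have e0 : 0 <= rnorm t ^+ K by rewrite exprn_ge0 ?rnorm_ge0.
have k1 : rnorm (g t - Q.[t]) <= `|M'| * rnorm t ^+ K.
  by apply: le_trans (h' t _) _; rewrite ?t0// ler_wpM2r ?ler_norm.
have k2 : rnorm (f t - P.[t]) <= `|M| * rnorm t ^+ K.
  by apply: le_trans (h t _) _; rewrite ?t0// ler_wpM2r ?ler_norm.
apply: lerD.
  by rewrite -mulrA; apply: ler_pM; rewrite ?rnorm_ge0// hB// t0.
by rewrite mulrAC; apply: ler_pM; rewrite ?rnorm_ge0// hB'// ltW.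
Qed.

Lemma jet_prod K (I : Type) (s : seq I) (f : I -> C -> C) (P : I -> {poly C}) :
  (forall i, jet K (f i) (P i)) -> jet K (fun t => \prod_(i <- s) f i t) (\prod_(i <- s) P i).
Proof.
move=> h; elim: s => [|i s IH].
  rewrite big_nil; apply: (@jet_ext _ (fun t => (1 : {poly C}).[t]) _ _ 1) => //.
    by move=> t _; rewrite hornerC big_nil.
  exact: jet_poly.
rewrite big_cons; apply: (@jet_ext _ (fun t => f i t * \prod_(i <- s) f i t) _ _ 1) => //.
  by move=> t _; rewrite big_cons.
exact: jetM.
Qed.

Lemma jet_scale K f P c : c != 0 -> jet K f P -> jet K (fun t => f (c * t)) (P \Po (c *: 'X)).
Proof.
move=> c0 [M [r [r0 h]]]; exists (M * rnorm c ^+ K), (r / rnorm c).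
have nc : 0 < rnorm c by rewrite rnorm_gt0.
split; first by rewrite divr_gt0.
move=> t /andP[t0]; rewrite ltr_pdivlMr// => tr.
have := h (c * t); rewrite rnormM mulr_gt0// mulrC tr => /(_ isT).
have -> : M * rnorm c ^+ K * rnorm t ^+ K = M * (rnorm t * rnorm c) ^+ K.
  by rewrite exprMn; ring.
by rewrite horner_comp hornerZ hornerX.
Qed.

(** At the lowest index where the two polynomials could differ, the difference is divided by
    [t ^+ k] and [t] tends to [0] along the reals. *)
Lemma jet_uniq K f P Q : jet K f P -> jet K f Q -> forall k, (k < K)%N -> P`_k = Q`_k.
Proof.
move=> [M [r [r0 h]]] [M' [r' [r'0 h']]].
pose D := P - Q; pose A := `|M| + `|M'|.
have A0 : 0 <= A by rewrite addr_ge0.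
have hD t : 0 < rnorm t < Num.min r r' -> rnorm D.[t] <= A * rnorm t ^+ K.
  move=> /andP[t0]; rewrite lt_min => /andP[tr tr'].
  have -> : D.[t] = (f t - Q.[t]) - (f t - P.[t]) by rewrite hornerD hornerN; ring.
  apply: le_trans (ler_rnormB _ _) _; rewrite addrC mulrDl.
  have e0 : 0 <= rnorm t ^+ K by rewrite exprn_ge0 ?rnorm_ge0.
  apply: lerD; [apply: le_trans (h t _) _|apply: le_trans (h' t _) _]; rewrite ?t0//;
    by rewrite ler_wpM2r ?ler_norm.
have key k : (k < K)%N -> D`_k = 0.
  elim/ltn_ind: k => k IH kK.
  pose E := drop_poly k D.
  have DE : D = E * 'X^k.
    rewrite -[LHS](poly_take_drop k) (_ : take_poly k D = 0) ?add0r//.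
    apply/polyP => i; rewrite coef_take_poly coef0; case: ifP => // ik.
    by apply: IH => //; exact: ltn_trans kK.
  have E0 : D`_k = E.[0] by rewrite horner_coef0 coef_drop_poly add0n.
  pose E1 := drop_poly 1 E.
  have EE t : E.[t] = E.[0] + E1.[t] * t.
    rewrite -[in LHS](poly_take_drop 1 E) hornerD hornerM hornerXn expr1; congr (_ + _).
    rewrite horner_coef0 (_ : take_poly 1 E = (E`_0)%:P) ?hornerC//.
    by apply/polyP => i; rewrite coef_take_poly coefC; case: i.
  have [B B0 hB] := poly_bounded E1.
  rewrite E0; apply/eqP; rewrite -rnorm_eq0; apply/eqP/le_anti; rewrite rnorm_ge0 andbT.
  apply/ler_addgt0Pr => e e0; rewrite add0r.
  have AB : 0 < A + B + 1 by rewrite ltr_wpDl// addr_ge0.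
  pose x := Num.min (Num.min (Num.min r r') 1) (e / (A + B + 1)) / 2.
  have m0 : 0 < Num.min (Num.min (Num.min r r') 1) (e / (A + B + 1)).
    by rewrite !lt_min r0 r'0 ltr01 divr_gt0.
  have x0 : 0 < x by rewrite divr_gt0.
  have : x < Num.min (Num.min (Num.min r r') 1) (e / (A + B + 1)).
    by rewrite /x ltr_pdivrMr// ltr_pMr// ltr1n.
  rewrite lt_min => /andP[]; rewrite lt_min => /andP[x1 x2]; rewrite ltr_pdivlMr// => x3.
  have nx : rnorm (x%:C%C) = x by rewrite rnorm_real gtr0_norm.
  have xk : 0 < x ^+ k by rewrite exprn_gt0.
  have hE : rnorm E.[x%:C%C] <= A * x.
    have := hD (x%:C%C); rewrite nx x0 x1 => /(_ isT).
    rewrite DE hornerM hornerXn rnormM rnormX nx => hh.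
    rewrite -(ler_pM2r xk); apply: le_trans hh _.
    rewrite -mulrA ler_wpM2l// -exprS -(subnKC kK) exprD.
    by rewrite ler_piMr ?exprn_ge0 ?(ltW x0)// exprn_ile1 ?ltW.
  have -> : E.[0] = E.[x%:C%C] - E1.[x%:C%C] * x%:C%C by rewrite (EE (x%:C%C)); ring.
  apply: le_trans (ler_rnormB _ _) _; rewrite rnormM nx.
  have := hB (x%:C%C); rewrite nx => /(_ (ltW x2)) hb.
  have : rnorm E1.[x%:C%C] * x <= B * x by rewrite ler_wpM2r// ltW.
  lra.
by move=> k kK; apply/eqP; rewrite -subr_eq0 -coefB; apply/eqP/key.
Qed.

(* The same [M], [A] and [r] serve for all orders [N]: the expansion converges near [0]. *)
Definition gjet a f := exists M A r : R, [/\ 0 <= M, 0 <= A, 0 < r &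
  forall N t, 0 < rnorm t < r -> rnorm (f t - \sum_(k < N) a k * t ^+ k) <= M * (A * rnorm t) ^+ N].

Lemma gjet_jet a f K : gjet a f -> jet K f (\poly_(k < K) a k).
Proof.
move=> [M [A [r [M0 A0 r0 h]]]]; exists (M * A ^+ K), r; split=> // t ht.
by rewrite horner_poly -mulrA -exprMn; exact: h.
Qed.

Lemma gjet_uniq a b f : gjet a f -> gjet b f -> a =1 b.
Proof.
move=> ha hb k; have := jet_uniq (gjet_jet k.+1 ha) (gjet_jet k.+1 hb) (ltnSn k).
by rewrite !coef_poly ltnSn.
Qed.

Lemma gjet_ext a f g r : 0 < r -> (forall t, 0 < rnorm t < r -> f t = g t) -> gjet a f -> gjet a g.
Proof.
move=> r0 fg [M [A [r1 [M0 A0 r10 h]]]]; exists M, A, (Num.min r r1).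
split=> //; first by rewrite lt_min r0.
move=> N t /andP[t0]; rewrite lt_min => /andP[tr tr1].
by rewrite -fg ?t0//; apply: h; rewrite t0.
Qed.

(** The term [a k * t ^+ k] is the difference of the remainders of orders [k] and [k.+1], evaluated
    at a fixed small [t = x]. *)
Lemma gjet_coef a f : gjet a f -> exists M A : R, [/\ 0 <= M, 0 <= A & forall k, rnorm (a k) <= M * A ^+ k].
Proof.
move=> [M [A [r [M0 A0 r0 h]]]].
pose x := Num.min r (A + 1)^-1 / 2.
have A1 : 0 < A + 1 by rewrite ltr_wpDl.
have m0 : 0 < Num.min r (A + 1)^-1 by rewrite lt_min r0 invr_gt0.
have x0 : 0 < x by rewrite divr_gt0.
have : x < Num.min r (A + 1)^-1 by rewrite /x ltr_pdivrMr// ltr_pMr// ltr1n.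
rewrite lt_min => /andP[xr]; rewrite -[X in _ < X]mul1r ltr_pdivlMr// => xA.
have nx : rnorm (x%:C%C) = x by rewrite rnorm_real gtr0_norm.
clearbody x; have Ax : A * x <= 1.
  by apply: le_trans (ltW xA); rewrite mulrC ler_wpM2l ?lerDl// ltW.
have Ax0 : 0 <= A * x by rewrite mulr_ge0// ltW.
exists (2 * M), A; split; rewrite ?mulr_ge0// => k.
have h1 := h k (x%:C%C); have h2 := h k.+1 (x%:C%C).
rewrite nx x0 xr in h1 h2; have {}h1 := h1 isT; have {}h2 := h2 isT.
have xk : 0 < x ^+ k by rewrite exprn_gt0.
rewrite -(ler_pM2r xk) -{1}nx -rnormX -rnormM.
have -> : a k * x%:C%C ^+ k = (f x%:C%C - \sum_(i < k) a i * x%:C%C ^+ i) - (f x%:C%C - \sum_(i < k.+1) a i * x%:C%C ^+ i).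
  by rewrite big_ord_recr /=; ring.
apply: le_trans (ler_rnormB _ _) _.
apply: (@le_trans _ _ (M * (A * x) ^+ k + M * (A * x) ^+ k)); last first.
  by rewrite exprMn; lra.
by apply: lerD => //; apply: le_trans h2 _; rewrite ler_wpM2l// exprS ler_piMl ?exprn_ge0.
Qed.

Definition conv a b k : C := \sum_(i < k.+1) a i * b (k - i)%N.

Lemma conv_sum a b t N : \sum_(k < N) conv a b k * t ^+ k =
  \sum_(i < N) a i * t ^+ i * \sum_(j < N - i) b j * t ^+ j.
Proof.
elim: N => [|N IH]; first by rewrite !big_ord0.
rewrite [LHS]big_ord_recr [RHS]big_ord_recr /= IH subSn// subnn big_ord1 expr0 mulr1.
have -> : \sum_(i < N) a i * t ^+ i * \sum_(j < N.+1 - i) b j * t ^+ j =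
  \sum_(i < N) (a i * t ^+ i * \sum_(j < N - i) b j * t ^+ j + a i * b (N - i)%N * t ^+ N).
  apply: eq_bigr => i _; rewrite subSn 1?ltnW// big_ord_recr /= mulrDr; congr (_ + _).
  have -> : t ^+ N = t ^+ i * t ^+ (N - i) by rewrite -exprD subnKC// ltnW.
  by ring.
rewrite big_split /= -addrA; congr (_ + _).
rewrite /conv big_ord_recr /= subnn mulrDl mulr_suml; congr (_ + _).
by ring.
Qed.

Lemma natr_le_pow N : 1 + 2 * N%:R <= 3 ^+ N :> R.
Proof.
elim: N => [|N IH]; first by rewrite mulr0 addr0 expr0.
have -> : N.+1%:R = N%:R + 1 :> R by rewrite natr1.
rewrite exprS; have : 0 <= N%:R :> R by []; nra.
Qed.

(** The remainder of order [N] contains [N] cross terms of size [(L * rnorm t) ^+ N]; the factor [N]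
    is absorbed by tripling the rate, through [natr_le_pow]. *)
Lemma gjetM a b f g : gjet a f -> gjet b g -> gjet (conv a b) (fun t => f t * g t).
Proof.
move=> /[dup] /gjet_coef[M1 [A1 [M10 A10 h1]]] [M [A [r [M0 A0 r0 h]]]] [M' [A' [r' [M'0 A'0 r'0 h']]]].
pose L := Num.max (Num.max A A1) A'.
have LA : A <= L by rewrite !le_max lexx.
have LA1 : A1 <= L by rewrite !le_max lexx orbT.
have LA' : A' <= L by rewrite !le_max lexx !orbT.
have L0 : 0 <= L by apply: le_trans LA.
exists (M' * (M + M1)), (3 * L), (Num.min r r').
split; rewrite ?mulr_ge0 ?addr_ge0// ?lt_min ?r0// => N t /andP[t0]; rewrite lt_min => /andP[tr tr'].
rewrite conv_sum.
have -> : f t * g t - \sum_(i < N) a i * t ^+ i * \sum_(j < N - i) b j * t ^+ j =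
  (f t - \sum_(i < N) a i * t ^+ i) * g t +
  \sum_(i < N) a i * t ^+ i * (g t - \sum_(j < N - i) b j * t ^+ j).
  under [X in _ = _ + X]eq_bigr do rewrite mulrBr.
  by rewrite sumrB -mulr_suml; ring.
have T0 := rnorm_ge0 t.
have LT0 : 0 <= (L * rnorm t) ^+ N by rewrite exprn_ge0// mulr_ge0.
apply: (@le_trans _ _ (M * M' * (L * rnorm t) ^+ N + (M1 * M' * (L * rnorm t) ^+ N) * N%:R)).
  apply: le_trans (ler_rnormD _ _) _; apply: lerD.
    rewrite rnormM mulrAC; apply: ler_pM; rewrite ?rnorm_ge0//.
      apply: le_trans (h N t _) _; rewrite ?t0// ler_wpM2l// lerXn2r// ?nnegrE ?mulr_ge0//.
      by rewrite ler_wpM2r.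
    by have := h' 0%N t; rewrite t0 tr' big_ord0 subr0 expr0 mulr1; apply.
  apply: le_trans (ler_rnorm_sum _ _ _) _.
  rewrite mulr_natr -[X in _ *+ X](card_ord N) -sumr_const.
  apply: ler_sum => i _; rewrite !rnormM rnormX.
  have iN : (i + (N - i) = N)%N by rewrite subnKC// ltnW.
  have -> : M1 * M' * (L * rnorm t) ^+ N = (M1 * (L * rnorm t) ^+ i) * (M' * (L * rnorm t) ^+ (N - i)).
    by rewrite -{1}iN exprD; ring.
  apply: ler_pM; rewrite ?mulr_ge0 ?rnorm_ge0 ?exprn_ge0//.
    rewrite exprMn mulrA ler_wpM2r ?exprn_ge0//; apply: le_trans (h1 i) _.
    by rewrite ler_wpM2l// lerXn2r// nnegrE.
  apply: le_trans (h' _ t _) _; rewrite ?t0// ler_wpM2l// lerXn2r// ?nnegrE ?mulr_ge0//.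
  by rewrite ler_wpM2r.
have -> : M' * (M + M1) * (3 * L * rnorm t) ^+ N = M' * (M + M1) * (L * rnorm t) ^+ N * 3 ^+ N.
  by rewrite !exprMn; ring.
have c0 : 0 <= M1 * M' * (L * rnorm t) ^+ N by rewrite mulr_ge0// mulr_ge0.
have c1 : 0 <= M * M' * (L * rnorm t) ^+ N by rewrite mulr_ge0// mulr_ge0.
have n0 : 0 <= N%:R :> R by [].
have := natr_le_pow N.
nra.
Qed.

End Jets.

Section Bernoulli.
Variable R : realType.
Local Notation C := R[i].
Implicit Types (f g : C -> C) (a b : nat -> C) (P Q : {poly C}) (t c y z : C) (K N k : nat).
Local Notation full := (fun=> True).

(** The derivative of the remainder of order [N.+1] is the remainder of order [N]; the mean value
    inequality carries out the induction. *)
Lemma expC_taylor N z :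
  rnorm (expC z - \sum_(k < N) (k`!%:R)^-1 * z ^+ k) <= expR (rnorm z) * rnorm z ^+ N.
Proof.
elim: N z => [|N IH] z.
  rewrite big_ord0 subr0 expr0 mulr1 rnorm_expC ler_expR.
  by apply: le_trans (ler_norm _) (ler_Re_rnorm z).
pose F (w : C) := expC w - \sum_(k < N.+1) (k`!%:R)^-1 * w ^+ k.
have dsum (w : C) : has_cderiv full (fun w : C => \sum_(k < N.+1) (k`!%:R)^-1 * w ^+ k) w
    (\sum_(k < N) (k`!%:R)^-1 * w ^+ k).
  elim: N {IH F} => [|N IH].
    rewrite big_ord0; apply: (@has_cderiv_eq_near _ _ (fun=> 1 : C) _ _ _ 1) (has_cderiv_cst _ _ _) => //;
      by move=> *; rewrite big_ord_recr big_ord0 /= add0r expr0 mulr1 fact0 invr1.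
  rewrite [X in has_cderiv _ _ _ X]big_ord_recr /=.
  have pw k : has_cderiv full (fun w : C => w ^+ k.+1) w (k.+1%:R * w ^+ k).
    elim: k => [|k IHk].
      by rewrite expr0 mulr1; apply: (@has_cderiv_eq_near _ _ id _ _ _ 1) (has_cderiv_id _ _).
    have := has_cderivM (@has_cderiv_id _ full w) IHk.
    have -> : 1 * w ^+ k.+1 + w * (k.+1%:R * w ^+ k) = k.+2%:R * w ^+ k.+1.
      have -> : k.+2%:R = k.+1%:R + 1 :> C by rewrite natr1.
      by rewrite exprS; ring.
    by apply: (@has_cderiv_eq_near _ _ _ _ _ _ 1) => // [u _ _|]; rewrite -exprS.
  have := has_cderivD IH (has_cderivZ (N.+1`!%:R)^-1 (pw N)).
  have -> : (N.+1`!%:R)^-1 * (N.+1%:R * w ^+ N) = (N`!%:R)^-1 * w ^+ N :> C.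
    rewrite factS natrM invfM; field.
    by rewrite nat1r !pnatr_eq0 -lt0n fact_gt0.
  by apply: (@has_cderiv_eq_near _ _ _ _ _ _ 1) => // [u _ _|]; rewrite [RHS]big_ord_recr.
have := @segment_le _ F 0 z (expR (rnorm z) * rnorm z ^+ N).
have -> : F 0 = 0.
  by rewrite /F expC0 big_ord_recl /= fact0 invr1 expr0 mulr1 big1 ?addr0 ?subrr// => i _; rewrite expr0n mulr0.
rewrite !subr0 -mulrA -exprSr; apply => t /andP[t0 t1]; rewrite add0r.
eexists; first exact: has_cderivB (has_cderiv_expC _ _) (dsum _).
have tz : rnorm (t%:C%C * z) <= rnorm z.
  by rewrite rnormM rnorm_real ger0_norm// ler_piMl ?rnorm_ge0.
apply: le_trans (IH _) _; apply: ler_pM; rewrite ?expR_ge0 ?exprn_ge0 ?rnorm_ge0 ?ler_expR//.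
by rewrite lerXn2r ?nnegrE ?rnorm_ge0.
Qed.

Lemma gjet_expC c : gjet (fun k => c ^+ k / k`!%:R) (fun t => expC (c * t)).
Proof.
exists (expR (rnorm c)), (rnorm c), 1; split; rewrite ?expR_ge0 ?rnorm_ge0// => N t /andP[t0 t1].
have -> : \sum_(k < N) c ^+ k / k`!%:R * t ^+ k = \sum_(k < N) (k`!%:R)^-1 * (c * t) ^+ k.
  by apply: eq_bigr => k _; rewrite exprMn; ring.
apply: le_trans (expC_taylor _ _) _; rewrite rnormM ler_wpM2r ?exprn_ge0 ?mulr_ge0 ?rnorm_ge0//.
by rewrite ler_expR ler_piMr ?rnorm_ge0 ?ltW.
Qed.

(** The product of [f] with a partial sum of the inverse series differs from [1] by cross terms
    only, estimated as in [gjetM]. The growth of the inverse coefficients has to be supplied. *)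
Lemma gjet_inv a b f (B : R) : gjet a f -> a 0%N != 0 -> 0 <= B -> (forall k, rnorm (b k) <= B ^+ k) ->
  (forall k, conv b a k = (k == 0%N)%:R) -> gjet b (fun t => (f t)^-1).
Proof.
move=> [M [A [r [M0 A0 r0 h]]]] a0 B0 hb hc.
have na0 : 0 < rnorm (a 0%N) by rewrite rnorm_gt0.
pose L := Num.max B A.
have LB : B <= L by rewrite le_max lexx.
have LA : A <= L by rewrite le_max lexx orbT.
have L0 : 0 <= L by apply: le_trans LA.
have MA0 : 0 <= M * A by rewrite mulr_ge0.
have MA : 0 < 2 * (M * A) + 1 by rewrite ltr_wpDl// mulr_ge0.
(* For [rnorm t < s] the first-order remainder [M * (A * rnorm t)] is below half of [rnorm (a 0%N)],
   which keeps [f t] away from [0]. *)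
pose s := rnorm (a 0%N) / (2 * (M * A) + 1).
pose c := 2 / rnorm (a 0%N).
have c0 : 0 < c by rewrite divr_gt0.
exists (c * (1 + M)), (3 * L), (Num.min r s); split.
- by rewrite mulr_ge0 ?addr_ge0 ?(ltW c0).
- by rewrite mulr_ge0.
- by rewrite lt_min r0 divr_gt0.
move=> N t /andP[t0]; rewrite lt_min => /andP[tr ts].
have fl : rnorm (a 0%N) / 2 <= rnorm (f t).
  have := h 1%N t; rewrite t0 tr => /(_ isT); rewrite big_ord1 expr0 mulr1 expr1 => h1.
  move: ts; rewrite ltr_pdivlMr// => ts.
  have := lerB_rnorm (a 0%N) (a 0%N - f t); rewrite (rnormBC (a 0%N)).
  have -> : a 0%N - (a 0%N - f t) = f t by ring.
  have := rnorm_ge0 t; nra.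
have f0 : f t != 0 by rewrite -rnorm_gt0; apply: lt_le_trans fl; rewrite divr_gt0.
have T0 := rnorm_ge0 t.
have LT0 k : 0 <= (L * rnorm t) ^+ k by rewrite exprn_ge0// mulr_ge0.
have key : rnorm (1 - (\sum_(k < N) b k * t ^+ k) * f t) <= (1 + M) * (3 * L * rnorm t) ^+ N.
  case: N => [|N].
    by rewrite big_ord0 mul0r subr0 rnorm1 expr0 mulr1 lerDl.
  have : \sum_(k < N.+1) conv b a k * t ^+ k = 1.
    rewrite big_ord_recl hc expr0 mulr1 big1 ?addr0// => i _.
    by rewrite hc mul0r.
  rewrite conv_sum => e1.
  have -> : 1 - (\sum_(k < N.+1) b k * t ^+ k) * f t =
     - \sum_(i < N.+1) b i * t ^+ i * (f t - \sum_(j < N.+1 - i) a j * t ^+ j).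
    under [X in _ = - X]eq_bigr do rewrite mulrBr.
    by rewrite sumrB -mulr_suml e1 opprB.
  rewrite rnormN; apply: le_trans (ler_rnorm_sum _ _ _) _.
  apply: (@le_trans _ _ (M * (L * rnorm t) ^+ N.+1 * N.+1%:R)).
    rewrite mulr_natr -[X in _ *+ X](card_ord N.+1) -sumr_const.
    apply: ler_sum => i _; rewrite !rnormM rnormX.
    have iN : (i + (N.+1 - i) = N.+1)%N by rewrite subnKC// ltnW.
    have -> : M * (L * rnorm t) ^+ N.+1 = (L * rnorm t) ^+ i * (M * (L * rnorm t) ^+ (N.+1 - i)).
      by rewrite -{1}iN exprD; ring.
    apply: ler_pM; rewrite ?mulr_ge0 ?rnorm_ge0 ?exprn_ge0//.
      rewrite exprMn ler_wpM2r ?exprn_ge0//; apply: le_trans (hb i) _.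
      by rewrite lerXn2r// nnegrE.
    apply: le_trans (h _ t _) _; rewrite ?t0// ler_wpM2l// lerXn2r// ?nnegrE ?mulr_ge0//.
    by rewrite ler_wpM2r.
  have -> : (3 * L * rnorm t) ^+ N.+1 = (L * rnorm t) ^+ N.+1 * 3 ^+ N.+1 by rewrite !exprMn; ring.
  have := natr_le_pow R N.+1; have := LT0 N.+1; have n0 : 0 <= N.+1%:R :> R by [].
  have := mulr_ge0 M0 (LT0 N.+1).
  move: (_ ^+ N.+1) (3 ^+ N.+1) (N.+1%:R) n0 => X Y Z Z0 MX X0 ZY.
  have : M * X * Z <= M * X * Y by rewrite ler_wpM2l//; lra.
  have : 0 <= X * Y by rewrite mulr_ge0//; lra.
  lra.
have -> : (f t)^-1 - \sum_(k < N) b k * t ^+ k = (1 - (\sum_(k < N) b k * t ^+ k) * f t) / f t.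
  by field.
rewrite rnormM rnormV mulrC -mulrA; apply: ler_pM; rewrite ?invr_ge0 ?rnorm_ge0//.
by rewrite /c -[leRHS]invf_div lef_pV2 ?posrE ?divr_gt0 ?rnorm_gt0.
Qed.

(** Each coefficient of the inverse power series depends on all earlier ones; building the list of
    the first [N] makes the recursion structural. *)
Fixpoint inv_seq a N : seq C := if N is k.+1 then
  let s := inv_seq a k in rcons s (((k == 0%N)%:R - \sum_(i < k) s`_i * a (k - i)%N) / a 0%N) else [::].
Definition inv_coef a k := (inv_seq a k.+1)`_k.

Lemma size_inv_seq a N : size (inv_seq a N) = N.
Proof. by elim: N => //= N IH; rewrite size_rcons IH. Qed.

Lemma inv_seqE a N k : (k < N)%N -> (inv_seq a N)`_k = inv_coef a k.
Proof.
elim: N => // N IH; rewrite ltnS leq_eqVlt => /predU1P[->//|kN].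
by rewrite /= nth_rcons size_inv_seq kN IH.
Qed.

Lemma inv_coefE a k : inv_coef a k = ((k == 0%N)%:R - \sum_(i < k) inv_coef a i * a (k - i)%N) / a 0%N.
Proof.
rewrite /inv_coef /= nth_rcons size_inv_seq ltnn eqxx; congr ((_ - _) / _).
by apply: eq_bigr => i _; rewrite inv_seqE.
Qed.

Lemma conv_inv_coef a k : a 0%N != 0 -> conv (inv_coef a) a k = (k == 0%N)%:R.
Proof. by move=> a0; rewrite /conv big_ord_recr /= subnn inv_coefE divfK// addrC subrK. Qed.

(** The coefficients of [t / (expC t - 1)]: the Bernoulli numbers divided by factorials. *)
Definition bern_coef := inv_coef (fun k => (k.+1`!%:R)^-1).

Lemma fact_ge_pow k : (2 ^ k <= k.+1`!)%N.
Proof. by elim: k => // k IH; rewrite expnS factS leq_mul. Qed.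

(** Since [k.+1!] is at least [2 ^ k], the recursion is dominated by a geometric sum with total
    below [1]. *)
Lemma bern_coef_le k : rnorm (bern_coef k) <= 1.
Proof.
elim/ltn_ind: k => k IH; rewrite /bern_coef inv_coefE -/bern_coef (_ : (1`!)%:R = 1 :> C)// invr1 divr1.
case: k IH => [|k] IH; first by rewrite big_ord0 subr0 rnorm1.
rewrite sub0r rnormN; apply: le_trans (ler_rnorm_sum _ _ _) _.
apply: (@le_trans _ _ (\sum_(i < k.+1) 2^-1 ^+ (k.+1 - i))).
  apply: ler_sum => i _; rewrite rnormM -[leRHS]mul1r; apply: ler_pM; rewrite ?rnorm_ge0 ?IH//.
  rewrite rnormV rnorm_nat exprVn lef_pV2 ?posrE ?exprn_gt0 ?ltr0n ?fact_gt0//.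
  by rewrite -natrX ler_nat fact_ge_pow.
rewrite (reindex_inj rev_ord_inj) /=.
have -> : \sum_(j < k.+1) 2^-1 ^+ (k.+1 - (k.+1 - j.+1)) = \sum_(j < k.+1) 2^-1 ^+ j.+1 :> R.
  by apply: eq_bigr => j _; rewrite subKn.
have H m : \sum_(j < m) 2^-1 ^+ j.+1 = 1 - 2^-1 ^+ m :> R.
  elim: m => [|m IHm]; first by rewrite big_ord0 expr0 subrr.
  by rewrite big_ord_recr /= IHm exprS; field.
by rewrite H lerBlDr lerDl exprn_ge0.
Qed.

Lemma gjet_expm1 : gjet (fun k => (k.+1`!%:R)^-1) (fun t => (expC t - 1) / t).
Proof.
exists (expR 1), 1, 1; split; rewrite ?expR_ge0// => N t /andP[t0 t1].
have tn : t != 0 by rewrite -rnorm_gt0.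
have -> : (expC t - 1) / t - \sum_(k < N) (k.+1`!%:R)^-1 * t ^+ k =
   (expC t - \sum_(k < N.+1) (k`!%:R)^-1 * t ^+ k) / t.
  rewrite big_ord_recl /= fact0 invr1 expr0 mulr1.
  have -> : \sum_(i < N) (i.+1`!%:R)^-1 * t ^+ i.+1 = (\sum_(k < N) (k.+1`!%:R)^-1 * t ^+ k) * t.
    by rewrite mulr_suml; apply: eq_bigr => i _; rewrite exprSr mulrA.
  by field.
rewrite rnormM rnormV ler_pdivrMr// mul1r -mulrA -exprSr.
apply: le_trans (expC_taylor _ _) _; rewrite ler_wpM2r ?exprn_ge0 ?rnorm_ge0//.
by rewrite ler_expR ltW.
Qed.

Lemma gjet_bern : gjet bern_coef (fun t => t / (expC t - 1)).
Proof.
apply: (@gjet_ext _ _ (fun t => ((expC t - 1) / t)^-1) _ 1) => //.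
  by move=> t _; rewrite invfM invrK mulrC.
apply: gjet_inv gjet_expm1 _ ler01 _ _; first by rewrite invr_eq0 oner_eq0.
- by move=> k; rewrite expr1n bern_coef_le.
- by move=> k; apply: conv_inv_coef; rewrite invr_eq0 oner_eq0.
Qed.

Lemma gjet_cvg a f : gjet a f -> exists2 r : R, 0 < r & forall t, 0 < rnorm t < r ->
  forall e : R, 0 < e -> exists N0, forall N, (N0 <= N)%N -> rnorm (f t - \sum_(k < N) a k * t ^+ k) < e.
Proof.
move=> [M [A [r [M0 A0 r0 h]]]].
have A1 : 0 < A + 1 by rewrite ltr_wpDl.
exists (Num.min r (A + 1)^-1); first by rewrite lt_min r0 invr_gt0.
move=> t /andP[t0]; rewrite lt_min => /andP[tr]; rewrite -[X in _ < X]mul1r ltr_pdivlMr// => tA.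
move=> e e0; pose q := A * rnorm t.
have q0 : 0 <= q by rewrite mulr_ge0 ?rnorm_ge0.
have q1 : q < 1.
  by rewrite /q; lra.
have : (fun k => M * q ^+ k : R) @ \oo --> (M * 0 : R).
  by apply: cvgMr; apply: cvg_expr; rewrite ger0_norm.
rewrite mulr0 => /cvgrPdist_lt /(_ e e0) [N0 _ hN]; exists N0 => N NN.
have := hN N NN; rewrite /= sub0r normrN => hh.
apply: le_lt_trans (h N t _) _; first by rewrite t0.
by apply: le_lt_trans hh; exact: ler_norm.
Qed.

Lemma series_cvgP (u : nat -> C) (l : C) : (series (u : nat -> C^o) @ \oo --> (l : C^o)) <->
  forall e : R, 0 < e -> exists N0, forall N, (N0 <= N)%N -> rnorm (l - \sum_(k < N) u k) < e.
Proof.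
split=> [/cvgrPdist_lt h e e0|h].
  have := h (e%:C%C); rewrite ltcR => /(_ e0) [N0 _ hN]; exists N0 => N /hN /=.
  by rewrite /series /= big_mkord rnormE ltcR.
apply/cvgrPdist_lt => e e0.
have er : (complex.Re e)%:C%C = e by rewrite RRe_real// ger0_real// ltW.
have [|N0 hN] := h (complex.Re e); first by rewrite -ltcR er.
by exists N0 => // N /= NN; rewrite -er rnormE ltcR /series /= big_mkord; exact: hN.
Qed.

(** Without a witness the choice defining [bernoulli_poly] would return its default. The witness is
    the Cauchy product of the series of [t / (expC t - 1)] and [expC (y * t)]. *)
Lemma bernoulli_generating_exists : exists B : nat -> {poly C}, bernoulli_generating B.
Proof.
exists (fun j => j`!%:R *: \sum_(i < j.+1) (bern_coef i / (j - i)`!%:R) *: 'X^(j - i)) => y.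
have := gjetM gjet_bern (gjet_expC y).
move=> /gjet_cvg[r r0 hr]; apply/dnear_rnormP; exists r => // t; rewrite subr0 => tr.
apply/series_cvgP => e e0; have [N0 hN] := hr t tr e e0; exists N0 => N /hN.
have -> : t / (expC t - 1) * expC (y * t) = t * expC (t * y) / (expC t - 1) by rewrite (mulrC y); ring.
congr (rnorm (_ - _) < _); apply: eq_bigr => k _.
rewrite hornerZ horner_sum; set S := \sum_(i < _) _.
have -> : k`!%:R * S * (t ^+ k / k`!%:R) = S * t ^+ k.
  by field; rewrite pnatr_eq0 -lt0n fact_gt0.
by congr (_ * _); apply: eq_bigr => i _; rewrite hornerZ hornerXn; ring.
Qed.

End Bernoulli.

Section BernoulliHalf.
Variable R : realType.
Local Notation C := R[i].
Implicit Types (f g : C -> C) (a b : nat -> C) (P Q : {poly C}) (t c y z : C) (K N k : nat).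

(** Abel's argument: the terms are bounded at radius [r / 2], so for [rnorm t < r / 4] the tails are
    dominated by a geometric series of ratio at most [1 / 2]. It turns the pointwise convergence in
    [bernoulli_generating] into an expansion with unique coefficients. *)
Lemma cvg_gjet a f (r : R) : 0 < r -> (forall t, 0 < rnorm t < r ->
  forall e : R, 0 < e -> exists N0, forall N, (N0 <= N)%N -> rnorm (f t - \sum_(k < N) a k * t ^+ k) < e) ->
  gjet a f.
Proof.
move=> r0 h; pose x := r / 2.
have x0 : 0 < x by rewrite divr_gt0.
have xr : x < r by rewrite /x ltr_pdivrMr// ltr_pMr// ltr1n.
have nx : rnorm (x%:C%C) = x by rewrite rnorm_real gtr0_norm.
have [M M0 hM] : exists2 M : R, 0 <= M & forall k, rnorm (a k) * x ^+ k <= M.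
  have [|N0 hN] := h (x%:C%C) _ 1 ltr01; first by rewrite nx x0.
  have S0 N : 0 <= \sum_(k < N) rnorm (a k) * x ^+ k.
    by apply: sumr_ge0 => i _; rewrite mulr_ge0 ?rnorm_ge0// exprn_ge0// ltW.
  exists (2 + \sum_(k < N0) rnorm (a k) * x ^+ k); first by rewrite addr_ge0.
  move=> k; case: (leqP N0 k) => kN.
    have h1 := hN k kN; have h2 := hN k.+1 (leqW kN).
    have : rnorm (a k * x%:C%C ^+ k) <= 2.
      have -> : a k * x%:C%C ^+ k = (f x%:C%C - \sum_(i < k) a i * x%:C%C ^+ i) - (f x%:C%C - \sum_(i < k.+1) a i * x%:C%C ^+ i).
        by rewrite big_ord_recr /=; ring.
      apply: le_trans (ler_rnormB _ _) _; lra.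
    by rewrite rnormM rnormX nx => h3; have := S0 N0; lra.
  rewrite (bigD1 (Ordinal kN))//= addrCA lerDl addr_ge0//.
  by apply: sumr_ge0 => i _; rewrite mulr_ge0 ?rnorm_ge0// exprn_ge0// ltW.
exists (2 * M), x^-1, (x / 2); split; rewrite ?mulr_ge0 ?invr_ge0 ?divr_gt0 ?(ltW x0)// => N t /andP[t0 tx].
pose q := x^-1 * rnorm t.
have q0 : 0 <= q by rewrite mulr_ge0 ?rnorm_ge0// invr_ge0 ltW.
have q2 : 2 * q <= 1 by rewrite /q mulrCA ler_pdivrMl//; lra.
rewrite -/q.
have D d : rnorm (\sum_(k < N + d) a k * t ^+ k - \sum_(k < N) a k * t ^+ k) <= M * (2 * q ^+ N - 2 * q ^+ (N + d)).
  elim: d => [|d IH]; first by rewrite addn0 !subrr rnorm0 mulr0.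
  rewrite addnS big_ord_recr /= addrAC; apply: le_trans (ler_rnormD _ _) _.
  have : rnorm (a (N + d)%N * t ^+ (N + d)) <= M * q ^+ (N + d).
    rewrite rnormM rnormX /q exprMn mulrA exprVn; apply: ler_wpM2r; first by rewrite exprn_ge0 ?rnorm_ge0.
    by rewrite ler_pdivlMr ?exprn_gt0.
  have : M * (2 * q * q ^+ (N + d)) <= M * (1 * q ^+ (N + d)).
    by rewrite ler_wpM2l// ler_wpM2r// exprn_ge0.
  rewrite exprS; lra.
apply/ler_addgt0Pr => e e0.
have [|N0 hN] := h t _ e e0; first by rewrite t0 (lt_trans tx)// (lt_trans _ xr)// ltr_pdivrMr// ltr_pMr// ltr1n.
have h1 := hN (N + N0)%N (leq_addl _ _); have h2 := D N0.
have -> : f t - \sum_(k < N) a k * t ^+ k = (f t - \sum_(k < N + N0) a k * t ^+ k) +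
   (\sum_(k < N + N0) a k * t ^+ k - \sum_(k < N) a k * t ^+ k) by ring.
apply: le_trans (ler_rnormD _ _) _.
have : 0 <= M * (2 * q ^+ (N + N0)) by rewrite !mulr_ge0// exprn_ge0.
lra.
Qed.

Lemma gjet_scale a f c : gjet a f -> c != 0 -> gjet (fun k => a k * c ^+ k) (fun t => f (c * t)).
Proof.
move=> [M [A [r [M0 A0 r0 h]]]] c0; have nc : 0 < rnorm c by rewrite rnorm_gt0.
exists M, (A * rnorm c), (r / rnorm c); split; rewrite ?mulr_ge0 ?rnorm_ge0 ?divr_gt0//.
move=> N t /andP[t0]; rewrite ltr_pdivlMr// => tr.
have := h N (c * t); rewrite rnormM mulr_gt0// mulrC tr => /(_ isT).
have -> : A * rnorm c * rnorm t = A * (rnorm t * rnorm c) by ring.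
have -> : \sum_(k < N) a k * c ^+ k * t ^+ k = \sum_(k < N) a k * (c * t) ^+ k.
  by apply: eq_bigr => k _; rewrite exprMn mulrA.
by [].
Qed.

Definition bern_half k : C := (bernoulli_poly k).[2^-1] / k`!%:R.

Lemma sinhCN z : sinhC (- z) = - sinhC z.
Proof. by rewrite /sinhC opprK; ring. Qed.

(** At [y = 1 / 2] the generating function [t * expC (t / 2) / (expC t - 1)] becomes symmetric after
    division by [expC (t / 2)]. *)
Lemma gjet_bern_half : gjet bern_half (fun t => t / (2 * sinhC (t / 2))).
Proof.
have [B hB] := bernoulli_generating_exists R.
have := @xgetPex _ (fun=> 0) [set B | bernoulli_generating B] (ex_intro _ B hB).
rewrite -/(bernoulli_poly) => /(_ (2^-1)) /dnear_rnormP[r r0 hr].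
apply: (@cvg_gjet _ _ r r0) => t tr e e0.
have := hr t; rewrite subr0 => /(_ tr) /series_cvgP /(_ e e0) [N0 hN]; exists N0 => N /hN.
congr (rnorm (_ - _) < _).
  have E : expC t = expC (t / 2) * expC (t / 2) by rewrite -expCD -splitr.
  have -> : expC t - 1 = expC (t / 2) * (2 * sinhC (t / 2)).
    by rewrite /sinhC expCN E; field; exact: expC_neq0.
  by rewrite (mulrC t) -mulf_div divff ?mul1r// expC_neq0.
by apply: eq_bigr => k _; rewrite /bern_half; ring.
Qed.

(** The generating function [t / (2 * sinhC (t / 2))] is even, and its coefficients are unique. *)
Lemma bern_half_odd k : odd k -> bern_half k = 0.
Proof.
move=> ko; have h := gjet_bern_half.
have N1 : -1 != 0 :> C by rewrite oppr_eq0 oner_eq0.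
have h' := gjet_scale h N1.
have {}h' : gjet (fun k => bern_half k * (-1) ^+ k) (fun t => t / (2 * sinhC (t / 2))).
  apply: (@gjet_ext _ _ _ _ 1) h' => // t _.
  by rewrite mulN1r !mulNr sinhCN mulrN invrN mulrN opprK.
have := gjet_uniq h h' k; rewrite -signr_odd ko expr1 mulrN1 => /eqP.
by rewrite -subr_eq0 opprK -mulr2n mulrn_eq0 /= => /eqP.
Qed.

Definition sinh_coef c k := bern_half k * (2 * c) ^+ k.

Lemma gjet_sinh c : c != 0 -> gjet (sinh_coef c) (fun z => c * z / sinhC (c * z)).
Proof.
move=> c0; have c20 : 2 * c != 0 by rewrite mulf_neq0// pnatr_eq0.
apply: (@gjet_ext _ _ _ _ 1) (gjet_scale gjet_bern_half c20) => // t _.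
have -> : 2 * c * t / 2 = c * t by field.
by rewrite -(mulrA 2) -mulf_div divff ?mul1r ?pnatr_eq0.
Qed.

Lemma jet_sinh c p : c != 0 -> jet (2 * p).+1 (fun z => c * z / sinhC (c * z))
  (\sum_(k < p.+1) sinh_coef c (2 * k) *: 'X^(2 * k)).
Proof.
move=> c0; have := gjet_jet (2 * p).+1 (gjet_sinh c0).
suff -> : \poly_(k < (2 * p).+1) sinh_coef c k = \sum_(k < p.+1) sinh_coef c (2 * k) *: 'X^(2 * k) by [].
rewrite poly_def.
elim: p => [|p IH]; first by rewrite !big_ord1.
rewrite [RHS]big_ord_recr /= -IH (_ : (2 * p.+1).+1 = (2 * p).+3)%N; last by rewrite mulnS.
rewrite !big_ord_recr /=.
have -> : sinh_coef c (2 * p).+1 = 0 by rewrite /sinh_coef bern_half_odd ?mul0r//= oddM.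
by rewrite scale0r addr0 mulnS add2n.
Qed.

(** Origin of the sum over [m_1 + ... + m_n = p] in the theorem: an exponent [2 * p] splits into
    even exponents [2 * m i]. *)
Lemma coef_prod_even n p (a : 'I_n -> nat -> C) :
  (\prod_(i < n) \sum_(k < p.+1) a i k *: 'X^(2 * k))`_(2 * p) =
  \sum_(m : {ffun 'I_n -> 'I_p.+1} | (\sum_(i < n) m i)%N == p) \prod_(i < n) a i (m i).
Proof.
rewrite bigA_distr_bigA /= coef_sum [RHS]big_mkcond; apply: eq_bigr => m _ /=.
have -> : \prod_(i < n) (a i (m i) *: 'X^(2 * m i)) = (\prod_(i < n) a i (m i)) *: 'X^(2 * \sum_(i < n) m i) :> {poly C}.
  rewrite scaler_prod; congr (_ *: _).
  by rewrite big_distrr /= -expr_sum.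
rewrite coefZ coefXn eqn_mul2l /= eq_sym.
by case: eqP => _; rewrite ?mulr1 ?mulr0.
Qed.

End BernoulliHalf.

(** * Unconditional sums *)

Section UnconditionalSums.
Variables (R : realType) (I : choiceType).
Local Notation C := R[i].
Implicit Types (u v : I -> C) (A B : {fset I}) (s z : C).

Definition has_csum u s := forall e : R, 0 < e -> exists A, forall B, (A `<=` B)%fset ->
  rnorm (\sum_(i <- B) u i - s) < e.

Lemma has_csumP u s : has_csum u s <->
  (partial_sum (u : I -> C^o) @ totally --> (s : C^o)).
Proof.
have FF := @totally_filter I.
have E A : partial_sum (u : I -> C^o) A = \sum_(i <- A) u i by rewrite big_seq_fsetE.
split=> [h|/cvgrPdist_lt h e e0].
  apply/cvgrPdist_lt => e e0.
  have er : (complex.Re e)%:C%C = e by rewrite RRe_real// ger0_real// ltW.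
  have [|A hA] := h (complex.Re e); first by rewrite -ltcR er.
  by exists A => // B /= /hA; rewrite -ltcR er -rnormE E distrC.
have := h (e%:C%C); rewrite ltcR => /(_ e0) [A _ hA]; exists A => B AB.
by rewrite rnormBC -ltcR -rnormE -E; exact: hA.
Qed.

Lemma has_csum_csum u s : has_csum u s -> csummable u /\ csum u = s.
Proof.
have FF := @totally_filter I.
move=> /has_csumP h; split; first by apply/cvg_ex; exists s.
by apply: (@cvg_lim (C^o) (@norm_hausdorff _ _)).
Qed.

Lemma has_csumD u v s z : has_csum u s -> has_csum v z -> has_csum (fun i => u i + v i) (s + z).
Proof.
move=> hu hv e e0; have e2 : 0 < e / 2 by rewrite divr_gt0.
have [A hA] := hu _ e2; have [B hB] := hv _ e2.
exists (A `|` B)%fset => D; rewrite fsubUset => /andP[/hA h1 /hB h2].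
rewrite big_split /=.
have -> : \sum_(i <- D) u i + \sum_(i <- D) v i - (s + z) = (\sum_(i <- D) u i - s) + (\sum_(i <- D) v i - z) by ring.
by apply: le_lt_trans (ler_rnormD _ _) _; lra.
Qed.

Lemma has_csumZ u s z : has_csum u s -> has_csum (fun i => z * u i) (z * s).
Proof.
move=> hu e e0; have k0 : 0 < rnorm z + 1 by rewrite ltr_wpDl ?rnorm_ge0.
have [|A hA] := hu (e / (rnorm z + 1)); first by rewrite divr_gt0.
exists A => B /hA; rewrite -mulr_sumr -mulrBr rnormM ltr_pdivlMr// mulrC.
by apply: le_lt_trans; rewrite ler_wpM2r ?rnorm_ge0// lerDl.
Qed.

Lemma has_csumB u v s z : has_csum u s -> has_csum v z -> has_csum (fun i => u i - v i) (s - z).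
Proof.
move=> hu hv; have := has_csumD hu (has_csumZ (-1) hv); rewrite mulN1r.
by under [X in has_csum X]funext do rewrite mulN1r.
Qed.

Lemma eq_has_csum u v s : u =1 v -> has_csum u s -> has_csum v s.
Proof. by move=> uv; rewrite (funext uv). Qed.

Lemma ler_fsum (v : I -> R) A B : (forall i, 0 <= v i) -> (A `<=` B)%fset ->
  \sum_(i <- A) v i <= \sum_(i <- B) v i.
Proof.
move=> v0 AB; rewrite [leRHS](big_fsetID _ (mem A)) /=.
have -> : [fset x in B | x \in A]%fset = A.
  by apply/fsetP => x; rewrite !inE /=; case: (boolP (x \in A)) => [/(fsubsetP AB) ->|]; rewrite ?andbF.
by rewrite lerDl sumr_ge0.
Qed.

Lemma has_csum_real_ge0 (v : I -> R) (M : R) : (forall i, 0 <= v i) ->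
  (forall A, \sum_(i <- A) v i <= M) -> exists s : R, has_csum (fun i => (v i)%:C%C) (s%:C%C).
Proof.
move=> v0 hM; pose S := [set \sum_(i <- A) v i | A in [set: {fset I}]].
have hS : has_sup S.
  by split; [exists (\sum_(i <- fset0) v i); exists fset0|exists M => _ [A _ <-]].
exists (sup S) => e e0.
have [_ [A _ <-] hA] := sup_adherent e0 hS.
exists A => B AB; have h1 := ler_fsum v0 AB.
have h2 : \sum_(i <- B) v i <= sup S by apply: ub_le_sup; [case: hS|exists B].
rewrite -rmorph_sum -rmorphB rnorm_real ltr_norml; apply/andP; split; lra.
Qed.

(** Positive and negative parts are summed separately. *)
Lemma has_csum_real (v : I -> R) (M : R) : (forall A, \sum_(i <- A) `|v i| <= M) ->
  exists s : R, has_csum (fun i => (v i)%:C%C) (s%:C%C).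
Proof.
move=> hM.
have [|A|s hs] := @has_csum_real_ge0 (fun i => (`|v i| + v i) / 2) M.
- by move=> i; rewrite divr_ge0//; have := ler_norm (- v i); rewrite normrN; lra.
- apply: le_trans (hM A); apply: ler_sum => i _; have := ler_norm (v i); lra.
have [|A|z hz] := @has_csum_real_ge0 (fun i => (`|v i| - v i) / 2) M.
- by move=> i; rewrite divr_ge0//; have := ler_norm (v i); lra.
- apply: le_trans (hM A); apply: ler_sum => i _; have := ler_norm (- v i); rewrite normrN; lra.
exists (s - z); rewrite rmorphB; apply: eq_has_csum (has_csumB hs hz) => i.
by rewrite -rmorphB; congr (_%:C%C); field.
Qed.

Lemma has_csum_abs u (M : R) : (forall A, \sum_(i <- A) rnorm (u i) <= M) -> exists s, has_csum u s.
Proof.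
move=> hM.
have [A|s hs] := @has_csum_real (fun i => complex.Re (u i)) M.
  by apply: le_trans (hM A); apply: ler_sum => i _; exact: ler_Re_rnorm.
have [A|z hz] := @has_csum_real (fun i => complex.Im (u i)) M.
  by apply: le_trans (hM A); apply: ler_sum => i _; exact: ler_Im_rnorm.
exists (s%:C%C + 'i%C * z%:C%C); apply: eq_has_csum (has_csumD hs (has_csumZ 'i%C hz)) => i.
by rewrite -complexE.
Qed.

Lemma has_csum_seq u s (F : nat -> {fset I}) : has_csum u s ->
  (forall A, exists k0, forall k, (k0 <= k)%N -> (A `<=` F k)%fset) ->
  forall e : R, 0 < e -> exists k0, forall k, (k0 <= k)%N -> rnorm (\sum_(i <- F k) u i - s) < e.
Proof.
move=> hu hF e e0; have [A hA] := hu e e0; have [k0 hk0] := hF A.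
by exists k0 => k /hk0 /hA.
Qed.

Lemma has_csum_le u s (M : R) : has_csum u s -> (forall A, \sum_(i <- A) rnorm (u i) <= M) -> rnorm s <= M.
Proof.
move=> hu hM; apply/ler_addgt0Pr => e e0; have [A hA] := hu e e0.
have h1 := hA A (fsubset_refl _).
have -> : s = \sum_(i <- A) u i - (\sum_(i <- A) u i - s) by ring.
apply: le_trans (ler_rnormB _ _) _; apply: lerD; last exact: ltW.
exact: le_trans (ler_rnorm_sum _ _ _) (hM A).
Qed.

End UnconditionalSums.

(** * The residue sum *)

Section SinhAndSectors.
Variable R : realType.
Local Notation C := R[i].
Implicit Types (f F G : C -> C) (t z w c l : C) (x y r : R).
Local Notation full := (fun=> True).

Definition coshC z : C := (expC z + expC (- z)) / 2.

Lemma has_cderiv_sinhC z : has_cderiv full (@sinhC R) z (coshC z).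
Proof.
have h1 : has_cderiv full (fun w => -1 * w) z (-1 * 1) := has_cderivZ (-1) (@has_cderiv_id _ full z).
have h2 := has_cderiv_comp (fun _ _ => I) h1 (has_cderiv_expC full (-1 * z)).
have := has_cderivZ 2^-1 (has_cderivB (has_cderiv_expC full z) h2).
have -> : 2^-1 * (expC z - expC (-1 * z) * (-1 * 1)) = coshC z.
  by rewrite /coshC mulN1r; ring.
by apply: (@has_cderiv_eq_near _ _ _ _ _ _ 1) => // [w _ _|]; rewrite /sinhC mulN1r mulrC.
Qed.

Lemma sinhCE x y : sinhC (x +i* y)%C =
  Complex ((expR x - expR (- x)) / 2 * cos y) ((expR x + expR (- x)) / 2 * sin y).
Proof.
rewrite /sinhC; have -> : (2 : C) = (2 : R)%:C%C by rewrite rmorph_nat.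
rewrite (_ : - (x +i* y)%C = (- x +i* - y)%C)//.
rewrite !expCE cosN sinN -fmorphV.
by apply: complex_eq; rewrite /= ; ring.
Qed.

(** Effective away from the imaginary axis; near it [rnorm_sinhC_sin] takes over. Together they
    locate the zeros of [sinhC]. *)
Lemma rnorm_sinhC_ge z : (expR `|complex.Re z| - 1) / 2 <= rnorm (sinhC z).
Proof.
rewrite /sinhC rnormM rnormV rnorm_nat ler_wpM2r ?invr_ge0//.
have [a0|a0] := leP 0 (complex.Re z).
  have := lerB_rnorm (expC z) (expC (- z)); rewrite !rnorm_expC Re_opp ger0_norm//.
  apply: le_trans; rewrite lerD2l lerN2 -[leRHS](expR0 R) ler_expR; lra.
rewrite rnormBC; have := lerB_rnorm (expC (- z)) (expC z); rewrite !rnorm_expC Re_opp ltr0_norm//.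
apply: le_trans; rewrite lerD2l lerN2 -[leRHS](expR0 R) ler_expR; lra.
Qed.

Lemma rnorm_sinhC_sin z : `|sin (complex.Im z)| <= rnorm (sinhC z).
Proof.
apply: le_trans (ler_Im_rnorm _); case: z => a b; rewrite sinhCE /= normrM.
have e0 := expR_gt0 a; have e1 : expR a * expR (- a) = 1 by rewrite -expRD subrr expR0.
have c1 : 1 <= (expR a + expR (- a)) / 2.
  by rewrite ler_pdivlMr// mul1r; have := sqr_ge0 (expR a - 1); have := expR_gt0 (- a); nra.
rewrite [leRHS](_ : _ = (expR a + expR (- a)) / 2 * `|sin b|); last first.
  by congr (_ * _); rewrite ger0_norm//; apply: le_trans c1.
by rewrite ler_peMl.
Qed.

Lemma sinhC_eq0 z : sinhC z = 0 -> complex.Re z = 0 /\ sin (complex.Im z) = 0.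
Proof.
move=> h; have h1 := rnorm_sinhC_ge z; have h2 := rnorm_sinhC_sin z.
move: h1 h2; rewrite h rnorm0 => h1 h2; split; last by apply/eqP; rewrite -normr_eq0 eq_le h2 normr_ge0.
apply/eqP; rewrite -normr_eq0 eq_le normr_ge0 andbT -(ler_expR (R:=R)) expR0.
by move: h1; rewrite ler_pdivrMr// mul0r subr_le0.
Qed.

(** Riemann's theorem: [g h = h ^+ 2 * f (c + h)] is differentiable at [0] as well, so it has an
    expansion up to order two. Its first two coefficients vanish, and the third is the value to be
    assigned at [c]. *)
Lemma removable f c r : 0 < r -> (forall w, 0 < rnorm (w - c) < r -> cdiff full f w) ->
  (forall e : R, 0 < e -> exists2 d : R, 0 < d & forall w, 0 < rnorm (w - c) < d -> rnorm ((w - c) * f w) <= e) ->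
  exists l, ccont full (fun w => if w == c then l else f w) c.
Proof.
move=> r0 fd fz; pose g h := h ^+ 2 * f (c + h).
have r20 : 0 < r / 2 by rewrite divr_gt0.
have gd h : rnorm h <= r / 2 -> cdiff full g h.
  move=> hr; have [->|h0] := eqVneq h 0.
    exists 0 => e e0; have [d d0 hd] := fz e e0; exists d => // w _; rewrite subr0 => wd.
    rewrite /g expr0n !mul0r subr0 subr0.
    have [->|w0] := eqVneq w 0; first by rewrite expr0n mul0r rnorm0 mulr0.
    rewrite expr2 -mulrA rnormM mulrC ler_wpM2r ?rnorm_ge0//.
    by have := hd (c + w); rewrite addrC addKr rnorm_gt0 w0 wd addrC; apply.
  apply: cdiffM; first by apply: cdiffX; exact: cdiff_id.
  have [|d hd] := fd (c + h); first by rewrite addrC addKr rnorm_gt0 h0 /=; lra.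
  exists (d * (0 + 1)); apply: (@has_cderiv_comp _ full full) => //.
  exact: has_cderivD (has_cderiv_cst _ _ _) (has_cderiv_id _ _).
have [|M hM] := @circle_bounded _ g (r / 2) r20.
  by move=> w wr; apply/cdiff_ccont/gd; rewrite wr.
have T := taylor3 r20 gd hM; have g0 : g 0 = 0 by rewrite /g expr0n mul0r.
rewrite (tcoef0 r20 gd) g0 in T.
set a1 := tcoef g (r / 2) 1 in T; set a2 := tcoef g (r / 2) 2 in T.
pose K := 4 * `|M| / (r / 2) ^+ 3.
have K0 : 0 <= K by apply: divr_ge0; [apply: mulr_ge0|apply: exprn_ge0; exact: ltW].
have {}T h : rnorm h <= r / 2 / 2 -> rnorm (g h - a1 * h - a2 * h ^+ 2) <= K * rnorm h ^+ 3.
  move=> hr; have := T h hr; rewrite subr0 => /le_trans; apply.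
  have -> : K * rnorm h ^+ 3 = 4 * `|M| * (rnorm h / (r / 2)) ^+ 3 by rewrite expr_div_n /K; ring.
  rewrite ler_wpM2r ?exprn_ge0 ?divr_ge0 ?rnorm_ge0 ?(ltW r0)//.
  by rewrite ler_wpM2l// ler_norm.
(* At a small real [y], [a1 * y] equals [g y] up to [O(y ^ 2)], while [g y] is [y] times
   [y * f (c + y)], hence [o(y)]. *)
have a10 : a1 = 0.
  apply/eqP; rewrite -rnorm_eq0; apply/eqP/le_anti; rewrite rnorm_ge0 andbT.
  apply/ler_addgt0Pr => e e0; rewrite add0r.
  have e3 : 0 < e / 3 by rewrite divr_gt0.
  have [d d0 hd] := fz _ e3.
  pose B := rnorm a2 + K + 1.
  have B0 : 0 < B by rewrite ltr_wpDl// addr_ge0// rnorm_ge0.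
  pose m := Num.min (Num.min (r / 2 / 2) 1) (Num.min d (e / 3 / B)).
  have m0 : 0 < m by rewrite !lt_min d0 ltr01 !divr_gt0.
  pose y := m / 2.
  have y0 : 0 < y by rewrite divr_gt0.
  have : y < m by rewrite /y ltr_pdivrMr// ltr_pMr// ltr1n.
  rewrite !lt_min -andbA => /and4P[y1 y2 y3 y4]; clearbody y.
  have ny : rnorm (y%:C%C) = y by rewrite rnorm_real gtr0_norm.
  have := T (y%:C%C); rewrite ny => /(_ (ltW y1)) h1.
  have := hd (c + y%:C%C); rewrite addrC addKr ny y0 y3 => /(_ isT) h2.
  rewrite ltr_pdivlMr// in y4.
  have E : a1 * y%:C%C = g y%:C%C - (g y%:C%C - a1 * y%:C%C - a2 * y%:C%C ^+ 2) - a2 * y%:C%C ^+ 2 by ring.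
  have : rnorm a1 * y <= rnorm (g y%:C%C) + K * y ^+ 3 + rnorm a2 * y ^+ 2.
    rewrite -{1}ny -rnormM E; apply: le_trans (ler_rnormB _ _) _; rewrite rnormM rnormX ny.
    by rewrite lerD2r; apply: le_trans (ler_rnormB _ _) _; rewrite lerD2l.
  have : rnorm (g y%:C%C) <= y * (e / 3).
    by rewrite /g expr2 -mulrA rnormM ny ler_pM2l// [c + _]addrC.
  move=> k1 k2.
  have yy : y ^+ 3 <= y ^+ 2 by rewrite exprS ler_piMl ?exprn_ge0 ?ltW.
  have k3 : K * y ^+ 3 <= K * y ^+ 2 by rewrite ler_wpM2l.
  have k4 : (rnorm a2 + K) * y ^+ 2 <= B * y ^+ 2 by rewrite ler_wpM2r ?exprn_ge0 ?(ltW y0)// /B lerDl.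
  have k5 : B * y ^+ 2 <= e / 3 * y by rewrite expr2 mulrA ler_pM2r// mulrC ltW.
  rewrite -(ler_pM2r y0); have := mulr_gt0 e0 y0; lra.
exists a2 => e e0.
have e2 : 0 < e / (K + 1) by rewrite divr_gt0// ltr_wpDl.
exists (Num.min (r / 2 / 2) (e / (K + 1))); first by rewrite lt_min e2 !divr_gt0.
move=> w _; rewrite lt_min eqxx => /andP[w1]; rewrite ltr_pdivlMr ?ltr_wpDl// => w2.
have [wc|wc] := eqVneq w c; first by rewrite subrr rnorm0.
have wc0 : 0 < rnorm (w - c) by rewrite rnorm_gt0 subr_eq0.
have := T (w - c) (ltW w1); rewrite a10 mul0r subr0 /g (addrC c) subrK.
have -> : (w - c) ^+ 2 * f w - a2 * (w - c) ^+ 2 = (w - c) ^+ 2 * (f w - a2) by ring.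
rewrite rnormM rnormX => h.
have : rnorm (f w - a2) <= K * rnorm (w - c).
  by rewrite -(ler_pM2l (exprn_gt0 2 wc0)); apply: le_trans h _; rewrite le_eqVlt; apply/orP; left; apply/eqP; ring.
by move=> /le_lt_trans; apply; apply: le_lt_trans w2; rewrite mulrC ler_wpM2l ?rnorm_ge0// lerDl.
Qed.

Section Sector.
Variables (y0 y1 : R).
Hypotheses (y01 : y0 < y1) (y1y0 : y1 - y0 < pi *+ 2).

Definition smean F x := cint y0 y1 (fun y => F (expC (x +i* y)%C)).

Lemma smean_rcont F x : (forall y, y0 <= y <= y1 -> ccont full F (expC (x +i* y)%C)) ->
  rcont y0 y1 (fun y => F (expC (x +i* y)%C)).
Proof.
move=> h; apply: (@rcont_v _ (fun u => F (expC u)) x x).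
  move=> [a b] [/andP[z1 z2] hb]; apply: (@ccont_comp _ _ full) => //; first exact: ccont_expC.
  by rewrite (_ : a = x); [exact: h|apply/eqP; rewrite eq_le z1 z2].
by rewrite lexx.
Qed.

Lemma smean_near F x l (e : R) : (forall y, y0 <= y <= y1 -> ccont full F (expC (x +i* y)%C)) ->
  (forall y, y0 <= y <= y1 -> rnorm (F (expC (x +i* y)%C) - l) <= e) ->
  rnorm (smean F x - (y1 - y0)%:C%C * l) <= 2 * (e * (y1 - y0)).
Proof.
move=> hc hl; have y01' := ltW y01; rewrite -cint_cst// /smean -cintB; [|exact: smean_rcont|exact: rcont_cst].
apply: cint_le => //; apply: (@smean_rcont (fun w => F w - l)) => y /hc hF.
move=> e' e'0; have [d d0 hd] := hF _ e'0; exists d => // w _ /(hd w I).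
by have -> : F w - l - (F (expC (x +i* y)%C) - l) = F w - F (expC (x +i* y)%C) by ring.
Qed.

(** The sector is narrower than a full turn, so that [c] has at most one preimage under [expC] in
    the strip. *)
Lemma smean_shift F x0 x1 c : x0 < x1 ->
  (forall x y, x0 <= x <= x1 -> y0 <= y <= y1 -> ccont full F (expC (x +i* y)%C)) ->
  (forall x y, x0 <= x <= x1 -> y0 <= y <= y1 -> expC (x +i* y)%C != c -> cdiff full F (expC (x +i* y)%C)) ->
  (forall x, x0 <= x <= x1 -> F (expC (x +i* y0)%C) = F (expC (x +i* y1)%C)) ->
  smean F x1 = smean F x0.
Proof.
move=> x01 hc hd per.
have [E hE] : exists E : seq C, forall u, y0 <= complex.Im u <= y1 -> expC u = c -> u \in E.
  have [[v [hv vc]]|no] := pselect (exists v, y0 <= complex.Im v <= y1 /\ expC v = c); last first.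
    by exists [::] => u hu uc; exfalso; apply: no; exists u.
  exists [:: v] => u hu; rewrite -vc => /expC_inj_strip [hR /cos_eq1].
  case/andP: hu => u0 u1; case/andP: hv => v0 v1.
  have -> : - (pi *+ 2) <= complex.Im u - complex.Im v <= pi *+ 2.
    by move: y1y0 u0 u1 v0 v1; move: (pi *+ 2) => q *; apply/andP; split; lra.
  move=> /(_ isT) hI; rewrite inE; apply/eqP/complex_eq => //.
  by move: y1y0 u0 u1 v0 v1 hI; move: (pi *+ 2) => q ? ? ? ? ?; case; lra.
apply: (@strip_shift _ E (fun u => F (expC u))) => //.
- move=> [a b] [ha hb]; apply: (@ccont_comp _ _ full) => //; first exact: ccont_expC.
  exact: hc.
- move=> [a b] [ha hb]; have [ec|nc] := eqVneq (expC (a +i* b)%C) c; first by left; apply: hE.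
  right; have [d hFd] := hd _ _ ha hb nc; exists (d * expC (a +i* b)%C).
  by apply: (@has_cderiv_comp _ _ full) => //; exact: has_cderiv_expC.
Qed.

Lemma smeanB F G x : (forall y, y0 <= y <= y1 -> ccont full F (expC (x +i* y)%C)) ->
  (forall y, y0 <= y <= y1 -> ccont full G (expC (x +i* y)%C)) ->
  smean (fun w => F w - G w) x = smean F x - smean G x.
Proof. by move=> hF hG; rewrite /smean cintB//; exact: smean_rcont. Qed.

(** The mean does not depend on the radius, and for large radii it approaches the value for the
    constant [l]. The companion [smean_left] lets the radius tend to [0]. *)
Lemma smean_right F x0 l :
  (forall x y, x0 <= x -> y0 <= y <= y1 -> cdiff full F (expC (x +i* y)%C)) ->
  (forall x, x0 <= x -> F (expC (x +i* y0)%C) = F (expC (x +i* y1)%C)) ->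
  (forall e : R, 0 < e -> exists X : R, forall x y, X <= x -> y0 <= y <= y1 -> rnorm (F (expC (x +i* y)%C) - l) <= e) ->
  smean F x0 = (y1 - y0)%:C%C * l.
Proof.
move=> Fd Fper Fl; apply/eqP; rewrite -subr_eq0 -rnorm_eq0; apply/eqP/le_anti; rewrite rnorm_ge0 andbT.
apply/ler_addgt0Pr => e e0; rewrite add0r.
have d0 : 0 < y1 - y0 by rewrite subr_gt0.
have e1 : 0 < e / (2 * (y1 - y0)) by rewrite divr_gt0// mulr_gt0.
have [X hX] := Fl _ e1; pose x := Num.max X (x0 + 1).
have x0x : x0 < x by rewrite lt_max; apply/orP; right; lra.
have Xx : X <= x by rewrite le_max lexx.
rewrite -(@smean_shift F x0 x 0 x0x).
- have -> : e = 2 * (e / (2 * (y1 - y0)) * (y1 - y0)) by field; exact: lt0r_neq0.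
  apply: smean_near => y hy; last exact: hX.
  by apply/cdiff_ccont/Fd => //; exact: ltW.
- by move=> a b /andP[ha _] hb; apply/cdiff_ccont/Fd.
- by move=> a b /andP[ha _] hb _; apply/Fd.
- by move=> a /andP[ha _]; apply: Fper.
Qed.

Lemma smean_left F x0 l :
  (forall x y, x <= x0 -> y0 <= y <= y1 -> cdiff full F (expC (x +i* y)%C)) ->
  (forall x, x <= x0 -> F (expC (x +i* y0)%C) = F (expC (x +i* y1)%C)) ->
  (forall e : R, 0 < e -> exists X : R, forall x y, x <= X -> y0 <= y <= y1 -> rnorm (F (expC (x +i* y)%C) - l) <= e) ->
  smean F x0 = (y1 - y0)%:C%C * l.
Proof.
move=> Fd Fper Fl; apply/eqP; rewrite -subr_eq0 -rnorm_eq0; apply/eqP/le_anti; rewrite rnorm_ge0 andbT.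
apply/ler_addgt0Pr => e e0; rewrite add0r.
have d0 : 0 < y1 - y0 by rewrite subr_gt0.
have e1 : 0 < e / (2 * (y1 - y0)) by rewrite divr_gt0// mulr_gt0.
have [X hX] := Fl _ e1; pose x := Num.min X (x0 - 1).
have x0x : x < x0 by rewrite gt_min; apply/orP; right; lra.
have Xx : x <= X by rewrite ge_min lexx.
rewrite (@smean_shift F x x0 0 x0x).
- have -> : e = 2 * (e / (2 * (y1 - y0)) * (y1 - y0)) by field; exact: lt0r_neq0.
  apply: smean_near => y hy; last exact: hX.
  by apply/cdiff_ccont/Fd => //; exact: ltW.
- by move=> a b /andP[_ ha] hb; apply/cdiff_ccont/Fd.
- by move=> a b /andP[_ ha] hb _; apply/Fd.
- by move=> a /andP[_ ha]; apply: Fper.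
Qed.

End Sector.

(** The residue of [A / s] at a simple zero of [s], as a limit with an explicit neighbourhood where
    [s] has no other zero. *)
Lemma pole_lim (A s : C -> C) c (d : C) : ccont full A c -> has_cderiv full s c d -> s c = 0 -> d != 0 ->
  forall e : R, 0 < e -> exists2 r : R, 0 < r & forall w, 0 < rnorm (w - c) < r ->
    s w != 0 /\ rnorm ((w - c) * (A w / s w) - A c / d) <= e.
Proof.
move=> hA hs sc d0 e e0; have nd : 0 < rnorm d by rewrite rnorm_gt0.
pose B := rnorm d + rnorm (A c) + 1.
have B0 : 0 < B by rewrite ltr_wpDl// addr_ge0 ?rnorm_ge0.
pose e1 := Num.min (rnorm d / 2) (e * rnorm d ^+ 2 / (2 * B)).
have e10 : 0 < e1 by rewrite lt_min !divr_gt0// mulr_gt0// exprn_gt0.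
have e1d : e1 <= rnorm d / 2 by rewrite ge_min lexx.
have e1e : e1 * (2 * B) <= e * rnorm d ^+ 2.
  by rewrite -ler_pdivlMr ?mulr_gt0// ge_min lexx orbT.
have [r r0 hr] := hA _ e10; have [r' r'0 hr'] := hs _ e10.
exists (Num.min r r'); first by rewrite lt_min r0.
move=> w /andP[w0]; rewrite lt_min => /andP[wr wr'].
have h1 := hr w I wr; have := hr' w I wr'; rewrite sc subr0 => h2.
have N0 := rnorm_ge0 (w - c).
have h3 : rnorm d / 2 * rnorm (w - c) <= rnorm (s w).
  have := lerB_rnorm (d * (w - c)) (d * (w - c) - s w).
  have -> : d * (w - c) - (d * (w - c) - s w) = s w by ring.
  rewrite (rnormBC (d * _)) rnormM.
  have : e1 * rnorm (w - c) <= rnorm d / 2 * rnorm (w - c) by rewrite ler_wpM2r.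
  lra.
have sw : s w != 0.
  by rewrite -rnorm_gt0; apply: lt_le_trans h3; rewrite mulr_gt0// divr_gt0.
split=> //.
have -> : (w - c) * (A w / s w) - A c / d =
   (d * (w - c) * (A w - A c) - A c * (s w - d * (w - c))) / (s w * d) by field; rewrite sw d0.
rewrite rnormM rnormV ler_pdivrMr ?rnorm_gt0 ?mulf_neq0// rnormM.
apply: (@le_trans _ _ (e1 * (2 * B) / 2 * rnorm (w - c))).
  apply: le_trans (ler_rnormB _ _) _; rewrite !rnormM.
  have k1 : rnorm d * rnorm (w - c) * rnorm (A w - A c) <= rnorm d * rnorm (w - c) * e1.
    by rewrite ler_wpM2l ?mulr_ge0 ?rnorm_ge0// ltW.
  have k2 : rnorm (A c) * rnorm (s w - d * (w - c)) <= rnorm (A c) * (e1 * rnorm (w - c)).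
    by rewrite ler_wpM2l ?rnorm_ge0.
  have : 0 <= e1 * rnorm (w - c) by rewrite mulr_ge0// ltW.
  by rewrite /B; lra.
apply: (@le_trans _ _ (e * rnorm d ^+ 2 / 2 * rnorm (w - c))).
  by rewrite ler_wpM2r// ler_pM2r.
have -> : e * rnorm d ^+ 2 / 2 * rnorm (w - c) = e * (rnorm d / 2 * rnorm (w - c) * rnorm d) by field.
by rewrite ler_pM2l// ler_pM2r.
Qed.

Lemma near_nonzero F c : ccont full F c -> F c != 0 -> exists2 r : R, 0 < r & forall w, rnorm (w - c) < r -> F w != 0.
Proof.
move=> hF F0; have nF : 0 < rnorm (F c) by rewrite rnorm_gt0.
have [r r0 hr] := hF _ nF; exists r => // w wr; rewrite -rnorm_gt0.
have := lerB_rnorm (F c) (F c - F w); have -> : F c - (F c - F w) = F w by ring.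
by rewrite (rnormBC (F c)) => h; have := hr w I wr; lra.
Qed.

Lemma cdiff_prod (I : eqType) (s : seq I) (G : I -> C -> C) w : (forall i, i \in s -> cdiff full (G i) w) ->
  cdiff full (fun u => \prod_(i <- s) G i u) w.
Proof.
elim: s => [|i s IH] h.
  exists 0; apply: (@has_cderiv_eq_near _ _ (fun=> 1) _ _ _ 1) (has_cderiv_cst _ _ _) => // [u _ _|];
    by rewrite big_nil.
have hs j : j \in s -> cdiff full (G j) w by move=> js; apply: h; rewrite inE js orbT.
have [d hd] := cdiffM (h i (mem_head _ _)) (IH hs).
exists d; apply: (@has_cderiv_eq_near _ _ _ _ _ _ 1) hd => // [u _ _|]; by rewrite big_cons.
Qed.

Lemma cdiff_sum (I : eqType) (s : seq I) (G : I -> C -> C) w : (forall i, i \in s -> cdiff full (G i) w) ->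
  cdiff full (fun u => \sum_(i <- s) G i u) w.
Proof.
elim: s => [|i s IH] h.
  exists 0; apply: (@has_cderiv_eq_near _ _ (fun=> 0) _ _ _ 1) (has_cderiv_cst _ _ _) => // [u _ _|];
    by rewrite big_nil.
have hs j : j \in s -> cdiff full (G j) w by move=> js; apply: h; rewrite inE js orbT.
have [d hd] := cdiffD (h i (mem_head _ _)) (IH hs).
exists d; apply: (@has_cderiv_eq_near _ _ _ _ _ _ 1) hd => // [u _ _|]; by rewrite big_cons.
Qed.

Lemma cdiffV F w : cdiff full F w -> F w != 0 -> cdiff full (fun u => (F u)^-1) w.
Proof.
move=> [d hd] F0; eexists; apply: (@has_cderiv_comp _ full full _ (fun u => u^-1)) hd _ => //.
exact: has_cderiv_inv.
Qed.

Lemma cdiff_exprz (k : int) w : w != 0 -> cdiff full (fun u => u ^ k) w.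
Proof.
move=> w0; case: k => k; first exact: cdiffX (cdiff_id w).
by apply: cdiffV; [exact: cdiffX (cdiff_id w)|rewrite expf_neq0].
Qed.

Lemma cdiff_sinhM c w : cdiff full (fun u => sinhC (u * c)) w.
Proof.
have h := has_cderivM (@has_cderiv_id _ full w) (has_cderiv_cst full c w).
by eexists; apply: has_cderiv_comp h (has_cderiv_sinhC _).
Qed.

Lemma has_cderivXn k w : has_cderiv full (fun u => u ^+ k.+1) w (k.+1%:R * w ^+ k).
Proof.
elim: k => [|k IHk].
  by rewrite expr0 mulr1; apply: (@has_cderiv_eq_near _ _ id _ _ _ 1) (has_cderiv_id _ _).
have := has_cderivM (@has_cderiv_id _ full w) IHk.
have -> : 1 * w ^+ k.+1 + w * (k.+1%:R * w ^+ k) = k.+2%:R * w ^+ k.+1.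
  have -> : k.+2%:R = k.+1%:R + 1 :> C by rewrite natr1.
  by rewrite exprS; ring.
by apply: (@has_cderiv_eq_near _ _ _ _ _ _ 1) => // [u _ _|]; rewrite -exprS.
Qed.

End SinhAndSectors.

(** * The sector of angle pi / n and the 2n-th roots of unity *)

Section EtaRoot.
Variables (R : realType) (n : nat).
Hypothesis n1 : (1 < n)%N.
Local Notation C := R[i].
Local Notation e := (eta_root n : C).

Let n0 : (0 : R) < n%:R. Proof. by rewrite ltr0n ltnW. Qed.

Lemma eta_polar k : e ^+ k = expC (0 +i* (pi * k%:R / n%:R))%C.
Proof.
rewrite /eta_root -expCMn; congr expC; apply: complex_eq.
  rewrite !Re_mul /= -(rmorph_nat (real_complex R)) /=; ring.
rewrite !Im_mul !Re_mul /= -(rmorph_nat (real_complex R)) /=; field.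
exact: lt0r_neq0.
Qed.

Lemma eta_neq0 : e != 0. Proof. exact: expC_neq0. Qed.

Lemma eta_n : e ^+ n = -1.
Proof.
rewrite eta_polar mulfK ?lt0r_neq0// expCE expR0 cospi sinpi !mul1r.
by apply: complex_eq; rewrite //= oppr0.
Qed.

Lemma eta_2n : e ^+ (2 * n) = 1.
Proof. by rewrite mulnC exprM eta_n sqrrN expr1n. Qed.

Lemma rnorm_eta k : rnorm (e ^+ k) = 1.
Proof. by rewrite eta_polar rnorm_expC expR0. Qed.

(* A period of [t -> eta t], centred at the imaginary axis: in this sector only the factor
   [j = 0] of [\prod_j sinh (eta ^ j t)] vanishes, at the points [i pi k]. *)
Definition sec_lo : R := pi / 2 - pi / (2 * n%:R).
Definition sec_hi : R := pi / 2 + pi / (2 * n%:R).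
Local Notation y0 := sec_lo.
Local Notation y1 := sec_hi.
Local Notation full := (fun=> True).
Local Notation smean := (smean y0 y1).
Implicit Types (F : C -> C) (t c rho : C) (x y : R) (p : int).

Let half : R := pi / (2 * n%:R).

Lemma half_gt0 : 0 < half.
Proof. by rewrite divr_gt0 ?pi_gt0// mulr_gt0. Qed.

Lemma half_le : half <= pi / 4.
Proof.
rewrite /half ler_pM2l ?pi_gt0// lef_pV2 ?posrE ?mulr_gt0//.
by rewrite -natrM ler_nat (@leq_mul 2 2).
Qed.

Lemma sec_lt : y0 < y1.
Proof. by rewrite /sec_lo /sec_hi -/half; have := half_gt0; lra. Qed.

Lemma sec_width : y1 - y0 = pi / n%:R.
Proof. by rewrite /sec_lo /sec_hi; field; exact: lt0r_neq0. Qed.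

Lemma sec_small : y1 - y0 < pi *+ 2.
Proof.
have := half_le; have := pi_gt0 R; rewrite /sec_lo /sec_hi -/half mulr2n; lra.
Qed.

Lemma sec_per F : (forall t, F (e * t) = F t) -> forall x, F (expC (x +i* y0)%C) = F (expC (x +i* y1)%C).
Proof.
move=> hF x; rewrite -hF; congr F.
rewrite -[e]expr1 eta_polar -expCD mulr1; congr expC; apply: complex_eq => /=; first by rewrite add0r.
by rewrite -sec_width subrK.
Qed.

(* Subtracting [kappa] removes the pole of a function with residue [rho * c / (2 * n)] at [c]. *)
Definition kappa c rho t := rho * (t ^+ (2 * n) / (t ^+ (2 * n) - c ^+ (2 * n))).

Lemma kappa_per c rho t : kappa c rho (e * t) = kappa c rho t.
Proof. by rewrite /kappa exprMn eta_2n mul1r. Qed.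

Lemma kappa_cdiff c rho t : t ^+ (2 * n) != c ^+ (2 * n) -> cdiff full (kappa c rho) t.
Proof.
move=> h; apply: cdiffM; first exact: cdiff_cst.
have hX := cdiffX (2 * n) (cdiff_id t).
apply: cdiffM => //; apply: cdiffV; last by rewrite subr_eq0.
by apply: cdiffB => //; exact: cdiff_cst.
Qed.

Lemma expr2n_neq c t : rnorm t != rnorm c -> t ^+ (2 * n) != c ^+ (2 * n).
Proof.
apply: contraNN => /eqP h; apply/eqP.
have : rnorm t ^+ (2 * n) = rnorm c ^+ (2 * n) by rewrite -!rnormX h.
by apply: pexpIrn; rewrite ?nnegrE ?rnorm_ge0// muln_gt0 /= ltnW.
Qed.

(** [kappa] tends to [rho] at infinity and to [0] at the origin; by this lemma and [kappa_left] its
    mean jumps by [(y1 - y0) * rho] when the radius passes [rnorm c]. *)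
Lemma kappa_right c rho x0 : rnorm c < expR x0 -> smean (kappa c rho) x0 = (y1 - y0)%:C%C * rho.
Proof.
move=> cx; apply: smean_right; [exact: sec_lt|exact: sec_small|..].
- move=> x y xx _; apply/kappa_cdiff/expr2n_neq; rewrite rnorm_expC gt_eqF//.
  by apply: lt_le_trans cx _; rewrite ler_expR.
- by move=> x _; apply: sec_per => t; exact: kappa_per.
move=> d d0; pose K := rnorm c ^+ (2 * n).
have K0 : 0 <= K by rewrite exprn_ge0 ?rnorm_ge0.
have q0 : 0 <= rnorm rho * K / d by rewrite divr_ge0 ?(ltW d0)// mulr_ge0 ?rnorm_ge0.
exists (ln (K + rnorm rho * K / d + 1)) => x y hx _.
set t := expC _; have nt : rnorm t = expR x by rewrite rnorm_expC.
have T1 : K + rnorm rho * K / d + 1 <= expR x.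
  by rewrite -[leLHS]lnK ?ler_expR// posrE; lra.
have T2 : expR x <= expR x ^+ (2 * n).
  by rewrite ler_eXnr// ?muln_gt0 /= 1?ltnW//; lra.
have D : rnorm rho * K / d + 1 <= rnorm (t ^+ (2 * n) - c ^+ (2 * n)).
  by have := lerB_rnorm (t ^+ (2 * n)) (c ^+ (2 * n)); rewrite !rnormX nt -/K; lra.
have D0 : t ^+ (2 * n) - c ^+ (2 * n) != 0 by rewrite -rnorm_gt0; apply: lt_le_trans D; rewrite ltr_wpDl.
have -> : kappa c rho t - rho = rho * c ^+ (2 * n) / (t ^+ (2 * n) - c ^+ (2 * n)).
  by rewrite /kappa; field.
rewrite rnormM rnormV ler_pdivrMr ?rnorm_gt0// rnormM rnormX -/K.
rewrite -ler_pdivrMl//; apply: le_trans D; rewrite mulrC lerDl//.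
Qed.

Lemma kappa_left c rho x0 : expR x0 < rnorm c -> smean (kappa c rho) x0 = 0.
Proof.
move=> cx; rewrite -(mulr0 ((y1 - y0)%:C%C)); apply: smean_left; [exact: sec_lt|exact: sec_small|..].
- move=> x y xx _; apply/kappa_cdiff/expr2n_neq; rewrite rnorm_expC lt_eqF//.
  by apply: le_lt_trans cx; rewrite ler_expR.
- by move=> x _; apply: sec_per => t; exact: kappa_per.
move=> d d0; pose K := rnorm c ^+ (2 * n).
have c0 : 0 < rnorm c by apply: lt_trans cx; exact: expR_gt0.
have K0 : 0 < K by rewrite exprn_gt0.
have r1 : 0 < rnorm rho + 1 by rewrite ltr_wpDl ?rnorm_ge0.
pose m := Num.min 1 (Num.min (K / 2) (d * (K / 2) / (rnorm rho + 1))).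
have m0 : 0 < m by rewrite !lt_min ltr01 /= divr_gt0//= divr_gt0// mulr_gt0// divr_gt0.
exists (ln m) => x y hx _.
set t := expC _; have nt : rnorm t = expR x by rewrite rnorm_expC.
have T1 : expR x <= m by rewrite -[leRHS]lnK ?ler_expR.
have [m1 m2 m3] : [/\ m <= 1, m <= K / 2 & m * (rnorm rho + 1) <= d * (K / 2)].
  by rewrite -ler_pdivlMr// /m !ge_min !lexx !orbT.
have e0 := expR_gt0 x.
have T2 : expR x ^+ (2 * n) <= expR x.
  by rewrite ler_iXnr ?muln_gt0 /= 1?ltnW//; lra.
have D : K / 2 <= rnorm (t ^+ (2 * n) - c ^+ (2 * n)).
  by have := lerB_rnorm (c ^+ (2 * n)) (t ^+ (2 * n)); rewrite rnormBC !rnormX nt -/K; lra.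
rewrite subr0 /kappa !rnormM rnormV rnormX nt mulrA ler_pdivrMr; last by apply: lt_le_trans D; rewrite divr_gt0.
have rr := rnorm_ge0 rho.
apply: (@le_trans _ _ (rnorm rho * m)).
  by rewrite ler_wpM2l//; lra.
apply: (@le_trans _ _ (d * (K / 2))); last by rewrite ler_pM2l.
by lra.
Qed.

Lemma sin_ge_sym (a b : R) : 0 <= b -> b <= a -> a <= pi - b -> sin b <= sin a.
Proof.
move=> b0 ba ap; have p0 := pi_gt0 R.
have -> : a = (a + b) / 2 + (a - b) / 2 by field.
have -> : sin b = sin ((a + b) / 2 - (a - b) / 2) by congr sin; field.
rewrite sinB sinD -subr_ge0.
have -> : sin ((a + b) / 2) * cos ((a - b) / 2) + cos ((a + b) / 2) * sin ((a - b) / 2) -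
  (sin ((a + b) / 2) * cos ((a - b) / 2) - cos ((a + b) / 2) * sin ((a - b) / 2)) =
  2 * (cos ((a + b) / 2) * sin ((a - b) / 2)) by ring.
rewrite mulr_ge0// mulr_ge0//.
  by apply: cos_ge0_pihalf; apply/andP; split; lra.
by apply: sin_ge0_pi; apply/andP; split; lra.
Qed.

Lemma expC_eta x y j : expC (x +i* y)%C * e ^+ j = expC (x +i* (y + pi * j%:R / n%:R))%C.
Proof. by rewrite eta_polar -expCD; congr expC; apply: complex_eq; rewrite //= addr0. Qed.

(** For [0 < j < n] the rotated point [e ^+ j * t] has an argument at distance at least [half] from
    the imaginary axis, so its real part has modulus at least [rnorm t * sin half]. *)
Lemma sector_sinh_ge x y j : y0 <= y <= y1 -> (0 < j < n)%N ->
  (expR (expR x * sin half) - 1) / 2 <= rnorm (sinhC (expC (x +i* y)%C * e ^+ j)).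
Proof.
move=> /andP[ya yb] /andP[j0 jn]; apply: le_trans (rnorm_sinhC_ge _).
rewrite ler_pM2r ?invr_gt0// lerD2r ler_expR expC_eta Re_expC /= normrM ger0_norm ?expR_ge0//.
rewrite ler_pM2l ?expR_gt0//.
have h0 := half_gt0; have p0 := pi_gt0 R.
have -> : y + pi * j%:R / n%:R = (y + pi * j%:R / n%:R - pi / 2) + pi / 2 by ring.
rewrite cosDpihalf normrN; apply: le_trans (ler_norm _); apply: sin_ge_sym; first exact: ltW.
  have : pi * 1 / n%:R <= pi * j%:R / n%:R :> R by rewrite ler_pM2r ?invr_gt0// ler_pM2l// ler1n.
  have -> : pi * 1 / n%:R = half + half by rewrite /half; field; exact: lt0r_neq0.
  by move: ya; rewrite /sec_lo -/half; lra.
have : pi * j%:R / n%:R <= pi * (n%:R - 1) / n%:R :> R.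
  by rewrite ler_pM2r ?invr_gt0// ler_pM2l// lerBrDr natr1 ler_nat.
have -> : pi * (n%:R - 1) / n%:R = pi - (half + half) by rewrite /half; field; exact: lt0r_neq0.
by move: yb; rewrite /sec_hi -/half; lra.
Qed.

Lemma sin_half_gt0 : 0 < sin half.
Proof. by have := half_gt0; have := half_le; have := pi_gt0 R => *; apply: sin_gt0_pi; apply/andP; split; lra. Qed.

Lemma sector_sinh_neq0 x y j : y0 <= y <= y1 -> (0 < j < n)%N ->
  sinhC (expC (x +i* y)%C * e ^+ j) != 0.
Proof.
move=> hy hj; rewrite -rnorm_gt0; apply: lt_le_trans (sector_sinh_ge x hy hj).
by rewrite divr_gt0// subr_gt0 -[ltLHS](expR0 R) ltr_expR mulr_gt0 ?expR_gt0 ?sin_half_gt0.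
Qed.

Lemma sin_npi k : sin (pi * k%:R : R) = 0.
Proof.
elim: k => [|k IH]; first by rewrite mulr0 sin0.
by rewrite -natr1 mulrDr mulr1 sinDpi IH oppr0.
Qed.

(** A zero of [sinhC] lies on the imaginary axis, which meets the sector only at the argument
    [pi / 2]; on an interval of half-width [pi / 2] the sine vanishes only at its centre
    [pi * k]. *)
Lemma sector_sinh0 x y k : y0 <= y <= y1 -> `|expR x - pi * k%:R| <= pi / 2 ->
  sinhC (expC (x +i* y)%C) = 0 -> expC (x +i* y)%C = 'i%C * (pi * k%:R)%:C%C.
Proof.
move=> /andP[ya yb] xk /sinhC_eq0[]; rewrite Re_expC Im_expC /= => /eqP.
have h0 := half_gt0; have p0 := pi_gt0 R; have h1 := half_le.
rewrite mulf_eq0 (gt_eqF (expR_gt0 x)) /= => /eqP cy.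
have yE : y = pi / 2.
  apply: cos_inj; rewrite ?in_itv/= ?cos_pihalf//; apply/andP; split;
    move: ya yb; rewrite /sec_lo /sec_hi -/half; lra.
rewrite yE sin_pihalf mulr1 => sx.
have s0 : sin (expR x - pi * k%:R) = 0 by rewrite sinB sx sin_npi mul0r mulr0 subrr.
have xE : expR x - pi * k%:R = 0.
  move: xk; rewrite ler_norml => /andP[xa xb]; apply: sin_inj; rewrite ?in_itv/= ?s0 ?sin0//;
    by apply/andP; split; lra.
have -> : pi * k%:R = expR x by apply/eqP; rewrite eq_sym -subr_eq0 xE.
by rewrite expCE cos_pihalf sin_pihalf; apply: complex_eq; rewrite /= ; ring.
Qed.
End EtaRoot.

(** * Expansion of the product of the functions t / sinh t at the origin *)

Section NearZero.
Variables (R : realType) (n : nat).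
Hypothesis n1 : (1 < n)%N.
Local Notation C := R[i].
Local Notation e := (eta_root n : C).
Local Notation full := (fun=> True).
Implicit Types (t c w : C) (P K : nat) (Q : {poly C}).

Lemma jet_trunc K (f : C -> C) Q : jet K f Q -> jet K f (\poly_(k < K) Q`_k).
Proof.
move=> [M [r [r0 h]]]; have [B B0 hB] := poly_bounded (drop_poly K Q).
exists (M + B), (Num.min r 1); split; first by rewrite lt_min r0 ltr01.
move=> t /andP[t0]; rewrite lt_min => /andP[tr t1].
have -> : f t - (\poly_(k < K) Q`_k).[t] = (f t - Q.[t]) + (drop_poly K Q).[t] * t ^+ K.
  rewrite -{2}(poly_take_drop K Q) hornerD hornerM hornerXn /take_poly; ring.
apply: le_trans (ler_rnormD _ _) _; rewrite mulrDl; apply: lerD; first by apply: h; rewrite t0.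
by rewrite rnormM rnormX ler_wpM2r ?exprn_ge0 ?rnorm_ge0//; apply/hB/ltW.
Qed.

Definition sinh_prod t : C := \prod_(i < n) (e ^+ i * t / sinhC (e ^+ i * t)).
Definition sinh_poly P : {poly C} := \prod_(i < n) \sum_(k < P.+1) sinh_coef (e ^+ i) (2 * k) *: 'X^(2 * k).

Lemma jet_sinh_prod P : jet (2 * P).+1 sinh_prod (sinh_poly P).
Proof. by apply: jet_prod => i; apply: jet_sinh; rewrite expf_neq0 ?eta_neq0. Qed.

(** The rotation shifts the factors by one; the last one is taken at [e ^+ n * t = - t] and equals
    the first, because [t / sinhC t] is even. *)
Lemma sinh_prod_rot t : sinh_prod (e * t) = sinh_prod t.
Proof.
pose g j : C := e ^+ j * t / sinhC (e ^+ j * t).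
have -> : sinh_prod (e * t) = \prod_(0 <= j < n) g j.+1.
  by rewrite big_mkord; apply: eq_bigr => j _; rewrite /g exprSr mulrA.
have -> : sinh_prod t = \prod_(0 <= j < n) g j by rewrite big_mkord.
rewrite -(big_add1 _ _ 0 n.+1 xpredT g) -(prednK (ltnW n1 : 0 < n)%N) big_nat_recr//= [in RHS]big_ltn// mulrC.
congr (_ * _); rewrite /g prednK ?(ltnW n1)// eta_n// expr0 mulN1r mul1r sinhCN invrN mulrNN.
by [].
Qed.

(** The rotated function has the coefficients [a k * e ^+ k] and is the same function, so uniqueness
    of jets identifies the two. *)
Lemma sinh_poly_rot P k : (k < (2 * P).+1)%N -> (sinh_poly P)`_k * e ^+ k = (sinh_poly P)`_k.
Proof.
have J := jet_trunc (jet_sinh_prod P); have := J; set K := (2 * P).+1.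
set a := fun k => (sinh_poly P)`_k => -[M [r [r0 h]]] kK.
have J' : jet K sinh_prod (\poly_(k < K) (a k * e ^+ k)).
  exists M, r; split=> // t tr; rewrite -sinh_prod_rot.
  have ne : rnorm e = 1 by rewrite -[e]expr1 rnorm_eta.
  have := h (e * t); rewrite rnormM ne mul1r => /(_ tr).
  rewrite !horner_poly; congr (rnorm (_ - _) <= _); apply: eq_bigr => i _.
  by rewrite exprMn mulrA.
by have := jet_uniq J' J kK; rewrite !coef_poly kK.
Qed.

Lemma sinh_poly0 P : e ^+ (2 * P) != 1 -> (sinh_poly P)`_(2 * P) = 0.
Proof.
move=> h; have /eqP := sinh_poly_rot (ltnSn (2 * P)).
by rewrite -subr_eq0 -{2}[_`__]mulr1 -mulrBr mulf_eq0 subr_eq0 (negPf h) orbF => /eqP.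
Qed.

End NearZero.

(** The power bound is [1 + x / k <= expR (x / k)] raised to the power [k = K.+1]; the condition
    [2 / c <= r] makes [expR (r * c)] at least [3]. *)
Lemma exp_beats (R : realType) K (c : R) : 0 < c -> exists2 B : R, 0 < B &
  forall r, 2 / c <= r -> 1 <= (expR (r * c) - 1) / 2 /\ r ^+ K.+1 <= B * ((expR (r * c) - 1) / 2).
Proof.
move=> c0; pose k : R := K.+1%:R; have k0 : 0 < k by rewrite ltr0n.
exists (4 * (k / c) ^+ K.+1); first by rewrite mulr_gt0// exprn_gt0// divr_gt0.
move=> r; rewrite ler_pdivrMr// => r2.
have r0 : 0 <= r by rewrite -(pmulr_lge0 _ c0); apply: le_trans r2.
have h1 := expR_ge1Dx (r * c).
have h2 : (r * c / k) ^+ K.+1 <= expR (r * c).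
  have -> : expR (r * c) = expR (r * c / k) ^+ K.+1.
    by rewrite -expRM_natl -/k; congr expR; field; exact: lt0r_neq0.
  apply: lerXn2r; rewrite ?nnegrE ?expR_ge0 ?divr_ge0 ?mulr_ge0 ?(ltW c0) ?(ltW k0)//.
  by apply: le_trans (expR_ge1Dx _); rewrite lerDr.
split; first by lra.
have -> : r ^+ K.+1 = (k / c) ^+ K.+1 * (r * c / k) ^+ K.+1.
  by rewrite -exprMn; congr (_ ^+ _); field; rewrite !lt0r_neq0.
have q0 : 0 <= (k / c) ^+ K.+1 by rewrite exprn_ge0// divr_ge0 ?(ltW k0) ?(ltW c0).
have -> : 4 * (k / c) ^+ K.+1 * ((expR (r * c) - 1) / 2) = (k / c) ^+ K.+1 * (4 * ((expR (r * c) - 1) / 2)) by ring.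
apply: ler_wpM2l => //; by apply: le_trans h2 _; lra.
Qed.

(** * Residues in the sector and the mean over large arcs *)

Section ResidueSum.
Variables (R : realType) (n : nat).
Hypothesis n1 : (1 < n)%N.
Local Notation C := R[i].
Local Notation e := (eta_root n : C).
Local Notation full := (fun=> True).
Local Notation y0 := (sec_lo R n).
Local Notation y1 := (sec_hi R n).
Local Notation smean := (smean y0 y1).
Variable p : int.
Hypothesis e2p : e ^ (2 * p) = 1.
Implicit Types (t c w : C) (x y : R) (k N : nat).

Let n0 : (0 : R) < n%:R. Proof. by rewrite ltr0n ltnW. Qed.
Let n_gt0 : (0 < n)%N. Proof. exact: ltnW. Qed.
Let p0 : 0 < pi :> R. Proof. exact: pi_gt0. Qed.

Definition sprod t : C := \prod_(1 <= j < n) sinhC (t * e ^+ j).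
(** Collects everything in [Phi] that has neither zero nor pole at a point [expC (x +i* y)] of the
    sector, so that the poles of [Phi] there come from [sinhC t] alone. *)
Definition Anum t : C := t ^ (n%:Z - 2 * p) / sprod t.
Definition Phi t : C := Anum t / sinhC t.

(** Two signs cancel: the power of [t] contributes [e ^+ n = -1], since [e ^ (2 * p) = 1], and in
    the product of the [sinhC] the last factor wraps around to [sinhC (- t)]. *)
Lemma Phi_per t : Phi (e * t) = Phi t.
Proof.
have [->|t0] := eqVneq t 0; first by rewrite mulr0.
rewrite /Phi /Anum -[LHS]mulrA -[RHS]mulrA -!invfM.
have E u : sprod u * sinhC u = \prod_(0 <= j < n) sinhC (u * e ^+ j).
  by rewrite [RHS]big_ltn// expr0 mulr1 mulrC.
rewrite !E.
have -> : \prod_(0 <= j < n) sinhC (e * t * e ^+ j) = - \prod_(0 <= j < n) sinhC (t * e ^+ j).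
  have -> : \prod_(0 <= j < n) sinhC (e * t * e ^+ j) = \prod_(0 <= j < n) sinhC (t * e ^+ j.+1).
    by apply: eq_bigr => j _; congr sinhC; rewrite exprS; ring.
  rewrite -(big_add1 _ _ 0 n.+1 xpredT (fun j => sinhC (t * e ^+ j))) big_nat_recr//=.
  by rewrite [in RHS]big_ltn// (eta_n _ n1) mulrN1 sinhCN expr0 mulr1; ring.
rewrite invrN mulrN -mulNr; congr (_ * _).
rewrite exprzMl ?unitfE ?eta_neq0// expfzDr ?eta_neq0// -exprnP (eta_n _ n1).
by rewrite -invr_expz e2p invr1 mulr1 mulN1r opprK.
Qed.

Lemma sprod_cdiff t : cdiff full sprod t.
Proof. by apply: cdiff_prod => j _; exact: cdiff_sinhM. Qed.

Lemma sprod_neq0 x y : y0 <= y <= y1 -> sprod (expC (x +i* y)%C) != 0.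
Proof.
move=> hy; rewrite /sprod big_seq; elim/big_rec: _ => [|j z]; first exact: oner_neq0.
by rewrite mem_index_iota => hj hz; rewrite mulf_neq0// (sector_sinh_neq0 n1).
Qed.

Lemma Anum_cdiff t : t != 0 -> sprod t != 0 -> cdiff full Anum t.
Proof.
by move=> t0 st; apply: cdiffM; [exact: cdiff_exprz|apply: cdiffV => //; exact: sprod_cdiff].
Qed.

Lemma cdiff_sinhC t : cdiff full (@sinhC R) t.
Proof. by exists (coshC t); exact: has_cderiv_sinhC. Qed.

Lemma Phi_cdiff t : t != 0 -> sprod t != 0 -> sinhC t != 0 -> cdiff full Phi t.
Proof.
move=> t0 st sh; apply: cdiffM; first exact: Anum_cdiff.
by apply: cdiffV => //; exact: cdiff_sinhC.
Qed.

Definition pole k : C := 'i%C * (pi * k%:R)%:C%C.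
(** The residue of [Phi] at [pole k] multiplied by [2 * n / pole k]: the parameter [rho] for which
    [kappa] has that residue. *)
Definition resid k : C := (2 * n)%:R * (Anum (pole k) / coshC (pole k)) / pole k.

Lemma poleE k : (0 < k)%N -> pole k = expC (ln (pi * k%:R) +i* (pi / 2))%C.
Proof.
move=> k0; rewrite expCE cos_pihalf sin_pihalf lnK ?posrE ?mulr_gt0 ?ltr0n//.
by apply: complex_eq; rewrite /= ; ring.
Qed.

Lemma pole_neq0 k : (0 < k)%N -> pole k != 0.
Proof. by move=> /poleE ->; exact: expC_neq0. Qed.

Lemma rnorm_pole k : rnorm (pole k) = pi * k%:R.
Proof. by rewrite rnormM rnorm_i mul1r rnorm_real ger0_norm// mulr_ge0// ltW. Qed.

Lemma cos_npi k : cos (pi * k%:R : R) = (-1) ^+ k.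
Proof.
elim: k => [|k IH]; first by rewrite mulr0 cos0.
by rewrite -natr1 mulrDr mulr1 cosDpi IH exprS mulN1r.
Qed.

Lemma pole_i k : pole k = (0 +i* (pi * k%:R))%C.
Proof. by apply: complex_eq; rewrite /= ; ring. Qed.

Lemma coshC_pole k : coshC (pole k) = (-1) ^+ k.
Proof.
have -> : (-1) ^+ k = ((-1) ^+ k : R)%:C%C :> C by rewrite rmorphXn /= rmorphN1.
rewrite pole_i /coshC (_ : - (0 +i* (pi * k%:R))%C = (0 +i* - (pi * k%:R))%C); last first.
  by apply: complex_eq; rewrite //= oppr0.
rewrite !expCE cosN sinN expR0 !mul1r sin_npi cos_npi.
have -> : (2 : C) = (2 : R)%:C%C by rewrite rmorph_nat.
rewrite -fmorphV; apply: complex_eq; rewrite /=; first by field.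
by ring.
Qed.

Lemma sinhC_pole k : sinhC (pole k) = 0.
Proof.
rewrite pole_i sinhCE sin_npi oppr0 expR0 subrr mul0r mul0r mulr0.
by [].
Qed.

Lemma pihalf_in : y0 <= pi / 2 <= y1.
Proof. by rewrite /sec_lo /sec_hi; have := half_gt0 R n1; set h := pi / _ => *; apply/andP; split; lra. Qed.

(** The solutions of [t ^+ (2 * n) = pole k ^+ (2 * n)] have arguments [pi / n] apart, while the
    sector extends only [pi / (2 * n)] to either side of the pole. *)
Lemma sector_2n x y k : (0 < k)%N -> y0 <= y <= y1 ->
  expC (x +i* y)%C ^+ (2 * n) = pole k ^+ (2 * n) -> expC (x +i* y)%C = pole k.
Proof.
move=> k0 /andP[ya yb] h; have n20 : (0 < 2 * n)%N by rewrite muln_gt0 /= ltnW.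
have : expR x = pi * k%:R.
  apply: (pexpIrn n20); rewrite ?nnegrE ?expR_ge0 ?mulr_ge0 ?(ltW p0)//.
  by move: (congr1 (@rnorm R) h); rewrite !rnormX rnorm_expC rnorm_pole.
move=> xE; move: h; rewrite (poleE k0) -!expCMn => /expC_inj_strip[_].
rewrite -!(rmorph_nat (real_complex R)) !Im_mul /= !mulr0 !add0r -mulrBl => /cos_eq1.
have h0 := half_gt0 R n1.
have w1 : `|(y - pi / 2) * (2 * n)%:R| <= pi.
  rewrite normrM (ger0_norm (ler0n _ _)) -ler_pdivlMr ?ltr0n// ler_norml.
  by move: ya yb; rewrite /sec_lo /sec_hi natrM; set q := pi / (2 * n%:R) => *; apply/andP; split; lra.
move: w1; rewrite ler_norml => /andP[w1 w2].
have -> : - (pi *+ 2) <= (y - pi / 2) * (2 * n)%:R <= pi *+ 2.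
  by rewrite mulr2n; have := p0 => *; apply/andP; split; lra.
move=> /(_ isT) [yy|yy|yy]; last 2 first.
- by exfalso; move: w2; rewrite yy mulr2n => w2; have := p0; clear w1; lra.
- by exfalso; move: w1; rewrite yy mulr2n => w1; have := p0; clear w2; lra.
move/eqP: yy; rewrite mulf_eq0 pnatr_eq0 (gtn_eqF n20) orbF subr_eq0 => /eqP ->.
by rewrite -xE expRK.
Qed.

(** [EQ] states that [Phi] and [kappa] have equal residues at the pole; their difference times
    [w - c] therefore tends to [0], and the singularity is removable. *)
Lemma pole_kappa k : (0 < k)%N -> exists l,
  ccont full (fun w => if w == pole k then l else Phi w - kappa n (pole k) (resid k) w) (pole k).
Proof.
move=> k0; set c := pole k; have c0 : c != 0 := pole_neq0 k0.
have n20 : (0 < 2 * n)%N by rewrite muln_gt0 /= ltnW.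
have sc : sprod c != 0 by rewrite /c poleE// sprod_neq0// pihalf_in.
have Ac := Anum_cdiff c0 sc.
have ch0 : coshC c != 0 by rewrite coshC_pole signr_eq0.
have H1 := pole_lim (cdiff_ccont Ac) (has_cderiv_sinhC c) (sinhC_pole k) ch0.
have dX : has_cderiv full (fun w => w ^+ (2 * n) - c ^+ (2 * n)) c ((2 * n)%:R * c ^+ (2 * n).-1).
  have := has_cderivB (has_cderivXn (2 * n).-1 c) (has_cderiv_cst full (c ^+ (2 * n)) c).
  by rewrite subr0 prednK.
have dX0 : (2 * n)%:R * c ^+ (2 * n).-1 != 0 :> C.
  by rewrite mulf_neq0 ?pnatr_eq0 -?lt0n// expf_neq0.
have AX : cdiff full (fun w => resid k * w ^+ (2 * n)) c.
  by apply: cdiffM; [exact: cdiff_cst|exact: cdiffX (cdiff_id c)].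
have H2 := pole_lim (cdiff_ccont AX) dX (subrr _) dX0.
have EQ : Anum c / coshC c = resid k * c ^+ (2 * n) / ((2 * n)%:R * c ^+ (2 * n).-1).
  have cE : c ^+ (2 * n) = c * c ^+ (2 * n).-1 by rewrite -exprS prednK.
  rewrite /resid -/c cE; field.
  by rewrite expf_neq0// c0 ch0 pnatr_eq0 -lt0n ltnW.
have [r1 r10 hr1] := H1 1 ltr01; have [r2 r20 hr2] := H2 1 ltr01.
have [r3 r30 hr3] := near_nonzero (cdiff_ccont (sprod_cdiff c)) sc.
have [r4 r40 hr4] := near_nonzero (cdiff_ccont (cdiff_id c)) c0.
apply: (@removable _ _ _ (Num.min (Num.min r1 r2) (Num.min r3 r4))).
- by rewrite !lt_min r10 r20 r30.
- move=> w /andP[w0]; rewrite !lt_min => /andP[/andP[wr1 wr2] /andP[wr3 wr4]].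
  apply: cdiffB.
    by apply: Phi_cdiff; [exact: hr4|exact: hr3|apply: (hr1 w _).1; rewrite w0].
  by apply: kappa_cdiff; rewrite -subr_eq0; apply: (hr2 w _).1; rewrite w0.
- move=> d d0; have d2 : 0 < d / 2 by rewrite divr_gt0.
  have [s1 s10 hs1] := H1 _ d2; have [s2 s20 hs2] := H2 _ d2.
  exists (Num.min s1 s2); first by rewrite lt_min s10.
  move=> w /andP[w0]; rewrite lt_min => /andP[ws1 ws2].
  have [|_ h1] := hs1 w; first by rewrite w0.
  have [|_ h2] := hs2 w; first by rewrite w0.
  have -> : (w - c) * (Phi w - kappa n c (resid k) w) =
     ((w - c) * (Anum w / sinhC w) - Anum c / coshC c) -
     ((w - c) * (resid k * w ^+ (2 * n) / (w ^+ (2 * n) - c ^+ (2 * n))) -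
       resid k * c ^+ (2 * n) / ((2 * n)%:R * c ^+ (2 * n).-1)).
    by rewrite -EQ /Phi /kappa; ring.
  by apply: le_trans (ler_rnormB _ _) _; lra.
Qed.

(** The bounds on the radii isolate the pole [k]. The mean of [Phi - kappa], patched at the pole,
    does not change, so the mean of [Phi] jumps exactly as that of [kappa]. *)
Lemma smean_Phi_step k x0 x1 : (0 < k)%N -> pi * (k%:R - 1 / 2) <= expR x0 -> expR x0 < pi * k%:R ->
  pi * k%:R < expR x1 -> expR x1 <= pi * (k%:R + 1 / 2) ->
  smean Phi x1 = smean Phi x0 + (y1 - y0)%:C%C * resid k.
Proof.
move=> k0 h1 h2 h3 h4; set c := pole k.
have yl := sec_lt R n1; have ys := sec_small R n1.
have [l hl] := pole_kappa k0.
pose F w := if w == c then l else Phi w - kappa n c (resid k) w.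
have x01 : x0 < x1 by rewrite -(ltr_expR (R:=R)); apply: lt_trans h3.
have sh0 x y : x0 <= x <= x1 -> y0 <= y <= y1 -> expC (x +i* y)%C != c -> sinhC (expC (x +i* y)%C) != 0.
  move=> /andP[xa xb] hy.
  have e1 : expR x0 <= expR x by rewrite ler_expR.
  have e2 : expR x <= expR x1 by rewrite ler_expR.
  have hk : `|expR x - pi * k%:R| <= pi / 2 by rewrite ler_norml; apply/andP; split; lra.
  by apply: contraNN => /eqP /(sector_sinh0 n1 hy hk) ->.
have Phid x y : x0 <= x <= x1 -> y0 <= y <= y1 -> expC (x +i* y)%C != c -> cdiff full Phi (expC (x +i* y)%C).
  by move=> hx hy nc; apply: Phi_cdiff; [exact: expC_neq0|exact: sprod_neq0|exact: sh0].
have kd x y : x0 <= x <= x1 -> y0 <= y <= y1 -> expC (x +i* y)%C != c ->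
    cdiff full (kappa n c (resid k)) (expC (x +i* y)%C).
  by move=> hx hy nc; apply: kappa_cdiff; apply: contraNneq nc => /(sector_2n k0 hy) ->.
have Fd x y : x0 <= x <= x1 -> y0 <= y <= y1 -> expC (x +i* y)%C != c -> cdiff full F (expC (x +i* y)%C).
  move=> hx hy nc; have [d hd] := cdiffB (Phid _ _ hx hy nc) (kd _ _ hx hy nc).
  exists d; apply: (@has_cderiv_eq_near _ _ _ _ _ _ (rnorm (expC (x +i* y)%C - c))) hd.
  - by rewrite rnorm_gt0 subr_eq0.
  - by move=> w _ wr; rewrite /F ifN//; apply/eqP => wc; move: wr; rewrite wc rnormBC ltxx.
  - by rewrite /F ifN.
have S : smean F x1 = smean F x0.
  apply: (@smean_shift _ _ _ yl ys F x0 x1 c x01).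
  - move=> x y hx hy; have [->//|nc] := eqVneq (expC (x +i* y)%C) c.
    exact/cdiff_ccont/Fd.
  - exact: Fd.
  - move=> x hx.
    have hh := half_gt0 R n1; have hl2 := half_le R n1.
    (* The pole lies on the imaginary axis and hence on neither edge of the sector; patching does
       not affect the equality of values on the two edges. *)
    have nc y : cos y != 0 -> expC (x +i* y)%C != c.
      move=> cy; apply/eqP => /(congr1 (@complex.Re R)); rewrite Re_expC /c pole_i /= => /eqP.
      by rewrite mulf_eq0 (gt_eqF (expR_gt0 x)) (negPf cy).
    have cy1 : cos y1 != 0.
      by rewrite /sec_hi addrC cosDpihalf oppr_eq0 gt_eqF// (sin_half_gt0 _ n1).
    have cy0 : cos y0 != 0.
      by rewrite /sec_lo -cosN opprB cosBpihalf gt_eqF// (sin_half_gt0 _ n1).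
    rewrite /F (negPf (nc _ cy0)) (negPf (nc _ cy1)).
    by rewrite (sec_per n1 Phi_per) (sec_per n1 (kappa_per n1 c (resid k))).
have FE x : x0 <= x <= x1 -> expR x != pi * k%:R ->
    smean F x = smean Phi x - smean (kappa n c (resid k)) x.
  move=> hx xk; have nc y : expC (x +i* y)%C != c.
    by apply: contraNneq xk => /(congr1 (@rnorm R)); rewrite rnorm_expC rnorm_pole => ->.
  rewrite -smeanB => [|y hy|y hy]; [|exact/cdiff_ccont/Phid|exact/cdiff_ccont/kd].
  by apply: eq_cint => y _; rewrite /F ifN.
have q1 : x0 <= x1 <= x1 by rewrite lexx ltW.
have q0 : x0 <= x0 <= x1 by rewrite lexx ltW.
have g1 : expR x1 != pi * k%:R by rewrite gt_eqF.
have g0 : expR x0 != pi * k%:R by rewrite lt_eqF.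
rewrite (FE _ q1 g1) (FE _ q0 g0) in S.
rewrite kappa_right// ?rnorm_pole// kappa_left ?rnorm_pole// in S.
have aux (a b d : C) : a - b = d - 0 -> a = d + b by rewrite subr0 => <-; rewrite subrK.
exact: aux S.
Qed.

Definition eta_const : C := (\prod_(i < n) e ^+ i)^-1.
(** The constant coefficient of [Phi] at [0]. For negative [p] the expansion starts with a positive
    power. *)
Definition limit0 : C := if p is Posz P then eta_const * (sinh_poly R n P)`_(2 * P) else 0.

Lemma Phi_sinh_prod t : t != 0 -> Phi t = eta_const * t ^ (- (2 * p)) * sinh_prod n t.
Proof.
move=> t0; rewrite /Phi /Anum /sinh_prod big_split /= prodfV big_split /= prodr_const card_ord.
have -> : \prod_(i < n) sinhC (e ^+ i * t) = sprod t * sinhC t.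
  rewrite -(big_mkord xpredT (fun i => sinhC (e ^+ i * t))) big_ltn// expr0 mul1r mulrC.
  by congr (_ * _); apply: eq_bigr => i _; rewrite mulrC.
rewrite expfzDr// -exprnP /eta_const.
have : \prod_(i < n) e ^+ i != 0 by apply/prodf_neq0 => i _; rewrite expf_neq0// eta_neq0.
move: (\prod_(i < n) _) (sprod t) (sinhC t) => a b c a0.
rewrite invfM [RHS](_ : _ = (a^-1 * a) * (t ^+ n * t ^ (- (2 * p)) * (b^-1 * c^-1))); last by ring.
by rewrite mulVf// mul1r mulrA.
Qed.

(** The principal part of [Phi] at [0], that is, its terms with negative exponents. *)
Let Tpoly P t : C := eta_const * \sum_(k < 2 * P) (sinh_poly R n P)`_k * t ^ (k%:Z - (2 * P)%:Z).

Lemma expr_shift t (a b : nat) : t != 0 -> t ^ (a%:Z - b%:Z) = t ^+ a / t ^+ b.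
Proof. by move=> t0; rewrite expfzDr// -exprnP -invr_expz. Qed.

Lemma Tpoly_cdiff P t : t != 0 -> cdiff full (Tpoly P) t.
Proof.
move=> t0; apply: cdiffM; first exact: cdiff_cst.
apply: cdiff_sum => k _.
by apply: cdiffM; [exact: cdiff_cst|exact: cdiff_exprz].
Qed.

Lemma Tpoly_rot P t : e ^+ (2 * P) = 1 -> Tpoly P (e * t) = Tpoly P t.
Proof.
move=> eP; rewrite /Tpoly; congr (_ * _); apply: eq_bigr => k _.
rewrite expfzMl (@expr_shift e k (2 * P)) ?eta_neq0// eP invr1 mulr1 mulrA (sinh_poly_rot _ n1)//.
by apply: ltnW; rewrite ltnS.
Qed.

(** The principal part is itself rotation invariant and tends to [0] at infinity; moving the radius
    there shows that its mean vanishes. *)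
Lemma smean_Tpoly P x : e ^+ (2 * P) = 1 -> smean (Tpoly P) x = 0.
Proof.
move=> eP; rewrite -(mulr0 ((y1 - y0)%:C%C)); apply: smean_right; [exact: sec_lt|exact: sec_small|..].
- by move=> a b _ _; apply: Tpoly_cdiff; exact: expC_neq0.
- by move=> a _; apply: (sec_per n1) => t; exact: Tpoly_rot.
move=> d d0; pose a k := rnorm ((sinh_poly R n P)`_k).
pose B := rnorm eta_const * \sum_(k < 2 * P) a k.
have B0 : 0 <= B.
  by apply: mulr_ge0; [exact: rnorm_ge0|apply: sumr_ge0 => i _; exact: rnorm_ge0].
have Bd : 0 < B / d + 1 by rewrite ltr_wpDl// divr_ge0// ltW.
exists (ln (B / d + 1)) => u y xu _; rewrite subr0; set t := expC _.
have nt : rnorm t = expR u by rewrite rnorm_expC.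
have T1 : B / d + 1 <= expR u by rewrite -[leLHS]lnK ?ler_expR.
have e1 : 1 <= expR u by apply: le_trans T1; rewrite lerDr divr_ge0// ltW.
have e0 := expR_gt0 u.
apply: (@le_trans _ _ (B / expR u)); last first.
  by rewrite ler_pdivrMr// mulrC -ler_pdivrMr//; lra.
rewrite /Tpoly rnormM /B -mulrA ler_wpM2l ?rnorm_ge0//.
apply: le_trans (ler_rnorm_sum _ _ _) _; rewrite mulr_suml; apply: ler_sum => k _.
rewrite rnormM ler_wpM2l ?rnorm_ge0// expr_shift ?expC_neq0// rnormM rnormV !rnormX nt.
rewrite ler_pdivrMr ?exprn_gt0// mulrC ler_pdivlMr// -exprSr.
by rewrite ler_weXn2l.
Qed.

Lemma smean_Phi_left x0 : expR x0 < pi -> smean Phi x0 = (y1 - y0)%:C%C * limit0.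
Proof.
move=> x0p.
have Phid x y : x <= x0 -> y0 <= y <= y1 -> cdiff full Phi (expC (x +i* y)%C).
  move=> xx hy; apply: Phi_cdiff; [exact: expC_neq0|exact: sprod_neq0|].
  have xp : expR x < pi by apply: le_lt_trans x0p; rewrite ler_expR.
  (* The multiple of [pi] closest to a radius below [pi] is [0] or [pi], and a zero of [sinhC] would
     have exactly that modulus. *)
  apply/eqP => sh; have [k [k1 k2]] : exists k : nat, `|expR x - pi * k%:R| <= pi / 2 /\ (k <= 1)%N.
    have e0 := expR_gt0 x; have [h|h] := leP (expR x) (pi / 2).
      by exists 0%N; split=> //; rewrite ler_norml; apply/andP; split; lra.
    by exists 1%N; split=> //; rewrite ler_norml; apply/andP; split; lra.
  have := sector_sinh0 n1 hy k1 sh => /(congr1 (@rnorm R)); rewrite rnorm_expC rnorm_pole => xE.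
  have := expR_gt0 x; case: k k2 xE {k1} => [|[|//]] _ xE; first by rewrite xE mulr0 ltxx.
  by move: xp; rewrite xE mulr1 ltxx.

have per x : Phi (expC (x +i* y0)%C) = Phi (expC (x +i* y1)%C) by apply: (sec_per n1 Phi_per).
have [[P pE]|[P pE]] : (exists P : nat, p = P) \/ (exists P, p = Negz P).
- by case: (p) => P; [left|right]; exists P.
- have eP : e ^+ (2 * P) = 1 by move: e2p; rewrite pE.
  have yl := sec_lt R n1; have ys := sec_small R n1.
  have tper x : Tpoly P (expC (x +i* y0)%C) = Tpoly P (expC (x +i* y1)%C).
    by apply: (sec_per n1) => t; exact: Tpoly_rot.
  have Td x y : cdiff full (Tpoly P) (expC (x +i* y)%C) by apply: Tpoly_cdiff; exact: expC_neq0.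
  (* Without the principal part the function has the limit [limit0] at the origin, so the radius can
     tend to [0]. *)
  have -> : smean Phi x0 = smean (fun w => Phi w - Tpoly P w) x0.
    rewrite smeanB ?smean_Tpoly ?subr0// => y hy; apply: cdiff_ccont => //.
    exact: Phid.
  apply: (@smean_left R y0 y1 yl ys (fun w => Phi w - Tpoly P w)).
  + by move=> x y xx hy; apply: cdiffB => //; exact: Phid.
  + by move=> x _; rewrite per tper.
  move=> d d0; have [M [r [r0 h]]] := jet_trunc (jet_sinh_prod R n P).
  have B0 : 0 < rnorm eta_const * `|M| + 1 by rewrite ltr_wpDl// mulr_ge0// rnorm_ge0.
  pose m := Num.min (r / 2) (d / (rnorm eta_const * `|M| + 1)).
  have m0 : 0 < m by rewrite lt_min !divr_gt0.
  exists (ln m) => x y hx _; set t := expC _.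
  have nt : rnorm t = expR x by rewrite rnorm_expC.
  have T1 : expR x <= m by rewrite -[leRHS]lnK ?ler_expR.
  move: T1; rewrite le_min ler_pdivlMr// => /andP[T1 T2].
  have t0 : t != 0 := expC_neq0 _.
  have -> : Phi t - Tpoly P t - limit0 =
      eta_const * (t ^+ (2 * P))^-1 * (sinh_prod n t - (\poly_(k < (2 * P).+1) (sinh_poly R n P)`_k).[t]).
    rewrite Phi_sinh_prod// /limit0 pE horner_poly big_ord_recr /= /Tpoly -invr_expz.
    have -> : \sum_(k < 2 * P) (sinh_poly R n P)`_k * t ^ (k%:Z - (2 * P)%:Z) =
      (\sum_(k < 2 * P) (sinh_poly R n P)`_k * t ^+ k) / t ^+ (2 * P).
      by rewrite mulr_suml; apply: eq_bigr => k _; rewrite (@expr_shift t k)// mulrA.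
    rewrite (_ : t ^ (2 * P%:Z) = t ^+ (2 * P)); last by [].
    have := expf_neq0 (2 * P) t0; move: (t ^+ (2 * P)) => u u0.
    by field.
  have e0 := expR_gt0 x.
  rewrite !rnormM rnormV rnormX nt; apply: (@le_trans _ _ (rnorm eta_const * `|M| * expR x)).
    rewrite -!mulrA ler_wpM2l ?rnorm_ge0// mulrC ler_pdivrMr ?exprn_gt0// -mulrA -exprS.
    apply: le_trans (h t _) _; first by rewrite nt e0; lra.
    by rewrite nt ler_wpM2r ?exprn_ge0 ?ler_norm// ltW.
  by move: T2; rewrite ler_pdivlMr//; lra.
- apply: (@smean_left R y0 y1 (sec_lt R n1) (sec_small R n1) Phi) => //.
  move=> d d0; have [B [r [B0 r0 h]]] := jet_bounded (jet_sinh_prod R n 0).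
  have B1 : 0 < rnorm eta_const * B + 1 by rewrite ltr_wpDl// mulr_ge0// rnorm_ge0.
  pose m := Num.min (Num.min (r / 2) 1) (d / (rnorm eta_const * B + 1)).
  have m0 : 0 < m by rewrite !lt_min ltr01 !divr_gt0.
  exists (ln m) => x y hx _; set t := expC _.
  have nt : rnorm t = expR x by rewrite rnorm_expC.
  have T1 : expR x <= m by rewrite -[leRHS]lnK ?ler_expR.
  move: T1; rewrite !le_min ler_pdivlMr// => /andP[/andP[T1 T2] T3].
  have t0 : t != 0 := expC_neq0 _; have e0 := expR_gt0 x.
  rewrite /limit0 pE subr0 Phi_sinh_prod// !rnormM pE.
  have -> : rnorm (t ^ (- (2 * Negz P))) = expR x ^+ (2 * P.+1) by rewrite NegzE mulrN opprK -nt -rnormX.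
  apply: (@le_trans _ _ (rnorm eta_const * B * expR x)); last by move: T3; rewrite ler_pdivlMr//; lra.
  rewrite -!mulrA ler_wpM2l ?rnorm_ge0// mulrC; apply: ler_pM; rewrite ?rnorm_ge0 ?exprn_ge0 ?(ltW e0)//.
    by apply: h; rewrite nt e0; lra.
  by rewrite ler_iXnr// ltW.
Qed.

(** Since [1 < n] the factor [j = 1] is present and gives exponential growth; the remaining factors
    are at least [1]. *)
Lemma sprod_ge x y : y0 <= y <= y1 -> 1 <= (expR (expR x * sin (pi / (2 * n%:R))) - 1) / 2 ->
  (expR (expR x * sin (pi / (2 * n%:R))) - 1) / 2 <= rnorm (sprod (expC (x +i* y)%C)).
Proof.
move=> hy; set q := _ / 2 => q1; rewrite /sprod big_ltn// rnormM.
have hq j : (0 < j < n)%N -> q <= rnorm (sinhC (expC (x +i* y)%C * e ^+ j)) by move=> hj; exact: sector_sinh_ge.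
apply: (@le_trans _ _ (q * 1)); first by rewrite mulr1.
apply: ler_pM => //; [by apply: le_trans q1|by apply: hq|].
rewrite big_seq; elim/big_rec: _ => [|j z]; first by rewrite rnorm1.
rewrite mem_index_iota => /andP[j2 jn] hz; rewrite rnormM -[leLHS]mulr1; apply: ler_pM => //.
by apply: le_trans q1 _; apply: hq; rewrite jn andbT; apply: leq_trans j2.
Qed.

(** A lower bound for [sinhC] on the arcs of radius [pi * (N + 1 / 2)]. If the real part has modulus
    at least [pi / 4], [rnorm_sinhC_ge] gives [pi / 8]; otherwise the imaginary part is within
    [pi / 4] of the radius, and its sine has modulus at least [sin (pi / 4)]. *)
Let arc_min : R := Num.min (pi / 8) (sin (pi / 4)).

Lemma arc_min_gt0 : 0 < arc_min.
Proof. by rewrite lt_min divr_gt0//= sin_gt0_pi//; apply/andP; split; have := p0; lra. Qed.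

Let arc N : R := ln (pi * (N%:R + 1 / 2)).

Lemma arcE N : expR (arc N) = pi * (N%:R + 1 / 2).
Proof. by rewrite lnK// posrE mulr_gt0// ltr_wpDl. Qed.

Lemma sinh_arc_ge N y : y0 <= y <= y1 -> arc_min <= rnorm (sinhC (expC (arc N +i* y)%C)).
Proof.
move=> /andP[ya yb]; set t := expC _; rewrite ge_min.
have h0 := half_gt0 R n1; have h1 := half_le R n1.
have tr : rnorm t = pi * (N%:R + 1 / 2) by rewrite rnorm_expC arcE.
have [a1|a1] := leP (pi / 4) `|complex.Re t|.
  apply/orP; left; apply: le_trans (rnorm_sinhC_ge t).
  by have := expR_ge1Dx `|complex.Re t|; lra.
apply/orP; right; apply: le_trans (rnorm_sinhC_sin t).
have It : 0 <= complex.Im t.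
  rewrite Im_expC /= mulr_ge0 ?expR_ge0// sin_ge0_pi//.
  by move: ya yb h0 h1; rewrite /sec_lo /sec_hi; have := p0; set h := pi / (2 * _) => *; apply/andP; split; lra.
have I1 : complex.Im t <= pi * (N%:R + 1 / 2).
  by rewrite -tr; apply: le_trans (ler_norm _) (ler_Im_rnorm t).
have I2 : pi * (N%:R + 1 / 2) - pi / 4 <= complex.Im t.
  by have := ler_rnorm_ReIm t; rewrite tr (ger0_norm It); lra.
have -> : complex.Im t = pi * N%:R + (pi / 2 - (pi * (N%:R + 1 / 2) - complex.Im t)) by ring.
rewrite sinD sin_npi mul0r add0r cos_npi normrM normrX normrN1 expr1n [leRHS]mul1r.
by apply: le_trans (ler_norm _); apply: sin_ge_sym; have := p0; lra.
Qed.

Lemma ler_rnorm_exprz t (z : int) : 1 <= rnorm t -> rnorm (t ^ z) <= rnorm t ^+ `|z|%N.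
Proof.
move=> t1; case: z => k; first by rewrite -exprnP rnormX.
rewrite NegzE -invr_expz rnormV -exprnP rnormX abszN absz_nat.
have : 1 <= rnorm t ^+ k.+1 by rewrite exprn_ege1.
by move=> h; apply: le_trans (h); rewrite invf_le1//; apply: lt_le_trans h.
Qed.

Lemma Phi_arc (d : R) : 0 < d -> exists N0 : nat, forall N y, (N0 <= N)%N -> y0 <= y <= y1 ->
  rnorm (Phi (expC (arc N +i* y)%C)) <= d.
Proof.
move=> d0; pose c : R := sin (pi / (2 * n%:R)).
have c0 : 0 < c := sin_half_gt0 R n1.
have [B B0 hB] := exp_beats (absz (n%:Z - 2 * p)%R) c0.
have m0 := arc_min_gt0.
(* A radius above [b] meets three demands: [2 / c] for [exp_beats], [B / (arc_min * d)] for the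
   final smallness, and [1] for [ler_rnorm_exprz]. *)
pose b := 2 / c + B / (arc_min * d) + 1.
have b0 : 0 <= b by rewrite !addr_ge0// divr_ge0 ?(ltW B0)// ltW// mulr_gt0.
exists (Num.bound b) => N y NN hy; set t := expC _.
have tr : rnorm t = expR (arc N) by rewrite rnorm_expC.
set r := expR (arc N) in tr.
have rb : b <= r.
  apply: le_trans (ltW (archi_boundP b0)) _; rewrite /r arcE.
  have : (Num.bound b)%:R <= N%:R :> R by rewrite ler_nat.
  have : N%:R <= pi * N%:R :> R by rewrite ler_peMl//; have := pi_ge2 R; lra.
  by have := p0; lra.
have k1 : 0 <= 2 / c by rewrite divr_ge0// ltW.
have k2 : 0 <= B / (arc_min * d) by rewrite divr_ge0 ?(ltW B0)// ltW// mulr_gt0.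
have r1 : 1 <= r by rewrite /b in rb; lra.
have r0 : 0 < r by lra.
have [|q1 hq] := hB r; first by rewrite /b in rb; lra.
have sg := sprod_ge hy q1; have ag := sinh_arc_ge N hy; rewrite -/t in sg ag.
rewrite /Phi /Anum !rnormM !rnormV.
have s0 : 0 < rnorm (sprod t) by apply: lt_le_trans sg; lra.
have a0 : 0 < rnorm (sinhC t) by apply: lt_le_trans ag.
rewrite !ler_pdivrMr//.
have := @ler_rnorm_exprz t (n%:Z - 2 * p); rewrite tr => /(_ r1) /le_trans; apply.
have h1 : B / r <= arc_min * d.
  rewrite ler_pdivrMr// mulrC -ler_pdivrMr ?mulr_gt0//; rewrite /b in rb; lra.
have h2 : r ^+ (absz (n%:Z - 2 * p)%R) <= B / r * ((expR (r * c) - 1) / 2).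
  by rewrite mulrAC ler_pdivlMr// -exprSr.
apply: le_trans h2 _.
apply: (@le_trans _ _ (arc_min * d * rnorm (sprod t))).
  by apply: ler_pM => //; [rewrite divr_ge0// ltW|lra].
by rewrite [leRHS](_ : _ = rnorm (sinhC t) * d * rnorm (sprod t)); [rewrite ler_pM2r// ler_pM2r|ring].
Qed.

Lemma smean_arc N : smean Phi (arc N) = (y1 - y0)%:C%C * (limit0 + \sum_(k < N) resid k.+1).
Proof.
elim: N => [|N IH].
  rewrite big_ord0 addr0; apply: smean_Phi_left; rewrite arcE; have := p0; lra.
rewrite (@smean_Phi_step N.+1 (arc N) (arc N.+1)) ?arcE//.
- by rewrite IH big_ord_recr /= !mulrDr addrA.
- have -> : N.+1%:R = N%:R + 1 :> R by rewrite natr1.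
  by have := p0; lra.
- have -> : N.+1%:R = N%:R + 1 :> R by rewrite natr1.
  by have := p0; lra.
- by have := p0; lra.
Qed.

Lemma resid_sum (d : R) : 0 < d -> exists N0 : nat, forall N, (N0 <= N)%N ->
  rnorm (limit0 + \sum_(k < N) resid k.+1) <= d.
Proof.
move=> d0; have d2 : 0 < d / 2 by rewrite divr_gt0.
have [N0 hN0] := Phi_arc d2; exists N0 => N /hN0 h.
have w0 : 0 < y1 - y0 by rewrite subr_gt0 sec_lt.
have := @smean_near R y0 y1 (sec_lt R n1) Phi (arc N) 0 (d / 2).
rewrite mulr0 subr0 smean_arc rnormM rnorm_real gtr0_norm// => H.
rewrite -(ler_pM2l w0); apply: le_trans (H _ _) _.
- move=> y hy; apply/cdiff_ccont/Phi_cdiff; [exact: expC_neq0|exact: sprod_neq0|].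
  by rewrite -rnorm_gt0; apply: lt_le_trans (sinh_arc_ge N hy); exact: arc_min_gt0.
- by move=> y hy; rewrite subr0; exact: h.
by rewrite le_eqVlt; apply/orP; left; apply/eqP; field.
Qed.

End ResidueSum.

(** * Convergence of numerical series and of symmetric sums over the integers *)

Section PowerSums.
Variable R : realType.

(** Comparison with the integral of [t ^ (- x)]: with [s = x - 1], the induction carries the sharper
    bound [1 + 1 / s - N ^ (- s) / s]. *)
Lemma power_sum_bound (x : R) : 1 < x -> exists M : R, forall N, \sum_(k < N) expR (- (x * ln k.+1%:R)) <= M.
Proof.
move=> x1; pose s := x - 1; have s0 : 0 < s by rewrite subr_gt0.
exists (1 + s^-1) => -[|N]; first by rewrite big_ord0 addr_ge0// invr_ge0 ltW.
apply: (@le_trans _ _ (1 + s^-1 - expR (- (s * ln N.+1%:R)) / s)); last first.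
  by rewrite lerBlDr lerDl divr_ge0 ?expR_ge0// ltW.
elim: N => [|N IH].
  by rewrite big_ord_recr big_ord0 /= ln1 !mulr0 oppr0 expR0; lra.
rewrite big_ord_recr /=; apply: le_trans (lerD IH (lexx _)) _.
have a0 : 0 < N.+1%:R :> R by rewrite ltr0n.
have b0 : 0 < N.+2%:R :> R by rewrite ltr0n.
set a : R := N.+1%:R in a0 *; set b : R := N.+2%:R in b0 *.
have ab : b = a + 1 by rewrite /a /b natr1.
have -> : expR (- (x * ln b)) = expR (- (s * ln b)) / b.
  rewrite -[X in _ / X]lnK ?posrE// -expRN -expRD; congr expR; rewrite /s; ring.
have h1 : b^-1 <= ln b - ln a.
  have h : ln (a / b) <= a / b - 1.
    have {1}-> : a / b = 1 + (a / b - 1) by ring.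
    by apply: le_ln1Dx; rewrite ltrBrDl subrr divr_gt0.
  rewrite lnM ?posrE ?invr_gt0// lnV ?posrE// in h.
  have -> : b^-1 = 1 - a / b by rewrite -(divff (lt0r_neq0 b0)) -mulrBl ab addrAC subrr add0r mul1r.
  by move: h; move: (ln a) (ln b) (a / b) => *; lra.
have h2 : expR (- (s * ln a)) = expR (- (s * ln b)) * expR (s * (ln b - ln a)).
  by rewrite -expRD; congr expR; ring.
have h3 : 1 + s * b^-1 <= expR (s * (ln b - ln a)).
  apply: le_trans (expR_ge1Dx _); rewrite lerD2l ler_pM2l//.
have e0 := expR_gt0 (- (s * ln b)).
have : expR (- (s * ln b)) * (1 + s * b^-1) <= expR (- (s * ln a)) by rewrite h2 ler_pM2l.
rewrite -(ler_pM2r (_ : 0 < s^-1)) ?invr_gt0//.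
have -> : expR (- (s * ln b)) * (1 + s / b) / s = expR (- (s * ln b)) / s + expR (- (s * ln b)) / b.
  by field; rewrite !lt0r_neq0.
by move: (expR (- (s * ln b)) / s) (expR (- (s * ln a)) / s) (_ / b) (s^-1) => *; lra.
Qed.

Lemma square_sum_bound (a : nat -> R) (B : R) (N0 : nat) : (forall k, 0 <= a k) ->
  (forall k, (N0 <= k)%N -> a k * k.+1%:R ^+ 2 <= B) -> exists M, forall N, \sum_(k < N) a k <= M.
Proof.
move=> a0 h; have [|M hM] := @power_sum_bound 2; first by rewrite ltr1n.
pose B' := `|B| + \sum_(k < N0) a k * k.+1%:R ^+ 2.
have t0 k : 0 <= a k * k.+1%:R ^+ 2 by rewrite mulr_ge0// exprn_ge0.
have B0 : 0 <= B' by rewrite addr_ge0// sumr_ge0.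
exists (B' * M) => N; apply: le_trans (ler_wpM2l B0 (hM N)); rewrite mulr_sumr; apply: ler_sum => k _.
have k0 : 0 < k.+1%:R :> R by rewrite ltr0n.
have -> : expR (- (2 * ln k.+1%:R)) = (k.+1%:R ^+ 2)^-1 :> R by rewrite expRN expRM_natl lnK.
rewrite ler_pdivlMr ?exprn_gt0//; have [kN|kN] := leqP N0 k.
  by apply: le_trans (h _ kN) _; apply: le_trans (ler_norm _) _; rewrite lerDl sumr_ge0.
rewrite /B' (bigD1 (Ordinal kN))//= addrCA lerDl addr_ge0// sumr_ge0//.
Qed.
End PowerSums.

Section SymmetricSums.
Variable R : realType.
Local Notation C := R[i].
Local Notation I := {m : int | m != 0}.
Implicit Types (u : int -> C) (N : nat).

Definition posI (k : nat) : I := exist (fun m : int => m != 0) (Posz k.+1) isT.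
Definition negI (k : nat) : I := exist (fun m : int => m != 0) (Negz k) isT.
Definition symI N : {fset I} := seq_fset tt (map posI (iota 0 N) ++ map negI (iota 0 N)).

Lemma symI_uniq N : uniq (map posI (iota 0 N) ++ map negI (iota 0 N)).
Proof.
rewrite cat_uniq !map_inj_uniq ?iota_uniq; [|by move=> a b [->]|by move=> a b [->]].
by rewrite andbT; apply/hasPn => i /mapP[k _ ->]; apply/mapP => -[].
Qed.

Lemma big_symI (V : nmodType) (u : I -> V) N : \sum_(i <- symI N) u i = \sum_(k < N) (u (posI k) + u (negI k)).
Proof.
rewrite (perm_big (map posI (iota 0 N) ++ map negI (iota 0 N))); last first.
  apply: uniq_perm; [exact: fset_uniq|exact: symI_uniq|move=> i].
  exact: seq_fsetE.
rewrite big_cat !big_map /= big_split /= -(big_mkord xpredT (fun k => u (posI k))).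
by rewrite -(big_mkord xpredT (fun k => u (negI k))) /index_iota subn0.
Qed.

Lemma symI_exhaust (A : {fset I}) : exists k0, forall k, (k0 <= k)%N -> (A `<=` symI k)%fset.
Proof.
exists (\max_(i <- A) absz (val i)) => k hk; apply/fsubsetP => i iA.
have hi : (absz (val i) <= k)%N by apply: leq_trans hk; apply: leq_bigmax_seq.
rewrite /symI seq_fsetE mem_cat; apply/orP; case: i hi {iA} => -[[|m]|m] //= im hi.
  by left; apply/mapP; exists m; [rewrite mem_iota|apply: val_inj].
by right; apply/mapP; exists m; [rewrite mem_iota|apply: val_inj].
Qed.

(** [Negz k] is the opposite of [k.+1], so the set [symI k] contributes twice the partial sum over
    positive integers; these sets exhaust the index type. *)
Lemma has_csum_sym u : (forall k, u (Negz k) = u k.+1%:Z) ->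
  (exists M : R, forall N, \sum_(k < N) rnorm (u k.+1%:Z) <= M) ->
  exists2 s, has_csum (fun m : I => u (val m)) s &
  forall d : R, 0 < d -> exists k0, forall k, (k0 <= k)%N -> rnorm (2 * \sum_(j < k) u j.+1%:Z - s) < d.
Proof.
move=> uN [M hM].
have [|s hs] := @has_csum_abs R I (fun m => u (val m)) (M + M).
  move=> A; have [k hk] := symI_exhaust A.
  apply: le_trans (ler_fsum _ (hk k (leqnn k))) _; first by move=> i; exact: rnorm_ge0.
  rewrite (big_symI (fun m : I => rnorm (u (val m)))) big_split /=; apply: lerD; first exact: hM.
  by apply: le_trans (hM k); apply: ler_sum => i _; rewrite -uN.
exists s => // d d0; have [k0 hk0] := has_csum_seq hs symI_exhaust d0.
exists k0 => k /hk0; rewrite (big_symI (fun m : I => u (val m))) /=.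
congr (rnorm (_ - _) < _); rewrite mulr_sumr; apply: eq_bigr => i _; rewrite uN; ring.
Qed.
End SymmetricSums.

(** * The sum over nonzero integers in closed form *)

Section CotangentSum.
Variables (R : realType) (n : nat).
Hypothesis n1 : (1 < n)%N.
Local Notation C := R[i].
Local Notation e := (eta_root n : C).
Variable p : int.
Local Notation q := (2 * p + 1 - n%:Z).

Definition sinh_term (m : int) : C :=
  (-1) ^ m / ((\prod_(1 <= j < n) sinhC (m%:~R * (pi : R)%:C%C * 'i%C * e ^+ j)) * m%:~R ^ q).

Lemma sinh_termE k : sinh_term k.+1%:Z = (-1) ^+ k.+1 / (sprod n (pole R k.+1) * k.+1%:R ^ q).
Proof.
have pE : k.+1%:Z%:~R * (pi : R)%:C%C * 'i%C = pole R k.+1.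
  by rewrite /pole rmorphM rmorph_nat mulrC; congr (_ * _); rewrite mulrC.
by rewrite /sinh_term pE.
Qed.

(** The product of [n.-1] odd functions and the power [q] both contribute [(-1) ^+ n.-1], because
    [q] and [n.-1] have the same parity. *)
Lemma sinh_termN k : sinh_term (Negz k) = sinh_term k.+1%:Z.
Proof.
rewrite /sinh_term NegzE; congr (_ / _).
  by rewrite -invr_expz -exprnP -exprVn invrN1.
have -> : \prod_(1 <= j < n) sinhC ((- k.+1%:Z)%:~R * (pi : R)%:C%C * 'i%C * e ^+ j) =
   (-1) ^+ n.-1 * \prod_(1 <= j < n) sinhC (k.+1%:Z%:~R * (pi : R)%:C%C * 'i%C * e ^+ j).
  rewrite -(subn1 n) -prodr_const_nat -big_split /=; apply: eq_bigr => j _.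
  by rewrite mulrNz [in LHS]mulNr [in LHS]mulNr [in LHS]mulNr sinhCN [RHS]mulN1r.
have -> : (- k.+1%:Z)%:~R = -1 * k.+1%:Z%:~R :> C by rewrite mulrNz mulN1r.
rewrite expfzMl.
have -> : (-1) ^ q = (-1) ^+ n.-1 :> C.
  rewrite (_ : q = 2 * (p - n.-1%:Z) + n.-1%:Z); last by lia.
  by rewrite expfzDr ?oppr_eq0 ?oner_neq0// -exprz_exp (_ : (-1) ^ (2 : int) = 1) ?exp1rz ?mul1r// -exprnP sqrrN expr1n.
set a := \prod_(1 <= j < n) _; set s := (-1) ^+ n.-1; set b := _ ^ q.
have ss : s * s = 1 by rewrite -expr2 sqrr_sign.
by rewrite mulrACA ss mul1r.
Qed.

Lemma sinh_term_bound : exists M : R, forall N, \sum_(k < N) rnorm (sinh_term k.+1%:Z) <= M.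
Proof.
pose c : R := sin (pi / (2 * n%:R)).
have c0 : 0 < c := sin_half_gt0 R n1.
(* The exponent becomes [absz q + 2]: after the power [q] is compensated, the decay [k ^ (- 2)] is
   left. *)
have [B B0 hB] := exp_beats (absz q%R).+1 c0.
apply: (@square_sum_bound R (fun k => rnorm (sinh_term k.+1%:Z)) B (Num.bound (2 / c))) => k; first exact: rnorm_ge0.
move=> hk; have p0 := pi_gt0 R; have p2 := pi_ge2 R.
have k0 : 0 < k.+1%:R :> R by rewrite ltr0n.
have kp : k.+1%:R <= pi * k.+1%:R :> R by rewrite ler_peMl//; lra.
have [|q1 hq] := hB (pi * k.+1%:R).
  apply: le_trans kp; apply: le_trans (ltW (archi_boundP _)) _; first by rewrite divr_ge0// ltW.
  by rewrite ler_nat ltnW.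
have sg : (expR (pi * k.+1%:R * c) - 1) / 2 <= rnorm (sprod n (pole R k.+1)).
  have -> : pi * k.+1%:R = expR (ln (pi * k.+1%:R)) :> R by rewrite lnK// posrE mulr_gt0.
  rewrite poleE//; apply: sprod_ge => //; first exact: pihalf_in.
  by rewrite lnK// posrE mulr_gt0.
have s0 : 0 < rnorm (sprod n (pole R k.+1)) by apply: lt_le_trans sg; lra.
have kq : 0 < rnorm (k.+1%:R ^ q : C) by rewrite rnorm_gt0 expfz_neq0// pnatr_eq0.
rewrite sinh_termE rnormM rnormV rnormX rnormM.
have -> : rnorm (-1 : C) = 1 by rewrite -[RHS](rnorm1 R) -(rnormN 1).
rewrite expr1n mul1r mulrC ler_pdivrMr ?mulr_gt0//.
have hx : 1 <= rnorm (k.+1%:R ^ q : C) * k.+1%:R ^+ (absz q%R).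
  rewrite mulrC -ler_pdivrMr// mul1r -rnormV invr_expz.
  have := @ler_rnorm_exprz R (k.+1%:R : C) (- q); rewrite rnorm_nat abszN; apply.
  by rewrite ler1n.
apply: (@le_trans _ _ (rnorm (k.+1%:R ^ q : C) * k.+1%:R ^+ (absz q%R) * k.+1%:R ^+ 2)).
  by rewrite ler_peMl// exprn_ge0// ltW.
rewrite [leRHS](_ : _ = rnorm (k.+1%:R ^ q : C) * (B * rnorm (sprod n (pole R k.+1)))); last by ring.
rewrite [leLHS](_ : _ = rnorm (k.+1%:R ^ q : C) * k.+1%:R ^+ (absz q%R).+2); last first.
  by rewrite -mulrA; congr (_ * _); rewrite -exprD addn2.
apply: ler_wpM2l; first exact: ltW.
apply: (@le_trans _ _ ((pi * k.+1%:R) ^+ (absz q%R).+2)).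
  by apply: lerXn2r => //; rewrite nnegrE ?mulr_ge0// ltW.
by apply: le_trans hq _; rewrite ler_pM2l.
Qed.

Lemma sinh_term_csummable : csummable (fun m : {m : int | m != 0} => sinh_term (val m)).
Proof.
by have [s /has_csum_csum[]] := has_csum_sym sinh_termN sinh_term_bound.
Qed.

(** A residue at [pole k.+1], scaled by [w = (pi * i) ^ q], is [n] times twice the term at [k.+1]:
    the two accounts for the opposite integer, and [n] comes from the factor [2 * n] in [resid]. *)
Lemma csum_sinh_term : e ^ (2 * p) = 1 ->
  n%:R * csum (fun m : {m : int | m != 0} => sinh_term (val m)) = - ((pi : R)%:C%C * 'i%C) ^ q * limit0 R n p.
Proof.
move=> e2p; have [s /has_csum_csum[_ ->] hs] := has_csum_sym sinh_termN sinh_term_bound.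
set w := (_ * 'i%C) ^ q.
have w0 : w != 0.
  rewrite expfz_neq0// mulf_neq0 -?rnorm_gt0 ?rnorm_i ?ltr01//.
  by rewrite rnorm_real gtr0_norm// pi_gt0.
have nR : 0 < n%:R :> R by rewrite ltr0n ltnW.
have n0 : n%:R != 0 :> C by rewrite pnatr_eq0 -lt0n ltnW.
have rE k : w * resid R n p k.+1 = n%:R * (2 * sinh_term k.+1%:Z).
  rewrite /resid /Anum coshC_pole sinh_termE natrM.
  have c0 := pole_neq0 R (ltn0Sn k).
  have S0 : sprod n (pole R k.+1) != 0 by rewrite poleE// sprod_neq0// pihalf_in.
  have K0 : k.+1%:R ^ q != 0 :> C by rewrite expfz_neq0// pnatr_eq0.
  have -> : pole R k.+1 ^ (n%:Z - 2 * p) = pole R k.+1 * (w * k.+1%:R ^ q)^-1.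
    rewrite /w -expfzMl [X in X ^ q](_ : _ = pole R k.+1); last first.
      by rewrite /pole rmorphM rmorph_nat /=; ring.
    by rewrite invr_expz (_ : n%:Z - 2 * p = 1 + - q) ?expfzDr//; lia.
  rewrite invr_sign; field.
  by rewrite K0 S0 c0 w0.
apply/eqP; rewrite -subr_eq0 mulNr opprK -rnorm_eq0; apply/eqP/le_anti; rewrite rnorm_ge0 andbT.
apply/ler_addgt0Pr => d d0; rewrite add0r.
have d1 : 0 < d / 2 / n%:R by rewrite !divr_gt0.
have d2 : 0 < d / 2 / rnorm w by rewrite !divr_gt0// rnorm_gt0.
have [N1 h1] := hs _ d1; have [N2 h2] := resid_sum n1 e2p d2.
pose N := maxn N1 N2.
have {}h1 := h1 N (leq_maxl _ _); have {}h2 := h2 N (leq_maxr _ _).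
have -> : n%:R * s + w * limit0 R n p = w * (limit0 R n p + \sum_(k < N) resid R n p k.+1) -
   n%:R * (2 * \sum_(j < N) sinh_term j.+1%:Z - s).
  have -> : n%:R * (2 * \sum_(j < N) sinh_term j.+1%:Z - s) = w * (\sum_(k < N) resid R n p k.+1) - n%:R * s.
    by rewrite mulrBr !mulr_sumr; congr (_ - _); apply: eq_bigr => j _; rewrite rE.
  by ring.
apply: le_trans (ler_rnormB _ _) _; rewrite !rnormM rnorm_nat.
rewrite ltr_pdivlMr// mulrC in h1; rewrite ler_pdivlMr ?rnorm_gt0// mulrC in h2.
lra.
Qed.

Definition bern_sum (P : nat) : C :=
  \sum_(m : {ffun 'I_n -> 'I_P.+1} | (\sum_(i < n) m i)%N == P)
    \prod_(i < n) (bern_half R (2 * m i) * e ^+ (2 * i * m i)).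

Lemma sinh_poly_coef P : (sinh_poly R n P)`_(2 * P) = 2 ^+ (2 * P) * bern_sum P.
Proof.
rewrite /sinh_poly (coef_prod_even P (fun (i : 'I_n) k => sinh_coef (e ^+ i) (2 * k))) mulr_sumr; apply: eq_bigr => m /eqP mP.
have -> : 2 ^+ (2 * P) = \prod_(i < n) 2 ^+ (2 * m i) :> C by rewrite -expr_sum -big_distrr /= mP.
rewrite -big_split /=; apply: eq_bigr => i _.
rewrite /sinh_coef exprMn mulrCA -exprM; congr (_ * (_ * _ ^+ _)); lia.
Qed.

Lemma eta_constE : eta_const R n = (e ^+ (n * n.-1 %/ 2))^-1.
Proof.
rewrite /eta_const -expr_sum; congr (_ ^+ _)^-1.
by rewrite -(big_mkord xpredT id) bin2_sum bin2 divn2.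
Qed.

(** The ratio [e ^ (- 2 p)] of the geometric sum is an [n]-th root of unity. *)
Lemma Zcal_eq : Zcal n (2 * p + 1) = if e ^ (2 * p) == 1 then n%:R else 0 :> C.
Proof.
have E (j : 'I_n) : e ^ (j%:Z * (1 - (2 * p + 1))) = (e ^ (2 * p))^-1 ^+ j :> C.
  rewrite (_ : j%:Z * _ = - (2 * p) * j%:Z); last by ring.
  by rewrite invr_expz exprnP exprz_exp.
rewrite /Zcal (eq_bigr _ (fun j _ => E j)); case: eqP => [->|h].
  by rewrite invr1 (eq_bigr (fun=> 1)) => [|j _]; rewrite ?expr1n// sumr_const card_ord.
set x := (_ ^ _)^-1; have x1 : x - 1 != 0 by rewrite subr_eq0 invr_eq1; apply/eqP.
apply: (mulfI x1); rewrite mulr0 -subrX1 /x invr_expz exprnP exprz_exp.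
rewrite (_ : - (2 * p) * n%:Z = (2 * n)%N%:Z * - p); last by rewrite PoszM; ring.
by rewrite -exprz_exp -exprnP eta_2n// exp1rz subrr.
Qed.

Lemma bern_sum0 P : e ^+ (2 * P) != 1 -> bern_sum P = 0.
Proof.
move=> h; have := sinh_poly_coef P; rewrite sinh_poly0// => /esym/eqP.
by rewrite mulf_eq0 expf_eq0 pnatr_eq0 andbF => /eqP.
Qed.

Lemma cotangent_sum : Zcal n (2 * p + 1) * csum (fun m : {m : int | m != 0} => sinh_term (val m)) =
  - (2 ^+ n.-1 * (2 * (pi : R)%:C%C * 'i%C) ^ q / e ^+ (n * n.-1 %/ 2)) *
    (if p is Posz P then bern_sum P else 0).
Proof.
rewrite Zcal_eq; case: eqP => [e2p|/eqP h]; last first.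
  rewrite mul0r; case: (p) h => [P|P] h; last by rewrite mulr0.
  by rewrite bern_sum0 ?mulr0.
rewrite csum_sinh_term// /limit0; case pE: p => [P|P]; last by rewrite !mulr0.
rewrite sinh_poly_coef eta_constE.
(* The exponents of [2] match because [n.-1 + (2 * P + 1 - n) = 2 * P]. *)
have -> : 2 ^+ n.-1 * (2 * (pi : R)%:C%C * 'i%C) ^ (2 * Posz P + 1 - n%:Z) =
  2 ^+ (2 * P) * ((pi : R)%:C%C * 'i%C) ^ (2 * Posz P + 1 - n%:Z).
  rewrite -mulrA expfzMl mulrA; congr (_ * _); rewrite !exprnP -expfzDr ?pnatr_eq0//.
  by congr (_ ^ _); lia.
ring.
Qed.

End CotangentSum.

(** * Barnes zeta-functions *)

Section HalfPlane.
Variables (R : realType) (theta : R).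
Local Notation C := R[i].
Local Notation full := (fun=> True).
Implicit Types (x z w s : C) (k : nat).

(* The real part of [exp (- i theta) * x], positive exactly on the half-plane [H(theta)]. *)
Definition hp x : R := complex.Re x * cos theta + complex.Im x * sin theta.
(** The other coordinate of [x] in the frame rotated by [theta], the imaginary part of
    [exp (- i theta) * x]. *)
Let hq x : R := complex.Im x * cos theta - complex.Re x * sin theta.

Definition logC x : C := (ln (rnorm x))%:C%C + 'i%C * (arg_halfplane theta x)%:C%C.

Lemma hpD x z : hp (x + z) = hp x + hp z.
Proof. by rewrite /hp Re_add Im_add; ring. Qed.

Lemma hp_real (t : R) x : hp (t%:C%C * x) = t * hp x.
Proof. by rewrite /hp Re_mul Im_mul /=; ring. Qed.

Lemma hpMn x k : hp (x * k%:R) = hp x * k%:R.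
Proof. by rewrite mulrC -(rmorph_nat (real_complex R)) hp_real mulrC. Qed.

Lemma hp_sum (I : Type) (r : seq I) (P : pred I) (F : I -> C) : hp (\sum_(i <- r | P i) F i) = \sum_(i <- r | P i) hp (F i).
Proof.
by elim/big_rec2: _ => [|i y u _ <-]; [rewrite /hp /= !mul0r addr0|rewrite hpD].
Qed.

Lemma hpq_norm x : hp x ^+ 2 + hq x ^+ 2 = rnorm x ^+ 2.
Proof.
rewrite rnorm_sqrt sqr_sqrtr ?addr_ge0 ?sqr_ge0// /hp /hq.
have := cos2Dsin2 theta; set c := cos theta; set s := sin theta => cs.
by rewrite -[RHS]mulr1 -cs; ring.
Qed.

Lemma hp_le x : hp x <= rnorm x.
Proof.
apply: le_trans (ler_norm _) _; rewrite -(ler_sqr (R:=R)) ?nnegrE ?rnorm_ge0//.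
by rewrite real_normK ?num_real// -hpq_norm lerDl sqr_ge0.
Qed.

Lemma hp_neq0 x : 0 < hp x -> x != 0.
Proof. by move=> h; rewrite -rnorm_gt0; apply: lt_le_trans (hp_le x). Qed.

(** The argument [theta + atan (hq x / hp x)] witnesses that the choice in [arg_halfplane] is not
    the default. *)
Lemma arg_halfplaneP x : 0 < hp x ->
  (theta - pi / 2 < arg_halfplane theta x < theta + pi / 2) /\ expC (logC x) = x.
Proof.
move=> h; have x0 := hp_neq0 h; have nx : 0 < rnorm x by rewrite rnorm_gt0.
rewrite /logC /arg_halfplane; set A := (X in xget 0 X).
have [|hA xA] := @xgetPex _ 0 A.
  pose t := atan (hq x / hp x); exists (theta + t).
  have t1 : - (pi / 2) < t := atan_gtNpi2 _.
  have t2 : t < pi / 2 := atan_ltpi2 _.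
  split; first by apply/andP; split; lra.
  have ct : 0 < cos t by apply: cos_gt0_pihalf; rewrite t1.
  have qE : hq x = hp x * (sin t / cos t).
    by rewrite -[sin t / cos t]/(tan t) atanK mulrC divfK// lt0r_neq0.
  have nE : rnorm x * cos t = hp x.
    apply/eqP; rewrite -(eqrXn2 (n:=2))// ?mulr_ge0 ?rnorm_ge0 ?(ltW ct) ?(ltW h)//.
    have c2 : cos t != 0 := lt0r_neq0 ct.
    apply/eqP; transitivity ((hp x ^+ 2 + hq x ^+ 2) * cos t ^+ 2); first by rewrite hpq_norm exprMn.
    rewrite qE; transitivity (hp x ^+ 2 * (cos t ^+ 2 + sin t ^+ 2)); first by field.
    by rewrite cos2Dsin2 mulr1.
  have nE2 : rnorm x * sin t = hq x.
    by rewrite qE -nE; field; exact: lt0r_neq0.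
  have cs := cos2Dsin2 theta.
  have xR : complex.Re x = hp x * cos theta - hq x * sin theta.
    by rewrite -[LHS]mulr1 -cs /hp /hq; ring.
  have xI : complex.Im x = hp x * sin theta + hq x * cos theta.
    by rewrite -[LHS]mulr1 -cs /hp /hq; ring.
  have -> : expC ('i%C * (theta + t)%:C%C) = (cos (theta + t) +i* sin (theta + t))%C.
    have -> : 'i%C * (theta + t)%:C%C = (0 +i* (theta + t))%C by apply: complex_eq; rewrite /=; ring.
    by rewrite expCE expR0 !mul1r.
  rewrite rnormE cosD sinD; apply: complex_eq => /=.
    by rewrite xR -nE -nE2; ring.
  by rewrite xI -nE -nE2; ring.
by split=> //; rewrite expCD expC_real lnK ?posrE// -rnormE -xA.
Qed.

Lemma expC_logC x : 0 < hp x -> expC (logC x) = x.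
Proof. by move=> /arg_halfplaneP[]. Qed.

Lemma Re_logC x : complex.Re (logC x) = ln (rnorm x).
Proof. by rewrite /logC Re_add Re_mul /=; ring. Qed.

Lemma Im_logC x : complex.Im (logC x) = arg_halfplane theta x.
Proof. by rewrite /logC Im_add Im_mul /=; ring. Qed.

(** Let [g] be the difference of two logarithms. Then [expC g = w / x] is close to [1], and [g] has
    imaginary part in [(- pi, pi)] because both arguments lie in an interval of length [pi]; so [g]
    is close to [0] and not merely to a multiple of [2 i pi]. *)
Lemma logC_ccont x : 0 < hp x -> ccont full logC x.
Proof.
move=> h d d0; have p0 := pi_gt0 R.
have [hx ex] := arg_halfplaneP h; have x0 := hp_neq0 h; have nx : 0 < rnorm x by rewrite rnorm_gt0.
pose b := Num.min (d / 4) (pi / 4).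
have b0 : 0 < b by rewrite lt_min !divr_gt0.
have [b1 b2] : b <= d / 4 /\ b <= pi / 4 by rewrite /b !ge_min !lexx orbT.
clearbody b.
have sb : 0 < sin b by apply: sin_gt0_pi; apply/andP; split; lra.
have eb : 0 < 1 - expR (- b) by rewrite subr_gt0 -[ltRHS](expR0 R) ltr_expR oppr_lt0.
(* Four demands on the modulus of [u = w / x - 1]: positive cosine, sine below [sin b], and the two
   bounds that confine the real part to [(- b, b)]. *)
pose m := Num.min (Num.min (1 / 2) (sin b / 2)) (Num.min b (1 - expR (- b))).
have m0 : 0 < m by rewrite !lt_min eb b0 !divr_gt0.
have [m1 m2 m3 m4] : [/\ m <= 1 / 2, m <= sin b / 2, m <= b & m <= 1 - expR (- b)].
  by rewrite /m !ge_min !lexx !orbT.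
exists (Num.min (hp x) (m * rnorm x)); first by rewrite lt_min h mulr_gt0.
move=> w _; rewrite lt_min => /andP[w1 w2].
have hw : 0 < hp w.
  have -> : hp w = hp x - hp (x - w) by rewrite -[w in hp w](subrK x) hpD /hp !Re_add !Im_add !Re_opp !Im_opp; ring.
  by have := hp_le (x - w); rewrite rnormBC; lra.
have [hw' ew] := arg_halfplaneP hw; pose u := (w - x) / x.
have nu : rnorm u < m by rewrite /u rnormM rnormV ltr_pdivrMr.
have E : expC (logC w - logC x) = 1 + u.
  have -> : 1 + u = w / x by rewrite /u; field.
  apply: (mulIf (expC_neq0 (logC x))); rewrite -expCD subrK ew ex; field.
  exact: x0.
set g := logC w - logC x in E *.
have gR : expR (complex.Re g) = rnorm (1 + u) by rewrite -E rnorm_expC.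
have g1 : rnorm (1 + u) <= 1 + rnorm u by apply: le_trans (ler_rnormD _ _) _; rewrite rnorm1.
have g2 : 1 - rnorm u <= rnorm (1 + u) by have := lerB_rnormD 1 u; rewrite rnorm1.
have u0 := rnorm_ge0 u.
have R1 : complex.Re g < b.
  by rewrite -(ltr_expR (R:=R)) gR; have := expR_ge1Dx b; lra.
have R2 : - b < complex.Re g.
  by rewrite -(ltr_expR (R:=R)) gR; lra.
have gI : complex.Im g = arg_halfplane theta w - arg_halfplane theta x.
  by rewrite /g Im_add Im_opp !Im_logC.
have I0 : - pi < complex.Im g < pi.
  by rewrite gI; case/andP: hx => q1 q2; case/andP: hw' => q3 q4; apply/andP; split; lra.
have eS : expR (complex.Re g) * sin (complex.Im g) = complex.Im u.
  by rewrite -Im_expC E Im_add /= add0r.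
have eC : expR (complex.Re g) * cos (complex.Im g) = 1 + complex.Re u.
  by rewrite -Re_expC E Re_add /=.
have uR := ler_Re_rnorm u; have uI := ler_Im_rnorm u.
have e0 := expR_gt0 (complex.Re g).
have cg : 0 < cos (complex.Im g).
  by rewrite -(pmulr_rgt0 _ e0) eC; move: uR; rewrite ler_norml => /andP[]; lra.
have sg : `|sin (complex.Im g)| < sin b.
  have : expR (complex.Re g) * `|sin (complex.Im g)| <= rnorm u.
    by rewrite -[X in X * _](gtr0_norm e0) -normrM eS.
  have : 1 / 2 * `|sin (complex.Im g)| <= expR (complex.Re g) * `|sin (complex.Im g)|.
    by rewrite ler_wpM2r// gR; lra.
  lra.
have I1 : `|complex.Im g| < b.
  rewrite ltNge; apply/negP => bI.
  have Ipi : `|complex.Im g| <= pi / 2.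
    rewrite leNgt; apply/negP => q; move: cg.
    have <- : cos `|complex.Im g| = cos (complex.Im g) by case: (ler0P (complex.Im g)) => i0; rewrite ?cosN.
    have q1 : `|complex.Im g| < pi by rewrite ltr_norml.
    have -> : `|complex.Im g| = (`|complex.Im g| - pi / 2) + pi / 2 by ring.
    rewrite cosDpihalf oppr_gt0 ltNge => /negP; apply.
    by apply: sin_ge0_pi; apply/andP; split; lra.
  have : sin b <= sin `|complex.Im g| by apply: sin_ge_sym => //; [exact: ltW|move: Ipi b2 p0; clear; move: `|_| => *; lra].
  move: sg; case: (ler0P (complex.Im g)) => i0 k1; rewrite ?sinN => k2.
    by have := ler_norm (- sin (complex.Im g)); rewrite normrN; lra.
  by have := ler_norm (sin (complex.Im g)); lra.
apply: le_lt_trans (ler_rnorm_ReIm g) _.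
have : `|complex.Re g| < b by rewrite ltr_norml R2.
lra.
Qed.

(** Derivative of an inverse function: differentiability of [expC] at [logC x] combined with
    continuity of [logC]. *)
Lemma has_cderiv_logC x : 0 < hp x -> has_cderiv full logC x x^-1.
Proof.
move=> h d d0; have x0 := hp_neq0 h; have nx : 0 < rnorm x by rewrite rnorm_gt0.
have hE := has_cderiv_expC full (logC x); rewrite expC_logC// in hE.
pose e1 := Num.min (rnorm x / 2) (d * rnorm x ^+ 2 / 2).
have e10 : 0 < e1 by rewrite lt_min !divr_gt0// mulr_gt0// exprn_gt0.
have [e2 e3] : e1 <= rnorm x / 2 /\ e1 <= d * rnorm x ^+ 2 / 2 by rewrite /e1 !ge_min !lexx orbT.
have [r1 r10 h1] := hE _ e10; have [r2 r20 h2] := logC_ccont h r10.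
exists (Num.min (hp x) r2); first by rewrite lt_min h.
move=> w _; rewrite lt_min => /andP[w1 w2].
have hw : 0 < hp w.
  have -> : hp w = hp x - hp (x - w) by rewrite -[w in hp w](subrK x) hpD /hp !Re_add !Im_add !Re_opp !Im_opp; ring.
  by have := hp_le (x - w); rewrite rnormBC; lra.
have := h1 _ I (h2 w I w2); rewrite !expC_logC//; set g := logC w - logC x => h3.
have h4 : rnorm x * rnorm g <= rnorm (w - x) + e1 * rnorm g.
  rewrite -rnormM; have -> : x * g = (w - x) - (w - x - x * g) by ring.
  by apply: le_trans (ler_rnormB _ _) _; rewrite lerD2l.
have g0 := rnorm_ge0 g.
have h5 : rnorm x * rnorm g <= 2 * rnorm (w - x).
  have : e1 * rnorm g <= rnorm x / 2 * rnorm g by rewrite ler_wpM2r.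
  lra.
have -> : g - x^-1 * (w - x) = - ((w - x - x * g) / x) by field.
rewrite rnormN rnormM rnormV ler_pdivrMr//; apply: le_trans h3 _.
have h6 : e1 * rnorm g <= d * rnorm x / 2 * (rnorm x * rnorm g).
  have -> : d * rnorm x / 2 * (rnorm x * rnorm g) = d * rnorm x ^+ 2 / 2 * rnorm g by ring.
  by rewrite ler_wpM2r.
apply: le_trans h6 _.
have -> : d * rnorm (w - x) * rnorm x = d * rnorm x / 2 * (2 * rnorm (w - x)) by field.
by rewrite ler_wpM2l// divr_ge0// mulr_ge0 ?ltW.
Qed.

End HalfPlane.

(** * Taylor remainders and complex powers *)

Section DifferentialFamily.
Variables (R : realType).
Local Notation C := R[i].
Local Notation full := (fun=> True).
Implicit Types (E : nat -> C -> C) (x v w s z : C) (k j J : nat) (c : nat -> C).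

Lemma has_cderiv_expsum c J w :
  has_cderiv full (fun u => \sum_(j < J.+1) c j * (u ^+ j / j`!%:R)) w (\sum_(j < J) c j.+1 * (w ^+ j / j`!%:R)).
Proof.
elim: J => [|J IH].
  rewrite big_ord0; apply: (@has_cderiv_eq_near _ _ (fun=> c 0%N) _ _ _ 1) (has_cderiv_cst _ _ _) => // [u _ _|];
    by rewrite big_ord_recr big_ord0 /= add0r expr0 divr1 mulr1.
have h := has_cderivD IH (has_cderivZ (c J.+1 / J.+1`!%:R) (has_cderivXn J w)).
rewrite big_ord_recr /=.
have -> : c J.+1 * (w ^+ J / J`!%:R) = c J.+1 / J.+1`!%:R * (J.+1%:R * w ^+ J).
  have g0 : J.+1%:R != 0 :> C by rewrite pnatr_eq0.
  have f0 : J`!%:R != 0 :> C by rewrite pnatr_eq0 -lt0n fact_gt0.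
  rewrite factS natrM; move: (J`!%:R) (J.+1%:R) (w ^+ J) (c J.+1) f0 g0 => a b p q a0 b0.
  by field; rewrite a0 b0.
apply: (@has_cderiv_eq_near _ _ _ _ _ _ 1) h => // [u _ _|]; rewrite [in RHS]big_ord_recr /=; ring.
Qed.

Lemma taylor_segment E x v (M : R) J k :
  (forall (t : R) j, 0 <= t <= 1 -> has_cderiv full (E j) (x + t%:C%C * v) (E j.+1 (x + t%:C%C * v))) ->
  (forall t : R, 0 <= t <= 1 -> rnorm (E (k + J)%N (x + t%:C%C * v)) <= M) ->
  rnorm (E k (x + v) - \sum_(j < J) E (k + j)%N x * (v ^+ j / j`!%:R)) <= M * rnorm v ^+ J.
Proof.
elim: J k v => [|J IH] k v hE hM.
  by rewrite big_ord0 subr0 expr0 mulr1; have := hM 1; rewrite addn0 mul1r; apply; rewrite lexx ler01.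
pose f u := E k (x + u) - \sum_(j < J.+1) E (k + j)%N x * (u ^+ j / j`!%:R).
have f0 : f 0 = 0.
  rewrite /f addr0 big_ord_recl /= addn0 expr0 divr1 mulr1 big1 ?addr0 ?subrr// => j _.
  by rewrite /bump /= add1n exprS mul0r mul0r mulr0.
have := @segment_le R f 0 v (M * rnorm v ^+ J); rewrite f0 !subr0 -mulrA -exprSr; apply => t ht.
rewrite add0r; set u := t%:C%C * v.
exists (E k.+1 (x + u) - \sum_(j < J) E (k + j.+1)%N x * (u ^+ j / j`!%:R)).
  apply: has_cderivB (has_cderiv_expsum (fun j => E (k + j)%N x) J u).
  have h1 : has_cderiv full (fun w => x + w) u (0 + 1) := has_cderivD (has_cderiv_cst _ _ _) (has_cderiv_id _ _).
  have := has_cderiv_comp (fun _ _ => I) h1 (hE t k ht); by rewrite add0r mulr1.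
have nt : rnorm (t%:C%C : C) <= 1 by rewrite rnorm_real ger0_norm; case/andP: ht.
have tt (t' : R) : 0 <= t' <= 1 -> 0 <= t' * t <= 1 /\ t'%:C%C * u = (t' * t)%:C%C * v.
  move=> /andP[a0 a1]; case/andP: ht => b0 b1; rewrite /u mulrA rmorphM mulr_ge0//; split=> //.
  by rewrite mulr_ile1.
apply: (@le_trans _ _ (M * rnorm u ^+ J)); last first.
  apply: ler_wpM2l; last first.
    by apply: lerXn2r; rewrite ?nnegrE ?rnorm_ge0// /u rnormM ler_piMl ?rnorm_ge0.
  by apply: le_trans (hM 0 _); rewrite ?rnorm_ge0 ?lexx ?ler01.
rewrite (eq_bigr (fun j : 'I_J => E (k.+1 + j)%N x * (u ^+ j / j`!%:R))) => [|j _]; last by rewrite addSnnS.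
apply: IH => [t' j /tt[h1 ->]|t' /tt[h1 ->]]; first exact: hE.
by rewrite addSnnS; exact: hM.
Qed.

Definition fallingC s k : C := \prod_(i < k) (s - i%:R).

Lemma fallingCS s k : fallingC s k.+1 = fallingC s k * (s - k%:R).
Proof. by rewrite /fallingC big_ord_recr. Qed.

Lemma fallingC_nat N k : (N < k)%N -> fallingC N%:R k = 0.
Proof. by move=> Nk; rewrite /fallingC (bigD1 (Ordinal Nk))//= subrr mul0r. Qed.

Lemma fallingC_fact N k : (k <= N)%N -> fallingC N%:R k * (N - k)`!%:R = N`!%:R.
Proof.
elim: k => [|k IH] kN; first by rewrite /fallingC big_ord0 subn0 mul1r.
rewrite -(IH (ltnW kN)) fallingCS -mulrA; congr (_ * _).
by rewrite -natrB ?(ltnW kN)// -natrM subnS -[in RHS](prednK (_ : 0 < N - k)%N) ?subn_gt0// factS prednK ?subn_gt0.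
Qed.

Lemma rnorm_fallingC (A : R) s k : rnorm s <= A -> rnorm (fallingC s k) <= (A + k%:R) ^+ k.
Proof.
move=> sA; have A0 : 0 <= A := le_trans (rnorm_ge0 s) sA.
rewrite /fallingC rnorm_prod -[X in _ ^+ X](card_ord k) -prodr_const; apply: ler_prod => i _.
rewrite rnorm_ge0 /=; apply: le_trans (ler_rnormB _ _) _; rewrite rnorm_nat; apply: lerD => //.
by rewrite ler_nat ltnW.
Qed.

Variable theta : R.
Local Notation hp := (hp theta).
Local Notation logC := (logC theta).

Definition powC z s : C := expC (s * logC z).

Lemma powCD z s w : powC z (s + w) = powC z s * powC z w.
Proof. by rewrite /powC mulrDl expCD. Qed.

Lemma powC_nat z k : 0 < hp z -> powC z k%:R = z ^+ k.
Proof. by move=> h; rewrite /powC mulrC expCMn expC_logC. Qed.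

Definition pow_deriv s k z : C := fallingC s k * powC z (s - k%:R).

Lemma has_cderiv_powC s z : 0 < hp z -> has_cderiv full (powC^~ s) z (s * powC z (s - 1)).
Proof.
move=> h; have z0 := hp_neq0 h.
have := has_cderiv_comp (fun _ _ => I) (has_cderivZ s (has_cderiv_logC h)) (has_cderiv_expC full (s * logC z)).
rewrite -/(powC z s) powCD (_ : powC z (-1) = z^-1); last first.
  by rewrite /powC mulN1r expCN expC_logC.
by have -> : powC z s * (s * z^-1) = s * (powC z s * z^-1) by ring.
Qed.

Lemma has_cderiv_pow_deriv s k z : 0 < hp z -> has_cderiv full (pow_deriv s k) z (pow_deriv s k.+1 z).
Proof.
move=> h; have := has_cderivZ (fallingC s k) (has_cderiv_powC (s - k%:R) h).
by rewrite mulrA -fallingCS -addrA -opprD (addrC k%:R) nat1r.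
Qed.

Lemma cdiff_fallingC s0 (f : C -> C) k : cdiff full f s0 -> cdiff full (fun s => fallingC (f s) k) s0.
Proof.
by move=> hf; apply: cdiff_prod => i _; apply: cdiffB => //; exact: cdiff_cst.
Qed.

Lemma cdiff_powC s0 (f : C -> C) z : cdiff full f s0 -> cdiff full (fun s => powC z (f s)) s0.
Proof.
move=> [d hf]; eexists; apply: (@has_cderiv_comp _ full full (fun s => f s * logC z)) => //.
  exact: has_cderivM hf (has_cderiv_cst _ _ _).
exact: has_cderiv_expC.
Qed.

(** The argument of [z] and the quotient [rnorm z / Y] are bounded, so for bounded [s] the modulus
    of the power differs from [Y ^ (Re s)] by a bounded factor. *)
Lemma powC_le (A kap W : R) : 0 < kap -> 0 < W -> exists2 B : R, 0 <= B & forall z s (Y : R), 0 < hp z -> 1 <= Y ->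
  kap * Y <= rnorm z -> rnorm z <= W * Y -> rnorm s <= A -> rnorm (powC z s) <= B * expR (complex.Re s * ln Y).
Proof.
move=> kap0 W0; pose L := `|ln kap| + `|ln W|; pose T := `|theta| + pi.
have p0 := pi_gt0 R.
exists (expR (A * (L + T))) => [|z s Y hz Y1 h1 h2 sA]; first exact: expR_ge0.
have Y0 : 0 < Y by lra.
have z0 : 0 < rnorm z by apply: lt_le_trans h1; rewrite mulr_gt0.
have A0 : 0 <= A := le_trans (rnorm_ge0 s) sA.
rewrite /powC rnorm_expC Re_mul Re_logC Im_logC -expRD ler_expR.
have [/andP[g1 g2] _] := arg_halfplaneP hz.
have hT : `|arg_halfplane theta z| <= T.
  have := ler_norm theta; have := ler_norm (- theta); rewrite normrN /T ler_norml => *; apply/andP; split; lra.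
have hL : `|ln (rnorm z) - ln Y| <= L.
  have l1 : ln kap + ln Y <= ln (rnorm z) by rewrite -lnM ?posrE// ler_ln ?posrE ?mulr_gt0.
  have l2 : ln (rnorm z) <= ln W + ln Y by rewrite -lnM ?posrE// ler_ln ?posrE ?mulr_gt0.
  have := ler_norm (ln W); have := ler_norm (- ln kap); rewrite normrN /L ler_norml => *.
  have := normr_ge0 (ln W); have := normr_ge0 (ln kap) => *.
  by apply/andP; split; lra.
have hR : `|complex.Re s| <= A := le_trans (ler_Re_rnorm s) sA.
have hI : `|complex.Im s| <= A := le_trans (ler_Im_rnorm s) sA.
have -> : complex.Re s * ln (rnorm z) = complex.Re s * (ln (rnorm z) - ln Y) + complex.Re s * ln Y by ring.
rewrite addrAC lerD2r [leRHS]mulrDr; apply: le_trans (ler_norm _) _; apply: le_trans (ler_normB _ _) _.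
by rewrite !normrM; apply: lerD; apply: ler_pM.
Qed.

End DifferentialFamily.

(** * Lattice sums and difference operators *)

Section Lattice.
Variables (R : realType) (n : nat).
Local Notation C := R[i].
Implicit Types (M : nat) (S : {ffun 'I_n -> bool}) (g : C -> C) (a x t : C).

Definition box_ffun M (m : {ffun 'I_n -> 'I_M}) : {ffun 'I_n -> nat} := [ffun i => val (m i)].

Lemma box_ffun_inj M : injective (@box_ffun M).
Proof.
move=> m m' /ffunP h; apply/ffunP => i; apply: val_inj.
by have := h i; rewrite !ffunE.
Qed.

Definition box M : {fset {ffun 'I_n -> nat}} := seq_fset tt (map (@box_ffun M) (index_enum {ffun 'I_n -> 'I_M})).

Lemma big_box (V : nmodType) (u : {ffun 'I_n -> nat} -> V) M :
  \sum_(m <- box M) u m = \sum_(m : {ffun 'I_n -> 'I_M}) u (box_ffun m).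
Proof.
rewrite (perm_big (map (@box_ffun M) (index_enum {ffun 'I_n -> 'I_M}))) ?big_map//.
apply: uniq_perm; [exact: fset_uniq| |exact: seq_fsetE].
by rewrite map_inj_uniq ?index_enum_uniq//; exact: box_ffun_inj.
Qed.

Lemma box_exhaust (A : {fset {ffun 'I_n -> nat}}) : exists k0, forall k, (k0 <= k)%N -> (A `<=` box k)%fset.
Proof.
exists (\max_(m <- A) \max_(i < n) m i).+1 => k hk; apply/fsubsetP => m mA.
have hm i : (m i < k)%N.
  apply: leq_trans hk; rewrite ltnS; apply: leq_trans (leq_bigmax_seq _ mA _) => //.
  exact: leq_bigmax.
rewrite /box seq_fsetE; apply/mapP; exists [ffun i => Ordinal (hm i)]; first exact: mem_index_enum.
by apply/ffunP => i; rewrite !ffunE.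
Qed.

Definition weight (m : {ffun 'I_n -> nat}) : R := 1 + (\sum_(i < n) m i)%N%:R.

Lemma weight_ge1 m : 1 <= weight m. Proof. by rewrite /weight lerDl. Qed.

(** The weight is at least [m i + 1] for every [i]. Distributing the exponent [rho] evenly over the
    coordinates bounds the sum by the [n]-th power of a one-dimensional sum with exponent
    [rho / n > 1]. *)
Lemma lattice_sum_bound (rho : R) : (0 < n)%N -> n%:R < rho ->
  exists M : R, forall A : {fset {ffun 'I_n -> nat}}, \sum_(m <- A) expR (- (rho * ln (weight m))) <= M.
Proof.
move=> n0 hr; have nR : 0 < n%:R :> R by rewrite ltr0n.
have r1 : 1 < rho / n%:R by rewrite ltr_pdivlMr// mul1r.
have r0 : 0 < rho by apply: lt_trans hr.
have [M hM] := power_sum_bound r1.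
exists (M ^+ n) => A; have [k hk] := box_exhaust A.
apply: le_trans (ler_fsum (fun m => expR_ge0 _) (hk k (leqnn k))) _; rewrite big_box.
apply: (@le_trans _ _ (\sum_(m : {ffun 'I_n -> 'I_k}) \prod_(i < n) expR (- (rho / n%:R * ln (m i).+1%:R)))).
  apply: ler_sum => m _; rewrite -expR_sum ler_expR sumrN lerN2.
  have -> : rho * ln (weight (box_ffun m)) = \sum_(i < n) rho / n%:R * ln (weight (box_ffun m)).
    by rewrite sumr_const card_ord -mulrnAl -[in RHS]mulr_natr divfK// lt0r_neq0.
  apply: ler_sum => i _; apply: ler_wpM2l; first by rewrite ltW// divr_gt0.
  have w1 := weight_ge1 (box_ffun m).
  rewrite ler_ln ?posrE ?ltr0n//; last by apply: lt_le_trans w1.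
  by rewrite /weight -nat1r lerD2l ler_nat (bigD1 i)//= ffunE leq_addr.
have E := bigA_distr_bigA (fun (i : 'I_n) (j : 'I_k) => expR (- (rho / n%:R * ln j.+1%:R)) : R).
rewrite -E -[X in _ ^+ X](card_ord n) -prodr_const; apply: ler_prod => i _.
by rewrite hM andbT; apply: sumr_ge0 => j _; exact: expR_ge0.
Qed.

Variable om : 'I_n -> C.

Definition sgnS S : C := \prod_(i < n) (-1) ^+ (S i).
Definition shift S : C := \sum_(i < n) om i * (S i)%:R.
(* Formally [\prod_i (1 - exp (om i * D))], where [D] is the derivation. *)
Definition diffop g x : C := \sum_S sgnS S * g (x + shift S).

Lemma ffun_indicator (J : finType) (z z0 : {ffun 'I_n -> J}) : \prod_(i < n) (z i == z0 i)%:R = (z == z0)%:R :> C.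
Proof.
have [->|h] := eqVneq z z0; first by rewrite big1// => i _; rewrite eqxx.
have [i hi] : exists i, z i != z0 i.
  apply/existsP; rewrite -negb_forall; apply: contraNN h => /forallP h.
  by apply/eqP/ffunP => i; apply/eqP.
by rewrite (bigD1 i)//= (negPf hi) mul0r.
Qed.

Lemma sum_indicator (J : finType) (F : {ffun 'I_n -> J} -> C) (z0 : {ffun 'I_n -> J}) :
  \sum_z F z * \prod_(i < n) (z i == z0 i)%:R = F z0.
Proof.
rewrite (eq_bigr (fun z => F z * (z == z0)%:R)) => [|z _]; last by rewrite ffun_indicator.
by rewrite (bigD1 z0)//= eqxx mulr1 big1 ?addr0// => z /negPf ->; rewrite mulr0.
Qed.

(* Written over indicator functions of lattice points, both sides factor over the coordinates,
   and the identity becomes a telescoping sum in each of them. *)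
Lemma diffop_box g a M :
  \sum_(m : {ffun 'I_n -> 'I_M}) diffop g (a + \sum_(i < n) om i * (m i)%:R) =
  \sum_S sgnS S * g (a + M%:R * shift S).
Proof.
pose G (z : {ffun 'I_n -> 'I_M.+1}) := g (a + \sum_(i < n) om i * (z i)%:R).
(* What telescoping leaves in a single coordinate; the product over the coordinates is supported on
   the corners of the dilated box. *)
pose h (z : 'I_M.+1) : C := (val z == 0%N)%:R - (val z == M)%:R.
have L1 m S : sgnS S * g (a + \sum_(i < n) om i * (m i : 'I_M)%:R + shift S) =
   \sum_z G z * \prod_(i < n) ((-1) ^+ (S i) * (val (z i) == (m i + S i)%N)%:R).
  have hz i : (m i + S i < M.+1)%N by have := ltn_ord (m i); case: (S i); rewrite ?addn1 ?addn0 ltnS// => /ltnW.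
  pose z0 : {ffun 'I_n -> 'I_M.+1} := [ffun i => Ordinal (hz i)].
  transitivity (\sum_z sgnS S * G z * \prod_(i < n) (z i == z0 i)%:R).
    rewrite (sum_indicator (fun z => sgnS S * G z)) /G /shift -addrA -big_split /=; congr (_ * g (_ + _)).
    by apply: eq_bigr => i _; rewrite ffunE /= natrD mulrDr.
  apply: eq_bigr => z _; rewrite big_split /= -/(sgnS S) (mulrC (sgnS S)) -mulrA; congr (_ * (_ * _)).
  by apply: eq_bigr => i _; rewrite -val_eqE ffunE.
have L2 S : sgnS S * g (a + M%:R * shift S) =
   \sum_z G z * \prod_(i < n) ((-1) ^+ (S i) * (val (z i) == (M * S i)%N)%:R).
  have hz i : (M * S i < M.+1)%N by case: (S i); rewrite ?muln1 ?muln0.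
  pose z0 : {ffun 'I_n -> 'I_M.+1} := [ffun i => Ordinal (hz i)].
  transitivity (\sum_z sgnS S * G z * \prod_(i < n) (z i == z0 i)%:R).
    rewrite (sum_indicator (fun z => sgnS S * G z)) /G /shift mulr_sumr; congr (_ * g (_ + _)).
    by apply: eq_bigr => i _; rewrite ffunE /= natrM; ring.
  apply: eq_bigr => z _; rewrite big_split /= -/(sgnS S) (mulrC (sgnS S)) -mulrA; congr (_ * (_ * _)).
  by apply: eq_bigr => i _; rewrite -val_eqE ffunE.
rewrite (eq_bigr (fun S => \sum_z G z * \prod_(i < n) ((-1) ^+ (S i) * (val (z i) == (M * S i)%N)%:R))) => [|S _]; last exact: L2.
rewrite [RHS]exchange_big /=.
transitivity (\sum_z G z * \prod_(i < n) h (z i)).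
  have L3 (m : {ffun 'I_n -> 'I_M}) : diffop g (a + \sum_(i < n) om i * (m i)%:R) =
    \sum_z \sum_(S : {ffun 'I_n -> bool}) G z * \prod_(i < n) ((-1) ^+ (S i) * (val (z i) == (m i + S i)%N)%:R).
    by rewrite exchange_big /=; apply: eq_bigr => S _; exact: L1.
  rewrite (eq_bigr _ (fun m _ => L3 m)).
  rewrite exchange_big /=; apply: eq_bigr => z _; under eq_bigr do rewrite -mulr_sumr.
  rewrite -mulr_sumr; congr (_ * _).
  have L4 (m : {ffun 'I_n -> 'I_M}) :
      \sum_(S : {ffun 'I_n -> bool}) \prod_(i < n) ((-1) ^+ (S i) * (val (z i) == (m i + S i)%N)%:R) =
      \prod_(i < n) \sum_(b : bool) (-1) ^+ b * (val (z i) == (m i + b)%N)%:R :> C.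
    by rewrite bigA_distr_bigA.
  rewrite (eq_bigr _ (fun m _ => L4 m)).
  rewrite -(bigA_distr_bigA (fun (i : 'I_n) (k : 'I_M) => \sum_(b : bool) (-1) ^+ b * (val (z i) == (k + b)%N)%:R)).
  apply: eq_bigr => i _; rewrite /h.
  transitivity (\sum_(0 <= k < M) ((val (z i) == k)%:R - (val (z i) == k.+1)%:R) : C).
    by rewrite big_mkord; apply: eq_bigr => k _; rewrite big_bool /= addn0 addn1 expr1 expr0; ring.
  have := @telescope_sumr _ 0 M (fun k => - (val (z i) == k)%:R : C) (leq0n M).
  rewrite opprK addrC => <-; apply: eq_bigr => k _; ring.
apply: eq_bigr => z _; rewrite -mulr_sumr; congr (_ * _).
rewrite -(bigA_distr_bigA (fun (i : 'I_n) (b : bool) => (-1) ^+ b * (val (z i) == (M * b)%N)%:R)).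
by apply: eq_bigr => i _; rewrite big_bool /= muln0 muln1 expr1 expr0 /h; ring.
Qed.

End Lattice.

Section SumsOfHolomorphic.
Variables (R : realType) (I : choiceType).
Local Notation C := R[i].
Local Notation full := (fun=> True).

(** Weierstrass' theorem for dominated sums: the derivative is the sum of the first Taylor
    coefficients, and [taylor3] bounds the second-order remainder of each term by a multiple of
    [b i]. *)
Lemma csum_cdiff (u : I -> C -> C) (b : I -> R) (s0 : C) (r M : R) : 0 < r ->
  (forall i z, rnorm (z - s0) <= r -> cdiff full (u i) z) ->
  (forall i z, rnorm (z - s0) <= r -> rnorm (u i z) <= b i) ->
  (forall A : {fset I}, \sum_(i <- A) b i <= M) ->
  cdiff full (fun z => csum (fun i => u i z)) s0.
Proof.
move=> r0 hu hb hM; have M0 : 0 <= M by have := hM fset0; rewrite big_seq_fset0.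
pose g i h := u i (s0 + h).
have gd i h : rnorm h <= r -> cdiff full (g i) h.
  move=> hr; have [|d hd] := hu i (s0 + h); first by rewrite addrC addKr.
  exists (d * (0 + 1)); apply: (@has_cderiv_comp _ full full (fun w => s0 + w)) => //.
  exact: has_cderivD (has_cderiv_cst _ _ _) (has_cderiv_id _ _).
have gb i h : rnorm h = r -> rnorm (g i h) <= b i by move=> hr; apply: hb; rewrite addrC addKr hr.
pose t1 i := tcoef (g i) r 1.
have b0 i : 0 <= b i by apply: le_trans (hb i s0 _); rewrite ?rnorm_ge0// subrr rnorm0 ltW.
have ht1 i : rnorm (t1 i) <= 2 / r * b i.
  by apply: le_trans (tcoef_le r0 (gd i) 1 (gb i)) _; rewrite expr1 le_eqVlt; apply/orP; left; apply/eqP; ring.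
have sumb (k : R) (v : I -> C) : 0 <= k -> (forall i, rnorm (v i) <= k * b i) ->
    forall A : {fset I}, \sum_(i <- A) rnorm (v i) <= k * M.
  move=> k0 hv A; apply: (@le_trans _ _ (\sum_(i <- A) k * b i)); first by apply: ler_sum => i _.
  by rewrite -mulr_sumr ler_wpM2l.
have k2 : 0 <= 2 / r by rewrite divr_ge0// ltW.
have [T1 hT1] := has_csum_abs (sumb _ _ k2 ht1).
have hS z : rnorm (z - s0) <= r -> has_csum (fun i => u i z) (csum (fun i => u i z)).
  move=> zr; have [|s hs] := @has_csum_abs _ _ (fun i => u i z) (1 * M).
    by apply: sumb => // i; rewrite mul1r; apply: hb.
  by have [_ ->] := has_csum_csum hs.
exists T1 => e e0; pose K := 4 / r ^+ 2.
have K0 : 0 <= K by rewrite divr_ge0// exprn_ge0// ltW.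
have KM1 : 0 < K * M + 1 by rewrite ltr_wpDl// mulr_ge0.
exists (Num.min (r / 2) (e / (K * M + 1))); first by rewrite lt_min !divr_gt0.
move=> z _; rewrite lt_min => /andP[z1]; rewrite ltr_pdivlMr// => z2.
have zr : rnorm (z - s0) <= r by lra.
have s0r : rnorm (s0 - s0) <= r by rewrite subrr rnorm0 ltW.
have H := has_csumB (has_csumB (hS z zr) (hS s0 s0r)) (has_csumZ (z - s0) hT1).
rewrite mulrC; apply: (@le_trans _ _ (K * rnorm (z - s0) ^+ 2 * M)); last first.
  rewrite expr2; have := rnorm_ge0 (z - s0); set x := rnorm _ in z2 *; clear -z2 K0 M0 => x0.
  have : (K * M + 1) * x * x <= e * x by apply: ler_wpM2r => //; rewrite mulrC ltW.
  have : 0 <= x * x by rewrite mulr_ge0.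
  by lra.
apply: has_csum_le H _; apply: sumb => [|i]; first by rewrite mulr_ge0// exprn_ge0// rnorm_ge0.
set h := z - s0.
have hh : rnorm h <= r / 2 by rewrite ltW.
have T := taylor3 r0 (gd i) (gb i) hh; rewrite (tcoef0 r0 (gd i)) in T.
have h2 := tcoef_le r0 (gd i) 2 (gb i).
have gz : g i h = u i z by rewrite /g /h addrC subrK.
have g0 : g i 0 = u i s0 by rewrite /g addr0.
rewrite gz g0 -/(t1 i) in T.
have -> : u i z - u i s0 - h * t1 i = (u i z - u i s0 - t1 i * h - tcoef (g i) r 2 * h ^+ 2) + tcoef (g i) r 2 * h ^+ 2.
  by ring.
apply: le_trans (ler_rnormD _ _) _; rewrite rnormM rnormX.
pose q := rnorm h / r.
have q0 : 0 <= q by rewrite divr_ge0 ?rnorm_ge0// ltW.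
have q2 : 2 * q <= 1 by rewrite /q mulrA ler_pdivrMr// mul1r mulrC -ler_pdivlMr.
have E1 : rnorm (tcoef (g i) r 2) * rnorm h ^+ 2 <= 2 * b i * q ^+ 2.
  have -> : 2 * b i * q ^+ 2 = 2 * (b i / r ^+ 2) * rnorm h ^+ 2 by rewrite /q expr_div_n; ring.
  by rewrite ler_wpM2r// exprn_ge0// rnorm_ge0.
have E2 : 4 * b i * q ^+ 3 <= 2 * b i * q ^+ 2.
  have -> : 4 * b i * q ^+ 3 = 2 * b i * q ^+ 2 * (2 * q) by ring.
  by apply: ler_piMr => //; apply: mulr_ge0; [apply: mulr_ge0 => //; exact: b0|exact: exprn_ge0].
have -> : K * rnorm h ^+ 2 * b i = 2 * b i * q ^+ 2 + 2 * b i * q ^+ 2.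
  by rewrite /K /q expr_div_n; field; exact: lt0r_neq0.
by rewrite -/q in T; apply: lerD => //; apply: le_trans E2.
Qed.

End SumsOfHolomorphic.

(** * Coefficients of the Barnes generating function *)

Section BarnesCoefficients.
Variables (R : realType) (n : nat).
Local Notation C := R[i].
Local Notation full := (fun=> True).
Implicit Types (a b : nat -> C) (f g : C -> C) (t : C).

Lemma gjetD a b f g : gjet a f -> gjet b g -> gjet (fun k => a k + b k) (fun t => f t + g t).
Proof.
move=> [M [A [r [M0 A0 r0 h]]]] [M' [A' [r' [M'0 A'0 r'0 h']]]].
have L1 : A <= Num.max A A' by rewrite le_max lexx.
have L2 : A' <= Num.max A A' by rewrite le_max lexx orbT.
exists (M + M'), (Num.max A A'), (Num.min r r'); split; rewrite ?addr_ge0 ?(le_trans A0 L1)// ?lt_min ?r0//.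
move=> N t /andP[t0]; rewrite lt_min => /andP[tr tr'].
have -> : f t + g t - \sum_(k < N) (a k + b k) * t ^+ k =
  (f t - \sum_(k < N) a k * t ^+ k) + (g t - \sum_(k < N) b k * t ^+ k).
  by under eq_bigr do rewrite mulrDl; rewrite big_split /=; ring.
apply: le_trans (ler_rnormD _ _) _; rewrite mulrDl; apply: lerD.
  apply: le_trans (h N t _) _; first by rewrite t0.
  apply: ler_wpM2l => //; apply: lerXn2r; rewrite ?nnegrE ?mulr_ge0 ?rnorm_ge0 ?(le_trans A0 L1)//.
  by apply: ler_wpM2r; rewrite ?rnorm_ge0.
apply: le_trans (h' N t _) _; first by rewrite t0.
apply: ler_wpM2l => //; apply: lerXn2r; rewrite ?nnegrE ?mulr_ge0 ?rnorm_ge0 ?(le_trans A0 L1)//.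
by apply: ler_wpM2r; rewrite ?rnorm_ge0.
Qed.

Lemma gjetZ (c : C) a f : gjet a f -> gjet (fun k => c * a k) (fun t => c * f t).
Proof.
move=> [M [A [r [M0 A0 r0 h]]]]; exists (rnorm c * M), A, r; split; rewrite ?mulr_ge0 ?rnorm_ge0// => N t tr.
have -> : c * f t - \sum_(k < N) c * a k * t ^+ k = c * (f t - \sum_(k < N) a k * t ^+ k).
  by rewrite mulrBr mulr_sumr; congr (_ - _); apply: eq_bigr => k _; rewrite mulrA.
by rewrite rnormM -mulrA ler_wpM2l ?rnorm_ge0//; exact: h.
Qed.

Lemma gjet_Xn m : gjet (fun k => (k == m)%:R) (fun t => t ^+ m).
Proof.
exists 1, 1, 1; split=> // N t /andP[t0 t1]; rewrite !mul1r.
have [mN|Nm] := ltnP m N.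
  rewrite (bigD1 (Ordinal mN))//= eqxx mul1r big1 ?addr0 ?subrr ?rnorm0 ?exprn_ge0 ?rnorm_ge0// => k km.
  by rewrite -val_eqE /= in km; rewrite (negPf km) mul0r.
rewrite big1 ?subr0 => [|k _]; last by rewrite ltn_eqF ?mul0r// (leq_trans (ltn_ord k)).
by rewrite rnormX; apply: ler_wiXn2l; rewrite ?rnorm_ge0 ?(ltW t1).
Qed.

Lemma gjet0 : gjet (fun=> 0) (fun=> 0 : C).
Proof.
exists 0, 0, 1; split=> // N t _; rewrite mul0r big1 ?subr0 ?rnorm0// => k _.
by rewrite mul0r.
Qed.

Lemma gjet_sum (J : Type) (s : seq J) (a : J -> nat -> C) (f : J -> C -> C) : (forall j, gjet (a j) (f j)) ->
  gjet (fun k => \sum_(j <- s) a j k) (fun t => \sum_(j <- s) f j t).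
Proof.
move=> h; elim: s => [|j s IH].
  have -> : (fun k => \sum_(j <- [::]) a j k) = fun=> 0 by apply: funext => k; rewrite big_nil.
  by apply: gjet_ext gjet0 => [|t _]; [exact: ltr01|rewrite big_nil].
have -> : (fun k => \sum_(j <- j :: s) a j k) = fun k => a j k + \sum_(j <- s) a j k.
  by apply: funext => k; rewrite big_cons.
by apply: gjet_ext (gjetD (h j) IH) => [|t _]; [exact: ltr01|rewrite big_cons].
Qed.

Lemma gjet_prod (J : Type) (s : seq J) (f : J -> C -> C) : (forall j, exists a, gjet a (f j)) ->
  exists a, gjet a (fun t => \prod_(j <- s) f j t).
Proof.
move=> h; elim: s => [|j s [b hb]].
  by exists (fun k => (k == 0%N)%:R); apply: gjet_ext (gjet_Xn 0) => [|t _]; [exact: ltr01|rewrite big_nil expr0].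
have [a ha] := h j; exists (conv a b).
by apply: gjet_ext (gjetM ha hb) => [|t _]; [exact: ltr01|rewrite big_cons].
Qed.

Variable om : 'I_n -> C.
Hypothesis om0 : forall i, om i != 0.

(** The Taylor coefficients of [\prod_i (1 - exp (om i * t))], with the product expanded over
    subsets [S] exactly as in [diffop]. *)
Definition taucoef k : C := \sum_(S : {ffun 'I_n -> bool}) sgnS R S * (shift om S ^+ k / k`!%:R).

Lemma gjet_taucoef : gjet taucoef (fun t => \prod_(i < n) (1 - expC (om i * t))).
Proof.
have h (S : {ffun 'I_n -> bool}) := gjetZ (sgnS R S) (gjet_expC (shift om S)).
apply: gjet_ext (gjet_sum (index_enum {ffun 'I_n -> bool}) h) => [|t _]; first exact: ltr01.
have -> : \prod_(i < n) (1 - expC (om i * t)) = \prod_(i < n) \sum_(b : bool) (-1) ^+ b * expC (om i * b%:R * t).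
  apply: eq_bigr => i _; rewrite big_bool /= expr1 expr0 mulr1 mulr0 mul0r expC0 mul1r mulN1r addrC.
  by [].
rewrite bigA_distr_bigA; apply: eq_bigr => S _; rewrite big_split /=; congr (_ * _).
rewrite /shift mulr_suml; apply: (big_rec2 (fun y u => expC y = u)); first by rewrite expC0.
by move=> i y u _ <-; rewrite expCD.
Qed.

Lemma exp_neq1 : exists2 r : R, 0 < r & forall t, 0 < rnorm t < r -> expC t != 1.
Proof.
have [|r r0 hr] := @has_cderiv_expC0 R full (1 / 2); first by rewrite divr_gt0.
exists r => // t /andP[t0 tr].
apply/eqP => et; have := hr t I; rewrite subr0 => /(_ tr).
by rewrite et expC0 subrr sub0r mul1r rnormN; lra.
Qed.

Lemma exp_prod_neq0 : exists2 r : R, 0 < r & forall t, 0 < rnorm t < r -> forall i, 1 - expC (om i * t) != 0.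
Proof.
have [r r0 hr] := exp_neq1; pose L := 1 + \sum_(i < n) rnorm (om i).
have L0 : 0 < L by rewrite ltr_pwDl// sumr_ge0// => i _; exact: rnorm_ge0.
exists (r / L); first by rewrite divr_gt0.
move=> t /andP[t0]; rewrite ltr_pdivlMr// => tr i; rewrite subr_eq0 eq_sym; apply: hr.
rewrite rnormM mulr_gt0 ?rnorm_gt0//=; last by rewrite -rnorm_gt0.
apply: le_lt_trans tr; rewrite mulrC ler_wpM2l ?rnorm_ge0// /L (bigD1 i)//= addrCA lerDl addr_ge0//.
by rewrite sumr_ge0// => j _; exact: rnorm_ge0.
Qed.

Lemma barnes_coef_exists : exists c, gjet c (fun t => \prod_(i < n) (t / (1 - expC (om i * t)))).
Proof.
apply: gjet_prod => i; eexists.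
apply: gjet_ext (gjetZ (- (om i)^-1) (gjet_scale (gjet_bern R) (om0 i))) => [|t _]; first exact: ltr01.
rewrite -(opprB _ 1) invrN; move: ((expC _ - 1)^-1) => y.
by field.
Qed.

(** The two generating functions multiply to [t ^+ n] near the origin. *)
Lemma conv_taucoef c : gjet c (fun t => \prod_(i < n) (t / (1 - expC (om i * t)))) ->
  forall k, conv c taucoef k = (k == n)%:R.
Proof.
move=> hc; apply: gjet_uniq (gjetM hc gjet_taucoef) _.
have [r r0 hr] := exp_prod_neq0.
apply: gjet_ext r0 _ (gjet_Xn n) => t /hr ht.
rewrite -big_split /= (eq_bigr (fun=> t)) => [|i _]; last by rewrite mulfVK.
by rewrite prodr_const card_ord.
Qed.

End BarnesCoefficients.

(** * Continuation of the lattice sum *)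

Section BarnesContinuation.
Variables (R : realType) (theta : R) (n : nat) (a : R[i]) (om : 'I_n -> R[i]).
Local Notation C := R[i].
Local Notation full := (fun=> True).
Local Notation hp := (hp theta).
Local Notation powC := (powC theta).
Local Notation pow_deriv := (pow_deriv theta).
Local Notation sgnS := (sgnS R).
Local Notation shift := (shift om).
Local Notation diffop := (diffop om).
Hypotheses (n_gt0 : (0 < n)%N) (a_hp : 0 < hp a) (om_hp : forall i, 0 < hp (om i)).
Variable c : nat -> C.
Hypothesis hc : gjet c (fun t => \prod_(i < n) (t / (1 - expC (om i * t)))).
Implicit Types (s x z : C) (K M k j : nat) (m : {ffun 'I_n -> nat}) (S : {ffun 'I_n -> bool}) (g : C -> C).

Definition lattice_pt m : C := a + \sum_(i < n) om i * (m i)%:R.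

Lemma shift_hp S : 0 <= hp (shift S).
Proof. by rewrite hp_sum sumr_ge0// => i _; rewrite hpMn mulr_ge0// ltW. Qed.

Lemma lattice_pt_bounds : exists kap W : R, [/\ 0 < kap, 0 < W & forall m S (t : R), 0 <= t <= 1 ->
  [/\ 0 < hp (lattice_pt m + t%:C%C * shift S), kap * weight R m <= rnorm (lattice_pt m + t%:C%C * shift S) &
      rnorm (lattice_pt m + t%:C%C * shift S) <= W * weight R m]].
Proof.
(* The inverse of a sum of inverses is a positive lower bound for [hp a] and all [hp (om i)] at
   once. *)
pose q := (hp a)^-1 + \sum_(i < n) (hp (om i))^-1; pose W := rnorm a + \sum_(i < n) rnorm (om i).
have s0 (P : pred 'I_n) : 0 <= \sum_(i < n | P i) (hp (om i))^-1 by apply: sumr_ge0 => i _; rewrite invr_ge0 ltW.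
have q0 : 0 < q by rewrite ltr_wpDr// invr_gt0.
have ka : q^-1 <= hp a by rewrite -[leRHS]invrK lef_pV2 ?posrE ?invr_gt0// /q lerDl.
have ko i : q^-1 <= hp (om i).
  by rewrite -[leRHS]invrK lef_pV2 ?posrE ?invr_gt0// /q (bigD1 i)//= addrCA lerDl addr_ge0// invr_ge0 ltW.
have r0 : 0 <= \sum_(i < n) rnorm (om i) by apply: sumr_ge0 => i _; exact: rnorm_ge0.
exists q^-1, W; split; rewrite ?invr_gt0//.
  by rewrite ltr_wpDr// rnorm_gt0; apply: hp_neq0 a_hp.
move=> m S t /andP[t0 t1]; have ts := shift_hp S.
have H : q^-1 * weight R m <= hp (lattice_pt m + t%:C%C * shift S).
  rewrite hpD hp_real -[leLHS]addr0; apply: lerD; last exact: mulr_ge0.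
  rewrite /lattice_pt hpD hp_sum /weight mulrDr mulr1 natr_sum mulr_sumr; apply: lerD => //.
  by apply: ler_sum => i _; rewrite hpMn ler_wpM2r.
have w1 := weight_ge1 R m.
split; first by apply: lt_le_trans H; rewrite mulr_gt0 ?invr_gt0//; lra.
- exact: le_trans H (hp_le _ _).
apply: le_trans (ler_rnormD _ _) _; rewrite rnormM rnorm_real ger0_norm//.
have h1 : rnorm (lattice_pt m) <= rnorm a + \sum_(i < n) rnorm (om i) * (m i)%:R.
  apply: le_trans (ler_rnormD _ _) _; rewrite lerD2l; apply: le_trans (ler_rnorm_sum _ _ _) _.
  by apply: ler_sum => i _; rewrite rnormM rnorm_nat.
have h2 : t * rnorm (shift S) <= \sum_(i < n) rnorm (om i).
  apply: (@le_trans _ _ (rnorm (shift S))); first by rewrite ler_piMl ?rnorm_ge0.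
  apply: le_trans (ler_rnorm_sum _ _ _) _; apply: ler_sum => i _; rewrite rnormM rnorm_nat.
  by rewrite ler_piMr ?rnorm_ge0// lern1; case: (S i).
have h3 : \sum_(i < n) rnorm (om i) * (m i)%:R <= W * (\sum_(i < n) m i)%N%:R.
  rewrite natr_sum mulr_sumr; apply: ler_sum => i _; rewrite ler_wpM2r// /W (bigD1 i)//= addrCA lerDl.
  by rewrite addr_ge0 ?rnorm_ge0// sumr_ge0// => j _; exact: rnorm_ge0.
by rewrite /weight mulrDr mulr1 {1}/W; lra.
Qed.

(* The operator [D ^ (k - n)] applied to [x ^ (- s)] has poles at [s = 1, ..., n]; multiplying by
   [polar_factor s] turns it into [D ^ k] applied to [x ^ (n - s)]. *)
Definition polar_factor s : C := fallingC (n%:R - s) n.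
Definition ansatz K s x : C := \sum_(k < K) c k * pow_deriv (n%:R - s) k x.
Definition remainder K s x : C := diffop (ansatz K s) x - polar_factor s * powC x (- s).

Lemma conv_weight (d : nat -> C) (b : nat -> C) K :
  \sum_(l < K) conv c b l * d l = \sum_(k < K) \sum_(j < K - k) c k * b j * d (k + j)%N.
Proof.
elim: K => [|K IH]; first by rewrite !big_ord0.
rewrite [LHS]big_ord_recr [RHS]big_ord_recr /= IH subSn// subnn big_ord1 addn0.
have -> : \sum_(k < K) \sum_(j < K.+1 - k) c k * b j * d (k + j)%N =
  \sum_(k < K) (\sum_(j < K - k) c k * b j * d (k + j)%N + c k * b (K - k)%N * d K).
  apply: eq_bigr => k _; rewrite subSn 1?ltnW// big_ord_recr /=; congr (_ + _ * d _).
  by rewrite subnKC// ltnW.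
rewrite big_split /= -addrA; congr (_ + _).
by rewrite /conv big_ord_recr /= subnn mulrDl mulr_suml.
Qed.

Let om0 i : om i != 0. Proof. exact: hp_neq0 (om_hp i). Qed.

(** The [k]-th summand of the ansatz is expanded to order [K - k]. The Taylor polynomials then
    combine through the convolution of [c] with [taucoef], of which only the index [n] survives, and
    this is the subtracted power; only Taylor errors remain. *)
Lemma remainderE K s x : (n < K)%N -> remainder K s x =
  \sum_S sgnS S * \sum_(k < K) c k * (pow_deriv (n%:R - s) k (x + shift S) -
    \sum_(j < K - k) pow_deriv (n%:R - s) (k + j)%N x * (shift S ^+ j / j`!%:R)).
Proof.
move=> nK; rewrite /remainder /diffop.
have E : polar_factor s * powC x (- s) = \sum_S sgnS S * \sum_(k < K) c k *
    \sum_(j < K - k) pow_deriv (n%:R - s) (k + j)%N x * (shift S ^+ j / j`!%:R).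
  have -> : polar_factor s * powC x (- s) = pow_deriv (n%:R - s) n x.
    by rewrite /pow_deriv (_ : n%:R - s - n%:R = - s)//; ring.
  have := conv_weight (fun l => pow_deriv (n%:R - s) l x) (taucoef om) K.
  rewrite (bigD1 (Ordinal nK))//= (conv_taucoef om0 hc) eqxx mul1r big1 ?addr0 => [->|l ln]; last first.
    by rewrite (conv_taucoef om0 hc) -(inj_eq val_inj) /= in ln *; rewrite (negPf ln) mul0r.
  have -> : \sum_S sgnS S * \sum_(k < K) c k * \sum_(j < K - k) pow_deriv (n%:R - s) (k + j)%N x * (shift S ^+ j / j`!%:R)
    = \sum_S \sum_(k < K) sgnS S * (c k * \sum_(j < K - k) pow_deriv (n%:R - s) (k + j)%N x * (shift S ^+ j / j`!%:R)).
    by apply: eq_bigr => S _; rewrite mulr_sumr.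
  rewrite exchange_big /=; apply: eq_bigr => k _.
  have -> : \sum_S sgnS S * (c k * \sum_(j < K - k) pow_deriv (n%:R - s) (k + j)%N x * (shift S ^+ j / j`!%:R)) =
    \sum_S \sum_(j < K - k) sgnS S * (c k * (pow_deriv (n%:R - s) (k + j)%N x * (shift S ^+ j / j`!%:R))).
    by apply: eq_bigr => S _; rewrite !mulr_sumr.
  rewrite exchange_big /=; apply: eq_bigr => j _; rewrite /taucoef mulr_sumr mulr_suml.
  by apply: eq_bigr => S _; ring.
rewrite E -sumrB; apply: eq_bigr => S _; rewrite -mulrBr /ansatz -sumrB; congr (_ * _).
by apply: eq_bigr => k _; rewrite mulrBr.
Qed.

Lemma rnorm_sgnS S : rnorm (sgnS S) = 1.
Proof.
rewrite /sgnS rnorm_prod big1// => i _; case: (S i); rewrite ?expr1 ?expr0 ?rnorm1//.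
by rewrite rnormN rnorm1.
Qed.

Let taylor_const K : R := \sum_S \sum_(k < K) rnorm (c k) * rnorm (shift S) ^+ (K - k).

Lemma taylor_const_ge0 K : 0 <= taylor_const K.
Proof. by apply: sumr_ge0 => S _; apply: sumr_ge0 => k _; rewrite mulr_ge0 ?exprn_ge0 ?rnorm_ge0. Qed.

(** As the [k]-th summand is expanded to order [K - k], every Taylor error involves one and the same
    derivative, the [K]-th. *)
Lemma remainder_le K s m (M : R) : (n < K)%N ->
  (forall S (t : R), 0 <= t <= 1 -> rnorm (pow_deriv (n%:R - s) K (lattice_pt m + t%:C%C * shift S)) <= M) ->
  rnorm (remainder K s (lattice_pt m)) <= M * taylor_const K.
Proof.
move=> nK hM; have [kap [W [_ _ hl]]] := lattice_pt_bounds.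
rewrite remainderE//; apply: le_trans (ler_rnorm_sum _ _ _) _; rewrite /taylor_const mulr_sumr; apply: ler_sum => S _.
rewrite rnormM rnorm_sgnS mul1r; apply: le_trans (ler_rnorm_sum _ _ _) _; rewrite mulr_sumr.
apply: ler_sum => k _; rewrite rnormM mulrCA ler_wpM2l ?rnorm_ge0//.
apply: taylor_segment => [t j ht|t ht].
  by apply: has_cderiv_pow_deriv; case: (hl m S t ht).
by rewrite subnKC ?(ltnW (ltn_ord k))//; exact: hM.
Qed.

Lemma remainder_bound K (A : R) : (n < K)%N -> exists2 B : R, 0 <= B & forall s m, rnorm s <= A ->
  rnorm (remainder K s (lattice_pt m)) <= B * expR ((n%:R - K%:R - complex.Re s) * ln (weight R m)).
Proof.
move=> nK; have [kap [W [kap0 W0 hl]]] := lattice_pt_bounds.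
have [B0 B00 hB] := powC_le theta (A + n%:R + K%:R) kap0 W0.
have [A0|A0] := ltP A 0; first by exists 0 => // s m sA; have := rnorm_ge0 s; lra.
have q0 : 0 <= (A + n%:R + K%:R) ^+ K by rewrite exprn_ge0// !addr_ge0.
exists ((A + n%:R + K%:R) ^+ K * B0 * taylor_const K); first by rewrite !mulr_ge0 ?taylor_const_ge0.
move=> s m sA; rewrite mulrAC; apply: remainder_le => // S t ht; have [h1 h2 h3] := hl m S t ht.
rewrite /pow_deriv rnormM -mulrA; apply: ler_pM; rewrite ?rnorm_ge0//.
  apply: rnorm_fallingC; apply: le_trans (ler_rnormB _ _) _; rewrite rnorm_nat addrC; lra.
have -> : n%:R - K%:R - complex.Re s = complex.Re (n%:R - s - K%:R).
  by rewrite !Re_add !Re_opp -!(rmorph_nat (real_complex R)) /=; ring.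
apply: hB => //; first exact: weight_ge1.
apply: le_trans (ler_rnormB _ _) _; rewrite rnorm_nat lerD2r.
by apply: le_trans (ler_rnormB _ _) _; rewrite rnorm_nat addrC; lra.
Qed.

Lemma remainder_cdiff K m s : cdiff full (fun s => remainder K s (lattice_pt m)) s.
Proof.
have hs k : cdiff full (fun s => n%:R - s - k%:R) s.
  by apply: cdiffB; [apply: cdiffB; [exact: cdiff_cst|exact: cdiff_id]|exact: cdiff_cst].
have hs0 : cdiff full (fun s => n%:R - s) s by apply: cdiffB; [exact: cdiff_cst|exact: cdiff_id].
apply: cdiffB; last first.
  apply: cdiffM; first exact: cdiff_fallingC.
  have h : cdiff full (fun s => 0 - s) s by apply: cdiffB; [exact: cdiff_cst|exact: cdiff_id].
  apply: cdiff_powC; case: h => d hd; exists d.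
  by apply: (@has_cderiv_eq_near _ _ _ _ _ _ 1) hd => // [w _ _|]; rewrite sub0r.
apply: cdiff_sum => S _; apply: cdiffM; first exact: cdiff_cst.
apply: cdiff_sum => k _; apply: cdiffM; first exact: cdiff_cst.
by apply: cdiffM; [exact: cdiff_fallingC|exact: cdiff_powC].
Qed.

Lemma ansatz_cdiff K x s : cdiff full (fun s => ansatz K s x) s.
Proof.
have hs k : cdiff full (fun s => n%:R - s - k%:R) s.
  by apply: cdiffB; [apply: cdiffB; [exact: cdiff_cst|exact: cdiff_id]|exact: cdiff_cst].
have hs0 : cdiff full (fun s => n%:R - s) s by apply: cdiffB; [exact: cdiff_cst|exact: cdiff_id].
apply: cdiff_sum => k _; apply: cdiffM; first exact: cdiff_cst.
by apply: cdiffM; [exact: cdiff_fallingC|exact: cdiff_powC].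
Qed.

Definition barnes_cont K s : C := ansatz K s a - csum (fun m => remainder K s (lattice_pt m)).

(** The remainder decays like the weight to the power [n - K - Re s]; convergence over the lattice
    requires this to be below [- n]. The radius [r] is half the available margin, which makes the
    bound uniform near [s0]. *)
Lemma remainder_sum_bound K s0 : (n < K)%N -> 2 * n%:R - K%:R < complex.Re s0 -> exists r M : R, exists b,
  [/\ 0 < r, forall s m, rnorm (s - s0) <= r -> rnorm (remainder K s (lattice_pt m)) <= b m &
      forall A : {fset {ffun 'I_n -> nat}}, \sum_(m <- A) b m <= M].
Proof.
move=> nK hs; pose r := (complex.Re s0 - (2 * n%:R - K%:R)) / 2.
have r0 : 0 < r by rewrite divr_gt0// subr_gt0.
have [B B0 hB] := remainder_bound (rnorm s0 + r) nK.
pose rho := complex.Re s0 - r + K%:R - n%:R.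
have rn : n%:R < rho by rewrite /rho /r; lra.
have [M hM] := @lattice_sum_bound R n rho n_gt0 rn.
exists r, (B * M), (fun m => B * expR (- (rho * ln (weight R m)))); split=> // [s m sr|A]; last first.
  by rewrite -mulr_sumr ler_wpM2l.
have h1 : rnorm s <= rnorm s0 + r.
  have := ler_rnormD s0 (s - s0); rewrite (_ : s0 + (s - s0) = s); last by ring.
  by move=> h; apply: le_trans h _; rewrite lerD2l.
apply: le_trans (hB s m h1) _; rewrite ler_wpM2l// ler_expR -mulNr ler_wpM2r ?ln_ge0 ?weight_ge1//.
have := le_trans (ler_Re_rnorm (s - s0)) sr; rewrite Re_add Re_opp ler_norml => /andP[k1 k2].
by rewrite /rho; lra.
Qed.

Lemma remainder_has_csum K s : (n < K)%N -> 2 * n%:R - K%:R < complex.Re s ->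
  has_csum (fun m => remainder K s (lattice_pt m)) (csum (fun m => remainder K s (lattice_pt m))).
Proof.
move=> nK /(remainder_sum_bound nK)[r [M [b [r0 hb hM]]]].
have [|y hy] := @has_csum_abs _ _ (fun m => remainder K s (lattice_pt m)) M.
  move=> A; apply: le_trans (hM A); apply: ler_sum => m _; apply: hb.
  by rewrite subrr rnorm0 ltW.
by have [_ ->] := has_csum_csum hy.
Qed.

Lemma barnes_cont_cdiff K s : (n < K)%N -> 2 * n%:R - K%:R < complex.Re s -> cdiff full (barnes_cont K) s.
Proof.
move=> nK /(remainder_sum_bound nK)[r [M [b [r0 hb hM]]]].
apply: cdiffB; first exact: ansatz_cdiff.
apply: (csum_cdiff r0 _ _ hM) => m z zr; first exact: remainder_cdiff.
exact: hb.
Qed.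

(** Decay at all corners of the dilated box other than [a] itself, that is, at the boundary terms of
    the telescoping sum. *)
Definition vanishing g := forall d : R, 0 < d -> exists M0, forall M S, (M0 <= M)%N -> S != [ffun=> false] ->
  rnorm (g (a + M%:R * shift S)) <= d.

Lemma vanishing_pow (s : C) k : complex.Re (s - k%:R) < 0 -> vanishing (pow_deriv s k).
Proof.
move=> sk d d0; have [kap [W [kap0 W0 hl]]] := lattice_pt_bounds.
have [B B0 hB] := powC_le theta (rnorm (s - k%:R)) kap0 W0.
pose x := - complex.Re (s - k%:R); have x0 : 0 < x by rewrite oppr_gt0.
pose D := rnorm (fallingC s k) * B.
have D0 : 0 <= D by rewrite mulr_ge0 ?rnorm_ge0.
have D1 : 0 < D / d + 1 by rewrite ltr_wpDl// divr_ge0// ltW.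
exists (Num.bound (expR (ln (D / d + 1) / x))) => M S hM Sn.
(* The corner is itself a lattice point, so [lattice_pt_bounds] applies with the empty shift; its
   weight is at least [1 + M] because some [S i] holds. *)
pose m : {ffun 'I_n -> nat} := [ffun i => (M * S i)%N].
have mE : a + M%:R * shift S = lattice_pt m + 0%:C%C * shift [ffun=> false].
  rewrite mul0r addr0 /lattice_pt /shift mulr_sumr; congr (_ + _); apply: eq_bigr => i _.
  by rewrite ffunE natrM; ring.
have [|h1 h2 h3] := hl m [ffun=> false] 0; first by rewrite lexx ler01.
have [i Si] : exists i, S i.
  apply/existsP; apply: contraNT Sn; rewrite negb_exists => /forallP h.
  by apply/eqP/ffunP => i; rewrite ffunE; apply/negbTE.
have wM : 1 + M%:R <= weight R m.
  by rewrite /weight lerD2l ler_nat (bigD1 i)//= ffunE Si muln1 leq_addr.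
have W1 : expR (ln (D / d + 1) / x) <= weight R m.
  apply: le_trans (ltW (archi_boundP (expR_ge0 _))) _; apply: le_trans wM.
  by rewrite -[leLHS]add0r lerD// ler_nat.
have := hB _ (s - k%:R) _ h1 (weight_ge1 R m) h2 h3 (lexx _); rewrite mE /pow_deriv rnormM => h.
apply: (@le_trans _ _ (D * expR (- ln (D / d + 1)))); last first.
  by rewrite expRN lnK// ler_pdivrMr// mulrDr mulr1 mulrCA divff ?mulr1 ?lerDl ?(ltW d0)// lt0r_neq0.
rewrite /D -mulrA ler_wpM2l ?rnorm_ge0//; apply: le_trans h _; rewrite ler_wpM2l// ler_expR.
rewrite -[complex.Re _]opprK -/x mulNr lerN2 -ler_pdivrMl// mulrC -ler_expR lnK// posrE.
by apply: lt_le_trans (weight_ge1 R m).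
Qed.

Lemma vanishing_sum K (b : nat -> C) (g : nat -> C -> C) : (forall k, (k < K)%N -> vanishing (g k)) ->
  vanishing (fun x => \sum_(k < K) b k * g k x).
Proof.
elim: K => [|K IH] h d d0; first by exists 0%N => M S _ _; rewrite big_ord0 rnorm0 ltW.
have d2 : 0 < d / 2 by rewrite divr_gt0.
have b1 : 0 < rnorm (b K) + 1 by rewrite ltr_wpDl ?rnorm_ge0.
have [M1 h1] := IH (fun k hk => h k (ltnW hk)) _ d2.
have d3 : 0 < d / 2 / (rnorm (b K) + 1) by rewrite divr_gt0.
have [M2 h2] := h K (ltnSn K) _ d3.
exists (maxn M1 M2) => M S; rewrite geq_max => /andP[k1 k2] Sn; rewrite big_ord_recr /=.
apply: le_trans (ler_rnormD _ _) _.
have := h1 M S k1 Sn; have := h2 M S k2 Sn; rewrite rnormM ler_pdivlMr//.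
have := rnorm_ge0 (g K (a + M%:R * shift S)); nra.
Qed.

Lemma diffop_lattice_box M (g : C -> C) :
  \sum_(m <- box n M) diffop g (lattice_pt m) = \sum_S sgnS S * g (a + M%:R * shift S).
Proof.
rewrite big_box -diffop_box; apply: eq_bigr => m _; congr (diffop _ (_ + _)).
by apply: eq_bigr => i _; rewrite ffunE.
Qed.

(** Summed along boxes, the differences telescope to the corner values, and only the corner [a],
    with sign [+1], survives in the limit. *)
Lemma csum_diffop g y : vanishing g -> has_csum (fun m => diffop g (lattice_pt m)) y -> y = g a.
Proof.
move=> vg hy; apply/eqP; rewrite -subr_eq0 -rnorm_eq0; apply/eqP/le_anti; rewrite rnorm_ge0 andbT.
apply/ler_addgt0Pr => d d0; rewrite add0r.
have d2 : 0 < d / 2 by rewrite divr_gt0.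
pose T : R := #|{ffun 'I_n -> bool}|%:R.
have T0 : 0 < T + 1 by rewrite ltr_wpDl.
have d3 : 0 < d / 2 / (T + 1) by rewrite divr_gt0.
have [M1 h1] := has_csum_seq hy (box_exhaust (n:=n)) d2; have [M2 h2] := vg _ d3.
pose M := maxn M1 M2; have {}h1 := h1 M (leq_maxl _ _).
have -> : y - g a = (\sum_(m <- box n M) diffop g (lattice_pt m) - g a) - (\sum_(m <- box n M) diffop g (lattice_pt m) - y) by ring.
apply: le_trans (ler_rnormB _ _) _.
suff : rnorm (\sum_(m <- box n M) diffop g (lattice_pt m) - g a) <= d / 2 by lra.
rewrite diffop_lattice_box (bigD1 [ffun=> false])//=.
have -> : sgnS ([ffun=> false] : {ffun 'I_n -> bool}) = 1 by apply: big1 => i _; rewrite ffunE.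
have -> : shift [ffun=> false] = 0 by apply: big1 => i _; rewrite ffunE mulr0.
rewrite mulr0 addr0 mul1r addrAC subrr add0r; apply: le_trans (ler_rnorm_sum _ _ _) _.
apply: (@le_trans _ _ (\sum_(S : {ffun 'I_n -> bool}) d / 2 / (T + 1))).
  apply: (@le_trans _ _ (\sum_(S | S != [ffun=> false]) d / 2 / (T + 1))).
    by apply: ler_sum => S Sn; rewrite rnormM rnorm_sgnS mul1r; apply: h2 => //; exact: leq_maxr.
  by rewrite [leRHS](bigD1 [ffun=> false])//= lerDr ltW.
rewrite [leLHS](_ : _ = d / 2 / (T + 1) * T); last by rewrite sumr_const -[LHS]mulr_natr.
by rewrite mulrAC ler_pdivrMr//; apply: ler_wpM2l; [exact: ltW|rewrite lerDl].
Qed.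

(** Raising the order adds one vanishing term [g] to the ansatz and [diffop g] to the remainder; by
    [csum_diffop] both contribute [g a]. *)
Lemma barnes_contS K s : (n < K)%N -> 2 * n%:R - K%:R < complex.Re s -> barnes_cont K.+1 s = barnes_cont K s.
Proof.
move=> nK hs; have nK1 : (n < K.+1)%N := ltnW nK.
have hs1 : 2 * n%:R - K.+1%:R < complex.Re s.
  by apply: le_lt_trans hs; rewrite lerD2l lerN2 ler_nat.
have H := has_csumB (remainder_has_csum nK1 hs1) (remainder_has_csum nK hs).
pose g x := c K * pow_deriv (n%:R - s) K x.
have gE x : ansatz K.+1 s x = ansatz K s x + g x by rewrite /ansatz big_ord_recr.
have vg : vanishing g.
  have v : vanishing (pow_deriv (n%:R - s) K).
    apply: vanishing_pow; rewrite !Re_add !Re_opp -!(rmorph_nat (real_complex R)) /=.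
    have : n%:R >= 0 :> R by []; lra.
  move=> d d0; have [M0 h] := @vanishing_sum 1 (fun=> c K) (fun=> pow_deriv (n%:R - s) K) (fun _ _ => v) d d0.
  by exists M0 => M S hM hS; have := h M S hM hS; rewrite big_ord_recr big_ord0 /= add0r.
have {}H : has_csum (fun m => diffop g (lattice_pt m))
   (csum (fun m => remainder K.+1 s (lattice_pt m)) - csum (fun m => remainder K s (lattice_pt m))).
  apply: eq_has_csum H => m; rewrite /remainder opprB addrA subrK /diffop -sumrB; apply: eq_bigr => S _.
  by rewrite gE; ring.
rewrite /barnes_cont gE -(csum_diffop vg H); ring.
Qed.

(** For [Re s > n] all powers in the ansatz decay, so the lattice sum of its differences is its
    value at [a]. *)
Lemma barnes_series_eq K s : (n < K)%N -> 2 * n%:R - K%:R < complex.Re s -> n%:R < complex.Re s ->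
  barnes_cont K s = polar_factor s * barnes_series theta a om s.
Proof.
move=> nK hs sn; have [kap [W [kap0 W0 hl]]] := lattice_pt_bounds.
have [B B0 hB] := powC_le theta (rnorm (- s)) kap0 W0.
have [M hM] := @lattice_sum_bound R n _ n_gt0 sn.
have [|y hy] := @has_csum_abs _ _ (fun m => powC (lattice_pt m) (- s)) (B * M).
  move=> A; apply: le_trans (ler_wpM2l B0 (hM A)); rewrite mulr_sumr; apply: ler_sum => m _.
  have [|h1 h2 h3] := hl m [ffun=> false] 0; first by rewrite lexx ler01.
  rewrite mul0r addr0 in h1 h2 h3.
  by have := hB _ (- s) _ h1 (weight_ge1 R m) h2 h3 (lexx _); rewrite Re_opp mulNr.
have -> : barnes_series theta a om s = y by have [_ <-] := has_csum_csum hy.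
have H := has_csumD (remainder_has_csum nK hs) (has_csumZ (polar_factor s) hy).
have va : vanishing (ansatz K s).
  apply: (vanishing_sum c) => k _; apply: vanishing_pow.
  rewrite !Re_add !Re_opp -!(rmorph_nat (real_complex R)) /=.
  have : k%:R >= 0 :> R by []; lra.
have {}H : has_csum (fun m => diffop (ansatz K s) (lattice_pt m))
    (csum (fun m => remainder K s (lattice_pt m)) + polar_factor s * y).
  by apply: eq_has_csum H => m; rewrite /remainder subrK.
by rewrite /barnes_cont -(csum_diffop va H); ring.
Qed.

Lemma barnes_cont_indep K K' s : (n < K)%N -> 2 * n%:R - K%:R < complex.Re s ->
  (n < K')%N -> 2 * n%:R - K'%:R < complex.Re s -> barnes_cont K s = barnes_cont K' s.
Proof.
have key d K0 : (n < K0)%N -> 2 * n%:R - K0%:R < complex.Re s -> barnes_cont (d + K0) s = barnes_cont K0 s.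
  move=> h1 h2; elim: d => [//|d IH]; rewrite addSn barnes_contS//; first exact: ltn_addl.
  by apply: le_lt_trans h2; rewrite lerD2l lerN2 ler_nat leq_addl.
move=> h1 h2 h3 h4; have [KK|KK] := leqP K K'; first by rewrite -(subnK KK) key.
by rewrite -(subnK (ltnW KK)) key.
Qed.

Definition order_at s : nat := (n + Num.bound `|2 * n%:R - complex.Re s|).+1.

Lemma order_atP s : (n < order_at s)%N /\ 2 * n%:R - (order_at s)%:R < complex.Re s.
Proof.
split; first by rewrite /order_at ltnS leq_addr.
have h := archi_boundP (normr_ge0 (2 * n%:R - complex.Re s)).
have : (Num.bound `|2 * n%:R - complex.Re s|)%:R <= (order_at s)%:R :> R by rewrite ler_nat ltnW// ltnS leq_addl.
by have := ler_norm (2 * n%:R - complex.Re s); lra.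
Qed.

(** Each [s] requires a sufficiently large order; independence of the order glues the functions
    [barnes_cont K] into one entire function, the series multiplied by [polar_factor]. *)
Definition barnes_entire s := barnes_cont (order_at s) s.

Lemma barnes_entireE K s : (n < K)%N -> 2 * n%:R - K%:R < complex.Re s -> barnes_entire s = barnes_cont K s.
Proof. by have [h1 h2] := order_atP s; exact: barnes_cont_indep. Qed.

Lemma barnes_entire_cdiff s : cdiff full barnes_entire s.
Proof.
have [h1 h2] := order_atP s; set K := order_at s in h1 h2.
have [d hd] := barnes_cont_cdiff h1 h2; exists d.
have r0 : 0 < complex.Re s - (2 * n%:R - K%:R) by rewrite subr_gt0.
apply: (@has_cderiv_eq_near _ _ _ _ _ _ _ r0) hd => // w _ wr.
apply/esym/barnes_entireE => //.
have := le_lt_trans (ler_Re_rnorm (w - s)) wr; rewrite Re_add Re_opp ltr_norml => /andP[k1 k2].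
by lra.
Qed.

Lemma barnes_entire_series s : n%:R < complex.Re s -> barnes_entire s = polar_factor s * barnes_series theta a om s.
Proof. by have [h1 h2] := order_atP s; exact: barnes_series_eq. Qed.

(** At [s = - N] the power [x ^ (n - s)] is the polynomial [x ^ (n + N)]: its derivatives of high
    order vanish, and with them all remainders; the ansatz becomes a finite convolution. *)
Lemma barnes_entire_negn (N : nat) :
  barnes_entire (- N%:R) = (n + N)`!%:R * conv c (fun j => a ^+ j / j`!%:R) (n + N)%N.
Proof.
(* Large enough both for convergence at [- N], which needs [2 * n - K < - N], and for the [K]-th
   derivative of [x ^ (n + N)] to vanish. *)
pose K := (2 * n + N).+1.
have nK : (n < K)%N by rewrite /K; lia.
have nNK : (n + N < K)%N by rewrite /K; lia.
have hs : 2 * n%:R - K%:R < complex.Re (- N%:R : C).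
  rewrite Re_opp -!(rmorph_nat (real_complex R)) /=; rewrite ltrBlDr -ltrBlDl opprK -natrM -natrD ltr_nat /K; lia.
rewrite (barnes_entireE nK hs) /barnes_cont.
have E : n%:R - - N%:R = (n + N)%:R :> C by rewrite opprK natrD.
have r0 m : remainder K (- N%:R) (lattice_pt m) = 0.
  apply/eqP; rewrite -rnorm_eq0; apply/eqP/le_anti; rewrite rnorm_ge0 andbT -(mul0r (taylor_const K)).
  apply: remainder_le => // S t ht; rewrite E /pow_deriv fallingC_nat//.
  by rewrite mul0r rnorm0.
have -> : csum (fun m => remainder K (- N%:R) (lattice_pt m)) = 0.
  have h : has_csum (fun m => remainder K (- N%:R) (lattice_pt m)) 0.
    by move=> d d0; exists fset0 => A _; rewrite big1 ?subr0 ?rnorm0.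
  by have [] := has_csum_csum h.
rewrite subr0 /ansatz E.
have -> : K = ((n + N).+1 + n)%N by rewrite /K; lia.
rewrite big_split_ord /= [X in _ + X]big1 ?addr0 => [|k _]; last first.
  by rewrite /pow_deriv fallingC_nat ?mul0r ?mulr0//; lia.
rewrite /conv mulr_sumr; apply: eq_bigr => k _.
have kN : (k <= n + N)%N by rewrite -ltnS.
rewrite /pow_deriv -natrB// powC_nat// -(fallingC_fact R kN).
by field; rewrite pnatr_eq0 -lt0n fact_gt0.
Qed.

Lemma polar_factor_negn (N : nat) : polar_factor (- N%:R) * N`!%:R = (n + N)`!%:R.
Proof.
rewrite /polar_factor opprK -natrD -(fallingC_fact R (leq_addr N n)); congr (_ * _`!%:R).
by rewrite addKn.
Qed.

End BarnesContinuation.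

(** * Division of an entire function by distinct linear factors *)

Section SimplePoles.
Variable R : realType.
Local Notation C := R[i].
Local Notation full := (fun=> True).
Implicit Types (h k : C -> C) (z w : C).

(** The expansion [k = a1 * u + a2 * u ^+ 2 + O(u ^ 3)] shows that [k / u], completed by [a1], has
    derivative [a2] at [u = 0]. *)
Lemma removable_quotient k z (r : R) : 0 < r -> (forall w, rnorm (w - z) < r -> cdiff full k w) -> k z = 0 ->
  exists l, cdiff full (fun w => if w == z then l else k w / (w - z)) z.
Proof.
move=> r0 kd kz; pose g u := k (z + u).
have r20 : 0 < r / 2 by rewrite divr_gt0.
have gd u : rnorm u <= r / 2 -> cdiff full g u.
  move=> ur; have [|d hd] := kd (z + u); first by rewrite addrC addKr; lra.
  exists (d * (0 + 1)); apply: (@has_cderiv_comp _ full full (fun w => z + w)) => //.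
  exact: has_cderivD (has_cderiv_cst _ _ _) (has_cderiv_id _ _).
have [|M hM] := @circle_bounded _ g (r / 2) r20.
  by move=> w wr; apply/cdiff_ccont/gd; rewrite wr.
have T := taylor3 r20 gd hM; rewrite (tcoef0 r20 gd) in T.
have g0 : g 0 = 0 by rewrite /g addr0.
rewrite g0 in T; set a1 := tcoef g (r / 2) 1 in T; set a2 := tcoef g (r / 2) 2 in T.
exists a1, a2 => d d0; pose K := 4 * `|M| / (r / 2) ^+ 3.
have K0 : 0 <= K by apply: divr_ge0; [apply: mulr_ge0|apply: exprn_ge0; exact: ltW].
have K1 : 0 < K + 1 by rewrite ltr_wpDl.
exists (Num.min (r / 2 / 2) (d / (K + 1))); first by rewrite lt_min !divr_gt0.
move=> w _; rewrite lt_min eqxx => /andP[w1]; rewrite ltr_pdivlMr// => w2.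
have [->|wz] := eqVneq w z; first by rewrite !subrr mulr0 subr0 rnorm0 mulr0.
have u0 : 0 < rnorm (w - z) by rewrite rnorm_gt0 subr_eq0.
have := T (w - z) (ltW w1); rewrite /g (addrC z) subrK subr0.
set u := w - z in u0 w1 w2 *; set y := k w - a1 * u - a2 * u ^+ 2.
have un : u != 0 by rewrite -rnorm_gt0.
move=> h; have -> : k w / u - a1 - a2 * u = y / u by rewrite /y; field.
rewrite rnormM rnormV ler_pdivrMr//; apply: le_trans h _.
apply: (@le_trans _ _ (K * rnorm u ^+ 3)).
  have -> : K * rnorm u ^+ 3 = 4 * `|M| * (rnorm u / (r / 2)) ^+ 3 by rewrite expr_div_n /K; ring.
  rewrite ler_wpM2r ?ler_wpM2l ?ler_norm// exprn_ge0// divr_ge0 ?rnorm_ge0// ltW//.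
have : K * rnorm u <= d.
  have : rnorm u * (K + 1) = K * rnorm u + rnorm u by ring.
  by move=> e1; rewrite e1 in w2; lra.
move=> h2; have -> : K * rnorm u ^+ 3 = K * rnorm u * (rnorm u * rnorm u) by ring.
by rewrite -[leRHS]mulrA; apply: ler_wpM2r => //; rewrite mulr_ge0// ltW.
Qed.

(** Distinct [b i] make all zeros of the divisor simple. Since [meromorphic] excludes removable
    singularities, the value must be patched wherever [h] vanishes together with the divisor. *)
Lemma meromorphic_quotient (n : nat) (b : 'I_n -> C) h : injective b -> (forall z, cdiff full h z) ->
  exists2 F, meromorphic F & forall z, \prod_(i < n) (b i - z) != 0 -> F z = h z / \prod_(i < n) (b i - z).
Proof.
move=> binj hd; pose q z := \prod_(i < n) (b i - z).
have cd (i : 'I_n) z : cdiff full (fun w => b i - w) z by apply: cdiffB; [exact: cdiff_cst|exact: cdiff_id].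
have qd z : cdiff full q z by apply: cdiff_prod => i _.
pose patch z l w := if w == z then l else h w / q w.
pose F z := if q z == 0 then xget 0 [set l | cdiff full (patch z l) z] else h z / q z.
have FE z : q z != 0 -> F z = h z / q z by rewrite /F => /negPf ->.
exists F => //; apply/meromorphicP => z.
have Fd w : q w != 0 -> cdiff full F w.
  move=> qw; have [d hdq] := cdiffM (hd w) (cdiffV (qd w) qw); exists d.
  have [r r0 hr] := near_nonzero (cdiff_ccont (qd w)) qw.
  by apply: (@has_cderiv_eq_near _ _ _ _ _ _ r) hdq => // [u _ /hr qu|]; rewrite FE.
have [qz|qz] := eqVneq (q z) 0; last first.
  have [r r0 hr] := near_nonzero (cdiff_ccont (qd z)) qz.
  by exists r => //; split; [move=> w /andP[_ wr]; apply/Fd/hr|left; exact: Fd].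
have [i bi] : exists i, b i = z.
  move/eqP: qz => /prodf_eq0[i _]; rewrite subr_eq0 => /eqP bz.
  by exists i.
pose rest w := \prod_(j < n | j != i) (b j - w).
have qE w : q w = (z - w) * rest w by rewrite /q (bigD1 i)//= bi.
have rz : rest z != 0.
  by apply/prodf_neq0 => j ji; rewrite subr_eq0 -bi (inj_eq binj).
have rd w : cdiff full rest w.
  have [d hd'] : cdiff full (fun w => \prod_(j <- [seq j <- index_enum 'I_n | j != i]) (b j - w)) w.
    by apply: cdiff_prod => j _.
  by exists d; apply: (@has_cderiv_eq_near _ _ _ _ _ _ 1) hd' => // [u _ _|]; rewrite big_filter.
have [r r0 hr] := near_nonzero (cdiff_ccont (rd z)) rz.
have qw w : 0 < rnorm (w - z) < r -> q w != 0.
  move=> /andP[w0 wr]; rewrite qE mulf_neq0 ?hr// subr_eq0 eq_sym -subr_eq0.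
  by rewrite -rnorm_gt0.
exists r => //; split; first by move=> w hw; apply/Fd/qw.
pose k w := - (h w / rest w).
have kd w : rnorm (w - z) < r -> cdiff full k w.
  move=> wr; have h1 : cdiff full (fun=> -1) w by exact: cdiff_cst.
  have [d hdk] := cdiffM h1 (cdiffM (hd w) (cdiffV (rd w) (hr _ wr))); exists d.
  by apply: (@has_cderiv_eq_near _ _ _ _ _ _ 1) hdk => // [u _ _|]; rewrite mulN1r.
have kE w : 0 < rnorm (w - z) < r -> h w / q w = k w / (w - z).
  move=> hw; have wz : w - z != 0 by rewrite -rnorm_gt0; case/andP: hw.
  have := qw w hw; rewrite qE mulf_eq0 negb_or => /andP[h1 h2].
  by rewrite /k; field; rewrite wz h1 h2.
(* [k] is the quotient without its vanishing factor: it decides between a removable point and a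
   genuine pole. *)
have [kz|kz] := eqVneq (k z) 0.
  left; have [l hl] := removable_quotient r0 kd kz.
  have P : cdiff full (patch z (F z)) z.
    rewrite /F qz eqxx; apply: (@xgetPex _ 0 [set l | cdiff full (patch z l) z]).
    exists l; case: hl => d hd'; exists d.
    apply: (@has_cderiv_eq_near _ _ _ _ _ _ r) hd' => // [w _ wr|]; rewrite /patch ?eqxx//.
    by case: eqVneq => // wz; rewrite kE// rnorm_gt0 subr_eq0 wz.
  case: P => d hd'; exists d; apply: (@has_cderiv_eq_near _ _ _ _ _ _ r) hd' => // [w _ wr|]; rewrite /patch ?eqxx//.
  by case: eqVneq => [->//|wz]; rewrite FE// qw// rnorm_gt0 subr_eq0 wz.
right=> M; have kz0 : 0 < rnorm (k z) / 2 by rewrite divr_gt0// rnorm_gt0.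
have [|r1 r10 hr1] := cdiff_ccont (kd z _) kz0; first by rewrite subrr rnorm0.
have M1 : 0 < `|M| + 1 by rewrite ltr_wpDl.
exists (Num.min (Num.min r r1) (rnorm (k z) / 2 / (`|M| + 1))); first by rewrite !lt_min r0 r10 divr_gt0.
move=> w /andP[w0]; rewrite !lt_min => /andP[/andP[wr wr1]]; rewrite ltr_pdivlMr// => w2.
rewrite FE ?qw ?w0// kE ?w0// rnormM rnormV ltr_pdivlMr//.
have := hr1 w I wr1; have := lerB_rnorm (k z) (k z - k w).
have -> : k z - (k z - k w) = k w by ring.
rewrite (rnormBC (k z)) => h1 h2.
apply: (@le_lt_trans _ _ (rnorm (w - z) * (`|M| + 1))); last by lra.
rewrite mulrC ler_wpM2l ?rnorm_ge0//; have := ler_norm M; lra.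
Qed.

End SimplePoles.

Section BarnesValue.
Variables (R : realType) (theta : R) (n : nat) (a : R[i]) (om : 'I_n -> R[i]).
Hypotheses (n_gt0 : (0 < n)%N) (a_hp : 0 < hp theta a) (om_hp : forall i, 0 < hp theta (om i)).

(** The quotient [F] of [barnes_entire] by [polar_factor] proves that a continuation exists, so that
    [barnes_zeta] is not the default; at the regular point [- N] uniqueness carries the value of [F]
    over to it. *)
Lemma barnes_zeta_negn (c : nat -> R[i]) (N : nat) :
  gjet c (fun t => \prod_(i < n) (t / (1 - expC (om i * t)))) ->
  barnes_zeta theta a om (- N%:R) = N`!%:R * conv c (fun j => a ^+ j / j`!%:R) (n + N)%N.
Proof.
(* The numbers [b i = n - i] run through [1, ..., n], the zeros of [polar_factor]. *)
move=> hc; pose b (i : 'I_n) : R[i] := (n - i)%N%:R.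
have binj : injective b.
  move=> i j /eqP; rewrite /b eqr_nat => /eqP h; apply: val_inj => /=.
  by have := ltn_ord i; have := ltn_ord j; lia.
have bE z : \prod_(i < n) (b i - z) = polar_factor n z.
  by apply: eq_bigr => i _; rewrite /b natrB 1?ltnW//; ring.
have [F Fm hF] := meromorphic_quotient binj (barnes_entire_cdiff n_gt0 a_hp om_hp hc).
have pE := polar_factor_negn R n N.
have p0 : polar_factor n (- N%:R : R[i]) != 0.
  by apply: contra_eq_neq pE => ->; rewrite mul0r eq_sym pnatr_eq0 -lt0n fact_gt0.
have Fs s : n%:R < complex.Re s -> F s = barnes_series theta a om s.
  move=> sn; have ps : polar_factor n s != 0.
    rewrite -bE; apply/prodf_neq0 => i _; rewrite subr_eq0; apply: contraTneq sn => <-.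
    by rewrite /b -(rmorph_nat (real_complex R)) /= -leNgt ler_nat leq_subr.
  by rewrite hF bE// (barnes_entire_series n_gt0 a_hp om_hp hc sn) mulrC mulKf.
have [Zm Zs] : barnes_continuation theta a om (barnes_zeta theta a om).
  by apply: (@xgetPex _ (fun=> 0) [set f | barnes_continuation theta a om f]); exists F.
have sE : - N%:R = (- N%:R : R)%:C%C :> R[i] by rewrite rmorphN rmorph_nat.
have cdF : cdiff (fun=> True) F (- N%:R).
  have pd : cdiff (fun=> True) (fun z => \prod_(i < n) (b i - z)) (- N%:R).
    by apply: cdiff_prod => i _; apply: cdiffB; [exact: cdiff_cst|exact: cdiff_id].
  have p0' : \prod_(i < n) (b i - - N%:R) != 0 by rewrite bE.
  have [d hd] := cdiffM (barnes_entire_cdiff n_gt0 a_hp om_hp hc (- N%:R)) (cdiffV pd p0').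
  have [r r0 hr] := near_nonzero (cdiff_ccont pd) p0'.
  exists d; apply: (@has_cderiv_eq_near _ _ _ _ _ _ r) hd => // [w _ /hr ?|]; by rewrite hF.
have -> : barnes_zeta theta a om (- N%:R) = F (- N%:R).
  rewrite sE; apply: (@meromorphic_unique R F _ n%:R) => //; last by rewrite -sE.
  by move=> w hw; rewrite Fs// Zs.
rewrite hF bE// barnes_entire_negn// -pE; field.
exact: p0.
Qed.

End BarnesValue.

(** * The Barnes zeta-function with periods 1, eta, ..., eta^(n-1) *)

Section EtaBarnes.
Variables (R : realType) (n : nat).
Hypothesis n1 : (1 < n)%N.
Local Notation C := R[i].
Local Notation e := (eta_root n : C).
Local Notation theta := (pi / 2 - pi / (2 * n%:R) : R).
Implicit Types (t : C) (K P N : nat) (Q : {poly C}).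

Let n0 : (0 : R) < n%:R. Proof. by rewrite ltr0n ltnW. Qed.

Lemma hp_eta (j : nat) : (j < n)%N -> 0 < hp theta (e ^+ j).
Proof.
move=> jn; have p0 := pi_gt0 R; rewrite eta_polar// expCE /hp /= expR0 !mul1r -cosB.
have -> : pi * j%:R / n%:R - theta = pi * (2 * j%:R + 1) / (2 * n%:R) - pi / 2.
  by field; exact: lt0r_neq0.
rewrite cosBpihalf sin_gt0_pi//; apply/andP; split.
  by rewrite divr_gt0 ?mulr_gt0// ltr_wpDl// mulr_ge0.
rewrite ltr_pdivrMr ?mulr_gt0// ltr_pM2l//.
have : (2 * j + 1 < 2 * n)%N by lia.
by rewrite -(ltr_nat R) natrD !natrM.
Qed.

Lemma half_sum_eta : 1 / (1 - e) = 2^-1 * \sum_(j < n) e ^+ j.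
Proof.
have h : (1 - e) * \sum_(j < n) e ^+ j = 2.
  by rewrite -opprB mulNr -subrX1 eta_n// opprB opprK.
have e1 : 1 - e != 0 by apply: contra_eq_neq h => ->; rewrite mul0r eq_sym pnatr_eq0.
by apply: (mulfI e1); rewrite [RHS]mulrCA h mul1r divff// mulVf ?pnatr_eq0.
Qed.

Lemma hp_half_sum : 0 < hp theta (1 / (1 - e)).
Proof.
rewrite half_sum_eta (_ : 2^-1 = (2^-1 : R)%:C%C); last by rewrite fmorphV rmorph_nat.
rewrite hp_real mulr_gt0 ?invr_gt0// hp_sum (bigD1 (Ordinal (ltnW n1)))//=.
by rewrite ltr_wpDr ?hp_eta ?(ltnW n1)// sumr_ge0// => j _; rewrite ltW// hp_eta.
Qed.

Lemma jet_eval K (f : C -> C) Q Q' : (forall t, Q.[t] = Q'.[t]) -> jet K f Q -> jet K f Q'.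
Proof. by move=> h [M [r [r0 hM]]]; exists M, r; split=> // t; rewrite -h; exact: hM. Qed.

Lemma jet_scale_coef K (f : C -> C) Q (c : C) : c != 0 -> jet K f Q ->
  jet K (fun t => f (c * t)) (\poly_(k < K) (Q`_k * c ^+ k)).
Proof.
move=> c0 /jet_trunc/(jet_scale c0); apply: jet_eval => t.
rewrite horner_comp hornerZ hornerX !horner_poly; apply: eq_bigr => k _.
by rewrite exprMn mulrA.
Qed.

(** The point [1 / (1 - e)] is half the sum of the periods, so [expC (a * t)] splits into one factor
    for each period. With [u = e ^+ i * t / 2], each factor becomes [t * expC u / (1 - expC (u + u))
    = - (e ^+ i)^-1 * (u / sinhC u)], whence the sign and [eta_const]; the powers of [2] cancel
    against those in [sinh_poly_coef]. *)
Lemma barnes_value_coef (c : nat -> C) P :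
  gjet c (fun t => \prod_(i < n) (t / (1 - expC (e ^+ i * t)))) ->
  conv c (fun j => (1 / (1 - e)) ^+ j / j`!%:R) (2 * P)%N = (-1) ^+ n * eta_const R n * bern_sum R n P.
Proof.
move=> hc; have J1 := gjet_jet (2 * P).+1 (gjetM hc (gjet_expC (1 / (1 - e)))).
have h0 : 2^-1 != 0 :> C by rewrite invr_eq0 pnatr_eq0.
have J2 := jetM (jet_poly (2 * P).+1 ((-1) ^+ n * eta_const R n)%:P)
                (jet_scale_coef h0 (jet_sinh_prod R n P)).
have E t : ((-1) ^+ n * eta_const R n)%:P.[t] * sinh_prod n (2^-1 * t) =
   \prod_(i < n) (t / (1 - expC (e ^+ i * t))) * expC (1 / (1 - e) * t).
  have -> : expC (1 / (1 - e) * t) = \prod_(i < n) expC (e ^+ i * (2^-1 * t)).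
    rewrite half_sum_eta mulrAC (mulrC (_ * t)) mulr_suml.
    by apply: (big_rec2 (fun y u => expC y = u)) => [|i y u _ <-]; rewrite ?expC0 ?expCD.
  rewrite hornerC /sinh_prod /eta_const -[X in (-1) ^+ X](card_ord n) -prodr_const -prodfV -!big_split /=.
  apply: eq_bigr => i _; have ei : e ^+ i != 0 by rewrite expf_neq0// eta_neq0.
  set u := e ^+ i * (2^-1 * t).
  have -> : e ^+ i * t = u + u by rewrite /u; field.
  rewrite expCD; have E0 := expC_neq0 u; rewrite /sinhC expCN; set x := expC u in E0 *; clearbody x.
  have -> : 1 - x * x = - (x * (x - x^-1)) by field.
  rewrite invrN !invfM invrK; move: ((x - x^-1)^-1) => y; rewrite /u.
  by field; rewrite ei E0.
have J3 := jet_ext (ltr01 : (0 : R) < 1) (fun t _ => E t) J2.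
have := jet_uniq J1 J3 (ltnSn (2 * P)); rewrite coef_poly ltnSn => ->.
rewrite coefCM coef_poly ltnSn sinh_poly_coef//; congr (_ * _).
by rewrite mulrAC exprVn divff ?mul1r// expf_neq0// pnatr_eq0.
Qed.

Lemma eta_barnes_zeta P : (n <= 2 * P)%N ->
  barnes_zeta theta (1 / (1 - e)) (fun j : 'I_n => e ^+ j) (- (2 * P - n)%N%:R) =
  (2 * P - n)`!%:R * ((-1) ^+ n * eta_const R n * bern_sum R n P).
Proof.
move=> nP; have om0 (i : 'I_n) : e ^+ i != 0 by rewrite expf_neq0// eta_neq0.
have [c hc] := barnes_coef_exists om0.
rewrite (barnes_zeta_negn (ltnW n1) hp_half_sum _ _ hc) => [|i]; last exact: hp_eta.
by rewrite subnKC// barnes_value_coef.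
Qed.

End EtaBarnes.

Theorem corollary6p2 (R : realType) (p : int) (n : nat) (hn : (2 <= n)%N) :
  let e : R[i] := eta_root n in
  let twopii : R[i] := 2%:R * (pi : R)%:C%C * 'i%C in
  let term (m : {m : int | m != 0}) : R[i] :=
    (-1) ^ (val m) /
    ((\prod_(1 <= j < n)
        sinhC ((val m)%:~R * (pi : R)%:C%C * 'i%C * e ^+ j)) *
     (val m)%:~R ^ (2%:Z * p + 1 - n%:Z)) in
  let lhs : R[i] := Zcal n (2%:Z * p + 1) * csum term in
  let rhs : R[i] :=
    - (2%:R ^+ n.-1 * twopii ^ (2%:Z * p + 1 - n%:Z) /
       e ^+ (n * n.-1 %/ 2)%N) *
    \sum_(m : {ffun 'I_n -> 'I_(absz p).+1} | (\sum_(i < n) (m i)%:Z) == p)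
      \prod_(i < n)
        ((bernoulli_poly (2 * m i)%N).[2%:R^-1] / ((2 * m i)%N`!)%:R *
         e ^+ (2 * i * m i)%N) in
  let zeta_side : R[i] :=
    twopii ^ (2%:Z * p + 1 - n%:Z) * (-1) ^ (1 - n%:Z) * 2%:R ^+ n.-1 /
      ((absz (2%:Z * p - n%:Z)%R)`!)%:R *
    barnes_zeta (pi / 2 - pi / (2 * n%:R)) (1 / (1 - e))
      (fun j : 'I_n => e ^+ j) (n%:R - 2%:R * p%:~R) in
  [/\ csummable term,
      lhs = rhs &
      (n%:R / 2%:R <= p%:~R :> rat) -> lhs = zeta_side /\ rhs = zeta_side].
Proof.
move=> e twopii term lhs rhs zeta_side.
have termE : term = fun m : {m : int | m != 0} => sinh_term R n p (val m).
  by apply: funext.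
have sumE : \sum_(m : {ffun 'I_n -> 'I_(absz p).+1} | (\sum_(i < n) (m i)%:Z) == p)
      \prod_(i < n) ((bernoulli_poly (2 * m i)%N).[2%:R^-1] / ((2 * m i)%N`!)%:R * e ^+ (2 * i * m i)%N) =
    if p is Posz P then bern_sum R n P else 0.
  have S (m : {ffun 'I_n -> 'I_(absz p).+1}) : \sum_(i < n) (m i)%:Z = (\sum_(i < n) m i)%N%:Z.
    by rewrite (big_morph Posz PoszD (erefl _)).
  case: (p) S => P S; first by apply: eq_bigl => m; rewrite S.
  (* For negative [p] no tuple of natural numbers has sum [p], and the sum is empty. *)
  by apply: big_pred0 => m; rewrite S.
have rhsE : rhs = - (2 ^+ n.-1 * twopii ^ (2 * p + 1 - n%:Z) / e ^+ (n * n.-1 %/ 2)) *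
    (if p is Posz P then bern_sum R n P else 0) by rewrite /rhs sumE.
have lr : lhs = rhs by rewrite rhsE /lhs termE cotangent_sum.
split=> //; first by rewrite termE; exact: sinh_term_csummable.
move=> np; suff rz : rhs = zeta_side by rewrite lr.
(* The rational inequality forces [p] to be a natural number and makes the truncated subtraction
   [2 * P - n] exact. *)
have [P pE nP] : exists2 P : nat, p = P%:Z & (n <= 2 * P)%N.
  move: np; rewrite ler_pdivrMr//; case: (p) => P.
    by rewrite -pmulrn -natrM ler_nat mulnC => h; exists P.
  rewrite NegzE mulrNz mulNr => h; exfalso; move: h; apply/negP; rewrite -ltNge.
  by apply: (@lt_le_trans _ _ 0); rewrite ?ler0n// oppr_lt0 mulr_gt0// ltr0z.
rewrite rhsE /zeta_side.
have -> : n%:R - 2%:R * p%:~R = - (2 * P - n)%N%:R :> R[i].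
  by rewrite pE natrB// natrM -pmulrn opprB.
have -> : absz (2%:Z * p - n%:Z)%R = (2 * P - n)%N by rewrite pE; lia.
rewrite eta_barnes_zeta// pE eta_constE -/e.
have -> : (-1) ^ (1 - n%:Z) = - (-1) ^+ n :> R[i].
  by rewrite expfzDr ?oppr_eq0 ?oner_neq0// expr1z mulN1r -invr_expz -exprnP -exprVn invrN1.
have f0 : (2 * P - n)`!%:R != 0 :> R[i] by rewrite pnatr_eq0 -lt0n fact_gt0.
have s2 : (-1) ^+ n * (-1) ^+ n = 1 :> R[i] by rewrite -expr2 sqrr_sign.
have e0 : e ^+ (n * n.-1 %/ 2) != 0 by rewrite expf_neq0// eta_neq0.
set F := _`!%:R in f0 *; set s := (-1) ^+ n in s2 *; set T := twopii ^ _; set B := bern_sum _ _ _.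
move: (e ^+ _) e0 => E e0.
have -> : T * - s * 2 ^+ n.-1 / F * (F * (s * E^-1 * B)) = - (s * s) * (T * 2 ^+ n.-1 / E) * B.
  by field; rewrite f0 e0.
by rewrite s2; field.
Qed.
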